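(* Let $v\in L^1((0,T);C^{0,1}(\Omega;\mathbb R^2))$, with $v\cdot n=0$ on $\partial\Omega$ when $\Omega$ is a bounded domain. For each $N$ considered, with $h=\sqrt{|\Omega|/N}$, assume that the set $\mathcal M=\mathcal M_h\subset\Omega^N$ of minimizers of $\mathscr F$ over $\Omega^N$ is nonempty and compact, and let $r_h>0$ be small enough that every $X\in\overline{\mathcal U_{r_h}}$ has pairwise distinct generators, and that $\overline{\mathcal U_{r_h}}\subset\Omega^N$ when $\Omega$ is a bounded domain, where $\mathcal U_{r}:=\{X\in\Omega^N:\operatorname{dist}(X,\mathcal M)<r\}$. Assume that there is $C_1>0$, independent of $h$, such that $\mathscr D(X)\le C_1h$ for every $X\in\mathcal U_{r_h}$. Let $X^{h,0}\in\mathcal U_{r_h}$ satisfy $\mathscr F(X^{h,0})-\mathscr F^\ast<\delta_{r_h}$, where $\mathscr F^\ast=\inf_{\Omega^N}\mathscr F$ and $\delta_{r}:=\inf\{\mathscr F(X)-\mathscr F^\ast: X\in\overline{\mathcal U_{r}},\ \operatorname{dist}(X,\mathcal M)=r\}$. Let $\alpha_h\in L^1(0,T)$, $\alpha_h\ge0$, and $X^h=(x_1^h,\dots,x_N^h)$ be such that $X^h$ is the unique absolutely continuous solution on $[0,T]$ of $$\dot x_i^h(t)=v(t,x_i^h(t))+\alpha_h(t)\left(c_i(X^h(t))-x_i^h(t)\right),\quad 1\le i\le N,\qquad X^h(0)=X^{h,0},$$ and $X^h(t)\in\mathcal U_{r_h}$ for every $t\in[0,T]$. Set $A_h:=\int_0^T\alpha_h(t)\,dt$.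 There exists a constant $C_3>0$, depending only on $C_1$ and $\Omega$, with the following property. If $r_h\le C_3h$, then the following hold for every $t\in[0,T]$. (i) The generators stay separated: $|x_i^h(t)-x_j^h(t)|\ge2C_3h$ for $i\ne j$. (ii) The cell volumes $V_i^h(t):=|\Omega_i(X^h(t))|$ satisfy $V_i^h(t)\ge h^2/C_4$ and $V_i^h(t)\ge V_i^h(0)/C_4$. (iii) $\int_0^T\alpha_h(t)\mathscr G(X^h(t))\,dt\le C_4h^2$. (iv) If $\rho_0\in L^p(\Omega)$, $\rho_0\ge0$, for some $1<p\le\infty$, then $$B_h(T)\le C_5\,h\,A_h^{1/\min\{p,2\}},$$ where $$B_h(T):=\int_0^T e^{\Lambda(T)-\Lambda(s)}\alpha_h(s)\sum_{i=1}^N M_i^h\left|c_i(X^h(s))-x_i^h(s)\right|ds,\qquad M_i^h:=\int_{\Omega_i(X^h(0))}\rho_0\,dx .$$ The constant $C_4$ depends only on $C_1$, $\Omega$ and $\Lambda(T)$, and $C_5$ depends also on $p$ and $\|\rho_0\|_{L^p}$.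
   Context: Domain. $T>0$ is finite. $\Omega$ is either a bounded convex Lipschitz domain of $\mathbb R^2$ or a flat torus $\Omega=\mathbb R^2/\mathcal L$, where $\mathcal L=\mathbb Z\ell_1+\mathbb Z\ell_2$ with $\ell_1,\ell_2\in\mathbb R^2$ linearly independent. On the torus, $|x-y|=\min_{k\in\mathcal L}|\tilde x-\tilde y-k|$ denotes the torus distance ($\tilde x,\tilde y\in\mathbb R^2$ representatives); balls and diameters are understood accordingly, and functions on $\Omega$ are identified with $\mathcal L$-periodic functions on $\mathbb R^2$. Voronoi tessellation. For $X=(x_1,\dots,x_N)\in\Omega^N$ with pairwise distinct entries (generators), $\Omega_i(X):=\{x\in\Omega: |x-x_i|<|x-x_j|\ \text{for all } j\ne i\}$, $V_i(X):=|\Omega_i(X)|$, and $c_i(X):=V_i(X)^{-1}\int_{\Omega_i(X)}x\,dx$ is the centroid. On the torus, the displacement $c_i(X)-x_i\in\mathbb R^2$ is defined by $c_i-x_i=\frac1{V_i}\int_{P_i}(y-x_i)\,dy$, where, for representatives $x_j\in\mathbb R^2$, $P_i:=\{y\in\mathbb R^2:\ |y-x_i|\le|y-x_j-k|\ \text{for all } 1\le j\le N,\ k\in\mathcal L\}$ (Euclidean norms); it does not depend on the chosen representatives. Indicators. $\mathscr F(X):=\sum_{i}\int_{\Omega_i(X)}|x-x_i|^2\,dx=\int_\Omega\min_{1\le i\le N}|x-x_i|^2\,dx$, the last expression defining $\mathscr F$ on all of $\overline\Omega^N$ (also when generators coincide); $\mathscr G(X):=\sum_{i}V_i(X)|x_i-c_i(X)|^2$;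 $\mathscr D(X):=\max_i\operatorname{diam}(\Omega_i(X))$. $L(t):=\|v(t,\cdot)\|_{C^{0,1}(\Omega)}$ (in particular $v(t,\cdot)$ is $L(t)$-Lipschitz) and $\Lambda(t):=\int_0^tL(s)\,ds$. $\operatorname{dist}$ is the distance on $\Omega^N$ induced by $|X-Y|=(\sum_i|x_i-y_i|^2)^{1/2}$, closures are taken in $\overline\Omega^N$, and $\inf\emptyset=+\infty$. *)

(* Defs.v *)
From HB Require Import structures.
From mathcomp Require Import all_boot all_order all_algebra.
From mathcomp Require Import all_classical all_reals all_analysis.

Set Implicit Arguments.
Unset Strict Implicit.
Unset Printing Implicit Defensive.

Import Order.TTheory GRing.Theory Num.Theory.
Import numFieldNormedType.Exports.

Local Open Scope classical_set_scope.
Local Open Scope ring_scope.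

(* The library norm of [R * R] is the sup norm: it is used for the topology
   only, and every length below is the Euclidean one. *)
Notation plane R := (Real.sort R * Real.sort R)%type.

Definition dot (R : realType) (x y : plane R) : R := x.1 * y.1 + x.2 * y.2.

Definition enorm (R : realType) (x : plane R) : R :=
  Num.sqrt (x.1 ^+ 2 + x.2 ^+ 2).

Definition leb1 (R : realType) : {measure set (measurableTypeR R) -> \bar R} :=
  @lebesgue_measure R.

Definition leb2 (R : realType) :
    {measure set (measurableTypeR R * measurableTypeR R)%type -> \bar R} :=
  (@lebesgue_measure R \x @lebesgue_measure R)%E.

(* [Torus l1 l2] is the quotient of the plane by the lattice spanned by [l1] and
   [l2]. Its points are handled through arbitrary representatives in the plane;
   its subsets are lattice-invariant sets of representatives. *)
Inductive region (R : realType) :=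
  | Bounded of set (plane R)
  | Torus of plane R & plane R.

(* Locally, in orthonormal coordinates, the set is the strict epigraph of a
   Lipschitz function. *)
Definition lipschitz_boundary (R : realType) (U : set (plane R)) : Prop :=
  forall x : plane R, (closure U `\` interior U) x ->
  exists (e1 e2 : plane R) (a b : R) (g : R -> R) (k : R),
    [/\ [/\ enorm e1 = 1, enorm e2 = 1 & dot e1 e2 = 0], 0 < a, 0 < b,
        (forall s s', `|g s - g s'| <= k * `|s - s'|) &
        (forall s u, `|s| < a -> `|u| < b ->
           U (x + s *: e1 + u *: e2) <-> g s < u)].

Definition admissible (R : realType) (Om : region R) : Prop :=
  match Om with
  | Bounded U =>
      [/\ U !=set0, open U, bounded_set U,
          convex_set (U : set (convex_lmodType (plane R))) &
          lipschitz_boundary U]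
  | Torus l1 l2 => forall a b : R, a *: l1 + b *: l2 = 0 -> a = 0 /\ b = 0
  end.

Definition carrier (R : realType) (Om : region R) : set (plane R) :=
  match Om with Bounded U => U | Torus _ _ => setT end.

(* The trivial lattice in the bounded case lets both cases share the formulas
   below. *)
Definition lattice (R : realType) (Om : region R) : set (plane R) :=
  match Om with
  | Bounded _ => [set 0]
  | Torus l1 l2 => [set k | exists m n : int, k = m%:~R *: l1 + n%:~R *: l2]
  end.

(* Integrals over the region are integrals over [cell]: in the torus case, a
   fundamental parallelogram. *)
Definition cell (R : realType) (Om : region R) : set (plane R) :=
  match Om with
  | Bounded U => U
  | Torus l1 l2 => [set x | exists s u : R,
      [/\ 0 <= s < 1, 0 <= u < 1 & x = s *: l1 + u *: l2]]
  end.

Definition lattice_periodic (R : realType) (S : Type) (Om : region R)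
    (f : plane R -> S) : Prop :=
  forall x k, lattice Om k -> f (x + k) = f x.

Definition pdist (R : realType) (Om : region R) (x y : plane R) : R :=
  inf [set enorm (x - y - k) | k in lattice Om].

Definition area (R : realType) (Om : region R) (A : set (plane R)) : R :=
  fine (leb2 R (cell Om `&` A)).

Definition diam (R : realType) (Om : region R) (A : set (plane R)) : R :=
  sup [set pdist Om p.1 p.2 | p in A `*` A].

Definition mesh (R : realType) (Om : region R) (N : nat) : R :=
  Num.sqrt (area Om (carrier Om) / N%:R).

Definition config (R : realType) (N : nat) : Type := 'I_N -> plane R.

Definition configs (R : realType) (Om : region R) (N : nat) :
    set (config R N) :=
  [set X | forall i, carrier Om (X i)].
Arguments configs {R} Om N.

(* On the torus, equal points may have distinct representatives. *)
Definition distinct (R : realType) (Om : region R) (N : nat)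
    (X : config R N) : Prop :=
  forall i j, i != j -> ~ lattice Om (X i - X j).

Definition voronoi (R : realType) (Om : region R) (N : nat)
    (X : config R N) (i : 'I_N) : set (plane R) :=
  [set x | carrier Om x /\
           forall j, j != i -> pdist Om x (X i) < pdist Om x (X j)].

Definition volume (R : realType) (Om : region R) (N : nat)
    (X : config R N) (i : 'I_N) : R := area Om (voronoi Om X i).

Definition planar_voronoi (R : realType) (Om : region R) (N : nat)
    (X : config R N) (i : 'I_N) : set (plane R) :=
  [set y | forall j k, lattice Om k -> enorm (y - X i) <= enorm (y - X j - k)].

(* The displacement c_i - x_i. *)
Definition displacement (R : realType) (Om : region R) (N : nat)
    (X : config R N) (i : 'I_N) : plane R :=
  let V := volume Om X i in
  match Om with
  | Bounded _ =>
      ((V^-1 * \int[leb2 R]_(x in voronoi Om X i) (x.1 : R),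
        V^-1 * \int[leb2 R]_(x in voronoi Om X i) (x.2 : R)) : plane R) - X i
  | Torus _ _ =>
      (V^-1 * \int[leb2 R]_(y in planar_voronoi Om X i) (y.1 - (X i).1),
       V^-1 * \int[leb2 R]_(y in planar_voronoi Om X i) (y.2 - (X i).2))
  end.

(* For 0 < N the inner infimum is the minimum over the generators. *)
Definition energy (R : realType) (Om : region R) (N : nat)
    (X : config R N) : R :=
  \int[leb2 R]_(x in cell Om) inf (range (fun i => pdist Om x (X i) ^+ 2)).

Definition gap (R : realType) (Om : region R) (N : nat) (X : config R N) : R :=
  \sum_(i < N) volume Om X i * enorm (displacement Om X i) ^+ 2.

Definition max_diam (R : realType) (Om : region R) (N : nat)
    (X : config R N) : R :=
  \big[Num.max/0]_(i < N) diam Om (voronoi Om X i).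

Definition cdist (R : realType) (Om : region R) (N : nat)
    (X Y : config R N) : R :=
  Num.sqrt (\sum_(i < N) pdist Om (X i) (Y i) ^+ 2).

Definition dist_to (R : realType) (Om : region R) (N : nat)
    (A : set (config R N)) (X : config R N) : R :=
  inf [set cdist Om X Y | Y in A].

(* [cdist_compact] and [cdist_closure] unfold the library's [compact] and
   [closure] for the topology of [cdist]; on the torus this is a pseudo-distance
   on representatives. *)
Definition cdist_compact (R : realType) (Om : region R) (N : nat)
    (A : set (config R N)) : Prop :=
  forall F : set_system (config R N), ProperFilter F -> F A ->
  exists2 X, A X &
    forall B, F B -> forall e : R, 0 < e -> exists2 Y, B Y & cdist Om X Y < e.

Definition cdist_closure (R : realType) (Om : region R) (N : nat)
    (A : set (config R N)) : set (config R N) :=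
  [set X | forall e : R, 0 < e -> exists2 Y, A Y & cdist Om X Y < e].

Definition min_energy (R : realType) (Om : region R) (N : nat) : R :=
  inf [set energy Om X | X in configs Om N].
Arguments min_energy {R} Om N.

Definition minimizers (R : realType) (Om : region R) (N : nat) :
    set (config R N) :=
  [set X | configs Om N X /\ forall Y, configs Om N Y -> energy Om X <= energy Om Y].
Arguments minimizers {R} Om N.

Definition tube (R : realType) (Om : region R) (N : nat) (r : R) :
    set (config R N) :=
  [set X | configs Om N X /\ dist_to Om (minimizers Om N) X < r].
Arguments tube {R} Om N r.

Definition tube_closure (R : realType) (Om : region R) (N : nat) (r : R) :
    set (config R N) :=
  cdist_closure Om (tube Om N r).
Arguments tube_closure {R} Om N r.

(* Extended-real valued, so that the infimum of the empty set is [+oo]. *)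
Definition barrier (R : realType) (Om : region R) (N : nat) (r : R) : \bar R :=
  ereal_inf [set (energy Om X - min_energy Om N)%:E | X in
    [set X | tube_closure Om N r X /\ dist_to Om (minimizers Om N) X = r]].
Arguments barrier {R} Om N r.

Definition c01norm (R : realType) (Om : region R)
    (u : plane R -> plane R) : \bar R :=
  (ereal_sup [set (enorm (u x))%:E | x in carrier Om] +
   ereal_sup [set (enorm (u p.1 - u p.2) / pdist Om p.1 p.2)%:E | p in
     [set p | [/\ carrier Om p.1, carrier Om p.2 & p.1 <> p.2]]])%E.

Definition C01 (R : realType) (Om : region R) (u : plane R -> plane R) : Prop :=
  lattice_periodic Om u /\ (c01norm Om u < +oo)%E.

Definition simple_C01 (R : realType) (Om : region R)
    (s : R -> plane R -> plane R) : Prop :=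
  exists (m : nat) (E : 'I_m -> set R) (u : 'I_m -> plane R -> plane R),
    [/\ forall k, measurable (E k), forall k, C01 Om (u k) &
        forall t x, s t x = \sum_(k < m) (\1_(E k) t : R) *: u k x].

(* Bochner space L^1((0,T); C^{0,1}): almost everywhere limits, in norm, of
   simple functions, with integrable norm. *)
Definition L1_C01 (R : realType) (Om : region R) (T : R)
    (v : R -> plane R -> plane R) : Prop :=
  (exists s : nat -> R -> plane R -> plane R,
     (forall n, simple_C01 Om (s n)) /\
     {ae leb1 R, forall t, 0 < t < T -> C01 Om (v t) /\
        (c01norm Om (fun x => v t x - s n t x) @[n --> \oo] --> 0%E)}) /\
  (\int[leb1 R]_(t in `]0%R, T[) c01norm Om (v t) < +oo)%E.

(* [n] is the outward unit normal of [U] at [x]: at [x], the set is tangent to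
   the half plane of inner normal [- n]. For a Lipschitz boundary this is
   differentiability of the local graph at [x], so that there is at most one
   normal, and none at a corner. *)
Definition outward_normal (R : realType) (U : set (plane R))
    (x n : plane R) : Prop :=
  enorm n = 1 /\
  forall e : R, 0 < e -> exists2 d : R, 0 < d &
    forall y, enorm (y - x) < d ->
      (dot (y - x) n < - e * enorm (y - x) -> U y) /\
      (e * enorm (y - x) < dot (y - x) n -> ~ U y).

(* Boundary values are those of the continuous extension of [u]. On the torus
   the boundary is empty. *)
Definition tangential (R : realType) (Om : region R)
    (u : plane R -> plane R) : Prop :=
  forall x n : plane R,
    (closure (carrier Om) `\` interior (carrier Om)) x ->
    outward_normal (carrier Om) x n ->
    dot (u y) n @[y --> within (carrier Om) (nbhs x)] --> (0 : R).

Definition abs_continuous (R : realType) (a b : R) (f : R -> plane R) : Prop :=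
  forall e : R, 0 < e -> exists2 d : R, 0 < d &
    forall (m : nat) (p q : 'I_m -> R),
      (forall k, a <= p k /\ p k <= q k /\ q k <= b) ->
      trivIset setT (fun k => `]p k, q k[%classic) ->
      \sum_(k < m) (q k - p k) < d ->
      \sum_(k < m) enorm (f (q k) - f (p k)) < e.

(* Admissible values are configurations in the region with pairwise distinct
   generators, where the right-hand side is defined. On the torus this is the
   equation for the lift of a path to the plane that starts at the given
   representatives. *)
Definition solution (R : realType) (Om : region R) (N : nat) (T : R)
    (v : R -> plane R -> plane R) (alpha : R -> R)
    (X0 : config R N) (X : R -> config R N) : Prop :=
  [/\ X 0 = X0,
      forall t, 0 <= t <= T -> configs Om N (X t) /\ distinct Om (X t),
      forall i, abs_continuous 0 T (fun t => X t i) &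
      {ae leb1 R, forall t, 0 < t < T -> forall i,
         is_derive t 1 (fun s => X s i)
           (v t (X t i) + alpha t *: displacement Om (X t) i)}].

Definition Lam (R : realType) (Om : region R) (v : R -> plane R -> plane R)
    (t : R) : R :=
  fine (\int[leb1 R]_(s in `]0%R, t[) c01norm Om (v s))%E.

Definition Lp_norm (R : realType) (Om : region R) (p : \bar R)
    (rho : plane R -> R) : \bar R :=
  'N[leb2 R]_p [EFin \o (rho \_ (cell Om))].

Definition in_Lp (R : realType) (Om : region R) (p : \bar R)
    (rho : plane R -> R) : Prop :=
  [/\ lattice_periodic Om rho, measurable_fun (cell Om) rho &
      (Lp_norm Om p rho < +oo)%E].

Definition mass (R : realType) (Om : region R) (N : nat) (rho : plane R -> R)
    (X : config R N) (i : 'I_N) : R :=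
  \int[leb2 R]_(x in cell Om `&` voronoi Om X i) rho x.

Definition total_intensity (R : realType) (T : R) (alpha : R -> R) : R :=
  \int[leb1 R]_(t in `]0, T[) alpha t.

Definition drift (R : realType) (Om : region R) (N : nat) (T : R)
    (v : R -> plane R -> plane R) (alpha : R -> R) (rho : plane R -> R)
    (X : R -> config R N) : \bar R :=
  (\int[leb1 R]_(s in `]0%R, T[)
     (expR (Lam Om v T - Lam Om v s) * alpha s *
      \sum_(i < N) mass Om rho (X 0) i * enorm (displacement Om (X s) i))%:E)%E.

(* Main.v *)
Require Import Defs.
From mathcomp Require Import all_boot all_order all_algebra.
From mathcomp Require Import all_classical all_reals all_analysis.
From mathcomp Require Import measurable_realfun ess_sup_inf hoelder.
From mathcomp Require Import ring lra zify.
Import Order.TTheory GRing.Theory Num.Theory.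
Import numFieldNormedType.Exports.
Local Open Scope classical_set_scope.
Local Open Scope ring_scope.
Set Implicit Arguments.
Unset Strict Implicit.
Unset Printing Implicit Defensive.

(** The argument compares three things with the mesh size [h]: distances between
   generators, areas of cells and the energy along the flow.

   Separation. In a minimizer two generators cannot be much closer than [h]
   ([minimizer_separation]): some cell has at least the average area, so it has a
   point at distance of order [h] from all generators ([far_point]). Moving there one of
   two generators at distance [dl] gains an energy of order [h ^+ 4] on a ball around that
   point, while the cell left behind, of diameter at most [C1 * h], is taken over by the
   other generator at a cost of order [dl * h ^+ 3]. A configuration within [C3 * h] of a
   minimizer inherits the separation.

   Volumes. A ball of radius [C3 * h] around a generator meets the region in a proportion of
   its area ([ball_density]), by convexity or on the torus because the lattice is discrete;
   by the separation it belongs to the cell. Conversely a cell has radius at most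
   [C1 * h].

   Dissipation. Assigning each point to its old generator shows that the energy of a
   perturbed configuration is at most a quadratic polynomial in the perturbation
   ([energy_perturbation]). Along the flow this yields an upper bound on the right
   derivative of the energy: minus twice the intensity times [gap], plus the transport term
   [- 2 * \sum_i V_i (c_i - x_i) . v(x_i)]. Up to the square of the mesh size times the norm of
   [v], this transport term is minus the integral of the gradient of [near_sq] against [v];
   integrating by parts, or rather translating the region by a small vector and comparing the
   integrals ([transport_axis]), bounds it by [h ^+ 2] times the norm of [v]
   ([transport_bound]). The boundary contributes strips whose area is linear in the
   translation, by convexity ([strip_small]), and on which [near_sq] is of order [h ^+ 2].
   Integration in time, through a monotonicity criterion for absolutely continuous functions
   ([abs_cont_nonincreasing]), bounds the dissipated energy by the initial energy, of order
   [h ^+ 2], plus the total transport ([dissipation_bound]).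

   Drift. Let [q] be the minimum of [p] and 2. For a density value [s] and a displacement
   [D <= C1 * h], the inequality [s * D <= l * s ^ q + m * D ^ 2] holds as soon as
   [(C1 * h) ^ (2 - q) <= l * m ^ (q - 1)] ([power_split]). Integrated over the initial cells,
   whose volumes are comparable with the current ones, it bounds the drift by the total
   intensity times [l] plus the dissipation times [m] ([drift_le]); the best [l] and [m] produce
   the power of the total intensity.

   The function [gap] along a solution is not known to be measurable in time. Its integral is
   the supremum of the integrals of its measurable minorants, for which the estimates are
   proved ([integral_le_minorants]). *)

(** * Euclidean geometry of the plane *)

Section euclidean.
Context {R : realType}.
Implicit Types x y z : plane R.

Lemma plane_ext x y : x.1 = y.1 -> x.2 = y.2 -> x = y.
Proof. by case: x y => a b [c d] /= -> ->. Qed.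

Lemma enorm_ge0 x : 0 <= enorm x.
Proof. exact: sqrtr_ge0. Qed.

Lemma sqr_enorm x : enorm x ^+ 2 = x.1 ^+ 2 + x.2 ^+ 2.
Proof. by rewrite sqr_sqrtr// addr_ge0// sqr_ge0. Qed.

Lemma enorm_le x (a : R) : 0 <= a -> (enorm x <= a) = (x.1 ^+ 2 + x.2 ^+ 2 <= a ^+ 2).
Proof. by move=> a0; rewrite -sqr_enorm ler_sqr ?nnegrE ?enorm_ge0. Qed.

Lemma enorm0 : enorm (0 : plane R) = 0.
Proof. by rewrite /enorm /= expr0n /= addr0 sqrtr0. Qed.

Lemma enorm0_eq0 x : enorm x = 0 -> x = 0.
Proof.
move=> x0; have := sqr_enorm x; rewrite x0 expr0n /= => /esym/eqP.
rewrite paddr_eq0 ?sqr_ge0// !sqrf_eq0 => /andP[/eqP a /eqP b].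
exact: plane_ext.
Qed.

Lemma enormZ (a : R) x : enorm (a *: x) = `|a| * enorm x.
Proof.
rewrite /enorm /= /GRing.scale /= !exprMn -mulrDr sqrtrM ?sqr_ge0//.
by rewrite sqrtr_sqr.
Qed.

Lemma enormN x : enorm (- x) = enorm x.
Proof. by rewrite /enorm /= !sqrrN. Qed.

Lemma enormC x y : enorm (x - y) = enorm (y - x).
Proof. by rewrite -enormN opprB. Qed.

Lemma norm_dot x y : `|dot x y| <= enorm x * enorm y.
Proof.
rewrite -ler_sqr ?nnegrE ?mulr_ge0 ?enorm_ge0// real_normK ?num_real//.
rewrite exprMn !sqr_enorm /dot.
have : 0 <= (x.1 * y.2 - x.2 * y.1) ^+ 2 by apply: sqr_ge0.
by nra.
Qed.

Lemma enormD x y : enorm (x + y) <= enorm x + enorm y.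
Proof.
rewrite -ler_sqr ?nnegrE ?addr_ge0 ?enorm_ge0// sqrrD !sqr_enorm /=.
have := norm_dot x y; rewrite ler_norml => /andP[_]; rewrite /dot => H.
by rewrite mulr2n; nra.
Qed.

Lemma enorm_dist x y z : enorm (x - z) <= enorm (x - y) + enorm (y - z).
Proof.
have -> : x - z = (x - y) + (y - z) by rewrite addrA subrK.
exact: enormD.
Qed.

Lemma fst_le_enorm x : `|x.1| <= enorm x.
Proof.
rewrite -ler_sqr ?nnegrE ?enorm_ge0// real_normK ?num_real// sqr_enorm.
by rewrite lerDl sqr_ge0.
Qed.

Lemma snd_le_enorm x : `|x.2| <= enorm x.
Proof.
rewrite -ler_sqr ?nnegrE ?enorm_ge0// real_normK ?num_real// sqr_enorm.
by rewrite lerDr sqr_ge0.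
Qed.

Lemma enorm_le_sum x : enorm x <= `|x.1| + `|x.2|.
Proof.
rewrite enorm_le ?addr_ge0// sqrrD !real_normK ?num_real//.
by rewrite addrAC lerDl mulrn_wge0// mulr_ge0.
Qed.

Lemma sqr_enormB x y : enorm (x - y) ^+ 2 = enorm x ^+ 2 - 2 * dot x y + enorm y ^+ 2.
Proof. by rewrite !sqr_enorm /dot /=; ring. Qed.

Lemma sqr_enormD x y : enorm (x + y) ^+ 2 = enorm x ^+ 2 + 2 * dot x y + enorm y ^+ 2.
Proof. by rewrite !sqr_enorm /dot /=; ring. Qed.

Lemma dotDl x y z : dot (x + y) z = dot x z + dot y z.
Proof. by rewrite /dot /=; ring. Qed.

Lemma dotDr x y z : dot z (x + y) = dot z x + dot z y.
Proof. by rewrite /dot /=; ring. Qed.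

Lemma dotNl x y : dot (- x) y = - dot x y.
Proof. by rewrite /dot /=; ring. Qed.

Lemma dotNr x y : dot x (- y) = - dot x y.
Proof. by rewrite /dot /=; ring. Qed.

Lemma dotZl a x y : dot (a *: x) y = a * dot x y.
Proof. by rewrite /dot /= /GRing.scale /=; ring. Qed.

Lemma dotZr a x y : dot x (a *: y) = a * dot x y.
Proof. by rewrite /dot /= /GRing.scale /=; ring. Qed.

Lemma dotxx x : dot x x = enorm x ^+ 2.
Proof. by rewrite sqr_enorm /dot !expr2. Qed.

End euclidean.

(** * Lebesgue measure of the plane *)

(** [plane R] carries the product topology but no sigma-algebra; [mplane R] is the
   same type with the product of the Borel sigma-algebras, the domain of [leb2]. *)
Notation mplane R := (measurableTypeR R * measurableTypeR R)%type.

Section plane_measure.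
Context {R : realType}.
Implicit Types (x y a : plane R) (A B D : set (plane R)).

Lemma leb2X (A B : set (measurableTypeR R)) : measurable A -> measurable B ->
  leb2 R (A `*` B) = (leb1 R A * leb1 R B)%E.
Proof. exact: product_measure1E. Qed.

Lemma dist_lt_split (a b q d e : R) :
  `|q - a| < d -> `|q - b| < d -> d < e / 2 -> `|a - b| < e.
Proof. by rewrite !ltr_norml => /andP[? ?] /andP[? ?] ?; apply/andP; split; lra. Qed.

(** An open set is the union of the squares with rational centre and radius
   [1/(n+1)] that it contains; a square is a measurable rectangle. *)
Lemma measurable_open_plane (U : set (plane R)) : open U ->
  measurable (U : set (mplane R)).
Proof.
move=> oU.
pose b (q : rat * rat * nat) : set (plane R) :=
  ball (ratr q.1.1 : R) q.2.+1%:R^-1 `*` ball (ratr q.1.2 : R) q.2.+1%:R^-1.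
pose F (n : nat) : set (plane R) :=
  if unpickle n is Some q then if `[< b q `<=` U >] then b q else set0 else set0.
rewrite (_ : U = \bigcup_n F n).
  apply: bigcupT_measurable => n; rewrite /F.
  case: (unpickle n) => [q|]; last exact: measurable0.
  case: asboolP => _; last exact: measurable0.
  by apply: measurableX; exact: measurable_ball.
apply/seteqP; split => [x Ux|x [n _]]; last first.
  rewrite /F; case: (unpickle n) => [q|//]; case: asboolP => // bU; exact: bU.
have := open_nbhs_nbhs (conj oU Ux).
move=> /nbhs_ballP[e /= e0 be].
have [n] : exists n : nat, n.+1%:R^-1 < e / 2.
  exists (Num.truncn (e / 2)^-1).
  rewrite -[ltRHS]invrK ltf_pV2 ?posrE// ?invr_gt0 ?divr_gt0//.
  exact: truncnS_gt.
move=> ne.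
have n0 : (0 : R) < n.+1%:R^-1 by rewrite invr_gt0.
(* A rational within [1/(n+1)] of each coordinate: such a square contains [x] and
   has all its points within [2/(n+1) < e] of [x]. *)
have D z : exists q : rat, ball (ratr q : R) n.+1%:R^-1 z.
  have [|q] := rat_in_itvoo (x := z - n.+1%:R^-1) (y := z + n.+1%:R^-1).
    by rewrite ltrD2l (lt_trans _ n0)// oppr_lt0.
  rewrite in_itv /= => /andP[q1 q2]; exists q.
  by rewrite /ball /= ltr_distl q1 q2.
have [q1 h1] := D x.1; have [q2 h2] := D x.2.
exists (pickle (q1, q2, n)); [exact: I|rewrite /F pickleK].
case: asboolP => [_|]; first by split.
case => y [/= y1 y2]; apply: be; split => /=.
- exact: dist_lt_split h1 y1 ne.
- exact: dist_lt_split h2 y2 ne.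
Qed.

Lemma open_enorm_ball_sub (U : set (plane R)) :
  (forall x, U x -> exists2 e : R, 0 < e & forall y, enorm (y - x) < e -> U y) ->
  open U.
Proof.
move=> H; rewrite openE => x Ux; have [e e0 He] := H _ Ux.
apply/nbhs_ballP; exists (e / 2); first by rewrite /= divr_gt0.
move=> y [/= h1 h2]; apply: He.
apply: le_lt_trans (enorm_le_sum _) _.
move: h1 h2; rewrite /ball /= => h1 h2.
by rewrite distrC [X in _ + X]distrC (splitr e) ltrD.
Qed.

Lemma open_enorm_ball (U : set (plane R)) x : open U -> U x ->
  exists2 e : R, 0 < e & forall y, enorm (y - x) < e -> U y.
Proof.
move=> oU Ux; have := open_nbhs_nbhs (conj oU Ux).
move=> /nbhs_ballP[e /= e0 be]; exists e => // y yx; apply: be.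
split => /=; rewrite /ball /=.
  by apply: le_lt_trans yx; rewrite enormC; exact: (fst_le_enorm (x - y)).
by apply: le_lt_trans yx; rewrite enormC; exact: (snd_le_enorm (x - y)).
Qed.

(** A real function on an open set is Borel if it is locally controlled by the
   Euclidean distance; this covers all the distance functions below. *)
Lemma measurable_lipschitz (D : set (plane R)) (f : plane R -> R) (K : R) :
  open D -> (forall x y, D x -> D y -> `|f x - f y| <= K * enorm (x - y)) ->
  measurable_fun (D : set (mplane R)) (f : mplane R -> measurableTypeR R).
Proof.
move=> oD Lf.
apply: (measurability _ (RGenOInfty.measurableE R)).
move=> _ [_ [a ->] <-].
apply: measurable_open_plane; apply: open_enorm_ball_sub => x [Dx].
rewrite /= in_itv /= andbT => ax.
have [e e0 He] := open_enorm_ball oD Dx.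
pose M := `|K| + 1.
have M0 : 0 < M by rewrite ltr_wpDl.
exists (Num.min e ((f x - a) / M)).
  by rewrite lt_min e0 divr_gt0// subr_gt0.
move=> y; rewrite lt_min => /andP[ye yM].
have Dy := He _ ye; split => //; rewrite /= in_itv /= andbT.
have := Lf _ _ Dy Dx; rewrite ler_norml => /andP[h _].
move: yM; rewrite ltr_pdivlMr// => yM.
have : K * enorm (y - x) <= enorm (y - x) * M.
  rewrite mulrC ler_wpM2l ?enorm_ge0// (le_trans (ler_norm K))// lerDl.
  exact: ler01.
by lra.
Qed.

Lemma measurable_fun_shift a :
  measurable_fun setT ((fun x => x + a) : mplane R -> mplane R).
Proof.
apply/measurable_fun_pairP; split => /=.
  apply: (@measurable_funD _ _ R); first exact: measurable_fst.
  exact: measurable_cst.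
apply: (@measurable_funD _ _ R); first exact: measurable_snd.
exact: measurable_cst.
Qed.

Lemma measurable_shift a D : measurable (D : set (mplane R)) ->
  measurable ([set x | D (x + a)] : set (mplane R)).
Proof.
by move=> mD; have := measurable_fun_shift a measurableT mD; rewrite setTI.
Qed.

Implicit Type z : plane R.

Lemma leb1_shift (c : R) (A : set (measurableTypeR R)) : measurable A ->
  leb1 R [set t | A (t + c)] = leb1 R A.
Proof.
have mf : measurable_fun setT ((fun t => t + c) : measurableTypeR R -> measurableTypeR R).
  by apply: measurable_funD => //; exact: measurable_cst.
move=> mA; apply/esym.
apply: (@lebesgue_measure_unique R (pushforward (@lebesgue_measure R) ((fun t => t + c) : measurableTypeR R -> measurableTypeR R))) => //.
move=> _ [[a b]] _ <-; rewrite /pushforward.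
transitivity (lebesgue_measure (`]a - c, b - c]%classic : set R)).
  by rewrite !lebesgue_measure_itv /= !lte_fin ltrD2r -!EFinB opprD opprK addrACA addNr addr0.
by congr lebesgue_measure; apply/seteqP; split => t; rewrite /= !in_itv /= ltrBlDr lerBrDr.
Qed.

Lemma leb2_shift a A : measurable (A : set (mplane R)) ->
  leb2 R [set x | A (x + a)] = leb2 R A.
Proof.
have mf := measurable_fun_shift a.
move=> mA; apply/esym.
apply: (@product_measure_unique _ _ _ _ R (@lebesgue_measure R) (@lebesgue_measure R)
  (pushforward (leb2 R) (fun x : mplane R => x + a : mplane R))) => // B C mB mC.
transitivity (leb2 R ([set t : measurableTypeR R | B (t + a.1)] `*`
    [set t : measurableTypeR R | C (t + a.2)])) => //.
rewrite leb2X; last 2 first.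
- have /(_ measurableT _ mB) : measurable_fun setT ((fun t => t + a.1) : measurableTypeR R -> measurableTypeR R).
    by apply: measurable_funD => //; exact: measurable_cst.
  by rewrite setTI.
- have /(_ measurableT _ mC) : measurable_fun setT ((fun t => t + a.2) : measurableTypeR R -> measurableTypeR R).
    by apply: measurable_funD => //; exact: measurable_cst.
  by rewrite setTI.
by rewrite !leb1_shift.
Qed.

(** Invariance of the measure gives the nonnegative case by pushforward; positive and
   negative parts give the rest. *)
Lemma integral_shift a A (f : plane R -> \bar R) :
  measurable (A : set (mplane R)) ->
  measurable_fun (A : set (mplane R)) (f : mplane R -> \bar R) ->
  (\int[leb2 R]_(x in [set x | A (x + a)%R]) f (x + a)%R)%E = (\int[leb2 R]_(x in A) f x)%E.
Proof.
have nneg (g : plane R -> \bar R) : measurable (A : set (mplane R)) ->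
    measurable_fun (A : set (mplane R)) (g : mplane R -> \bar R) -> (forall x, 0 <= g x)%E ->
    (\int[leb2 R]_(x in [set x | A (x + a)%R]) g (x + a)%R)%E = (\int[leb2 R]_(x in A) g x)%E.
  move=> mA mg g0.
  have E := ge0_integral_pushforward (measurable_fun_shift a) (leb2 R) mA mg (fun y _ => g0 y).
  apply: etrans (esym E) _.
  apply: eq_measure_integral => [|? B mB BA].
    exact: measurable_fun_shift.
  exact: leb2_shift.
move=> mA mf; rewrite integralE [RHS]integralE; congr (_ - _)%E.
- have <- := nneg _ mA (measurable_funepos mf) (funepos_ge0 f).
  by apply: eq_integral => x _; rewrite !funeposE.
- have <- := nneg _ mA (measurable_funeneg mf) (funeneg_ge0 f).
  by apply: eq_integral => x _; rewrite !funenegE.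
Qed.

Lemma measurable_enorm_lt z r : measurable ([set y | enorm (y - z) < r] : set (mplane R)).
Proof.
apply: measurable_open_plane; apply: open_enorm_ball_sub => y /= yz.
exists (r - enorm (y - z)); first by rewrite subr_gt0.
by move=> w; rewrite ltrBrDr; apply: le_lt_trans; exact: enorm_dist.
Qed.

Lemma leb1_itv (b c : bool) (s t : R) : s <= t ->
  leb1 R [set` Interval (BSide b s) (BSide c t)] = (t - s)%:E.
Proof.
move=> st; apply: etrans (lebesgue_measure_itv _) _ => /=.
rewrite lte_fin; case: ltP => [_|ts]; first by rewrite EFinB.
have -> : s = t by apply/eqP; rewrite eq_le st ts.
by rewrite subrr.
Qed.

(** The square circumscribed to the ball is measured instead of the ball; only the
   order of magnitude matters. *)
Lemma leb2_ball_le z (r : R) A : 0 <= r -> measurable (A : set (mplane R)) ->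
  (forall y, A y -> enorm (y - z) <= r) -> (leb2 R A <= (4 * r ^+ 2)%:E)%E.
Proof.
move=> r0 mA H.
have E : leb2 R (`[z.1 - r, z.1 + r]%classic `*` `[z.2 - r, z.2 + r]%classic) = (4 * r ^+ 2)%:E.
  rewrite leb2X//.
  by rewrite !leb1_itv; [rewrite -EFinM; congr EFin; ring|lra|lra].
rewrite -E; apply: le_measure; rewrite ?inE//.
  by apply: measurableX; exact: measurable_itv.
move=> y /H yz; split => /=; rewrite in_itv /=.
  have := le_trans (fst_le_enorm (y - z)) yz; rewrite /= ler_norml => /andP[]; lra.
have := le_trans (snd_le_enorm (y - z)) yz; rewrite /= ler_norml => /andP[]; lra.
Qed.

(** The square with vertices inside the ball plays the same role from below. *)
Lemma leb2_ball_ge z (r : R) A : 0 < r -> measurable (A : set (mplane R)) ->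
  (forall y, enorm (y - z) < r -> A y) -> ((r ^+ 2)%:E <= leb2 R A)%E.
Proof.
move=> r0 mA H.
have E : leb2 R (`]z.1 - r / 2, z.1 + r / 2[%classic `*` `]z.2 - r / 2, z.2 + r / 2[%classic) = (r ^+ 2)%:E.
  rewrite leb2X//.
  by rewrite !leb1_itv; [rewrite -EFinM; congr EFin; field|lra|lra].
rewrite -E; apply: le_measure; rewrite ?inE//.
  by apply: measurableX; exact: measurable_itv.
move=> y [/=]; rewrite !in_itv /= => /andP[h1 h2] /andP[h3 h4]; apply: H.
apply: le_lt_trans (enorm_le_sum _) _ => /=.
have : `|y.1 - z.1| < r / 2 by rewrite ltr_norml; apply/andP; split; lra.
have : `|y.2 - z.2| < r / 2 by rewrite ltr_norml; apply/andP; split; lra.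
lra.
Qed.

Lemma open_halfplane a (c : R) : open [set x | dot a x < c].
Proof.
have na : 0 < enorm a + 1 by rewrite ltr_wpDl ?enorm_ge0.
apply: open_enorm_ball_sub => x /= dx; exists ((c - dot a x) / (enorm a + 1)).
  by rewrite divr_gt0// subr_gt0.
move=> y; rewrite ltr_pdivlMr//.
have := norm_dot a (y - x); rewrite dotDr dotNr ler_norml => /andP[_ h1 h2].
have := enorm_ge0 (y - x); nra.
Qed.

(** A vertical line is a product with a point; any other line has
   one point in each vertical section. *)
Lemma leb2_line a (c : R) : a <> 0 -> leb2 R [set x | dot a x = c] = 0%E.
Proof.
move=> a0.
have mL : measurable ([set x | dot a x = c] : set (mplane R)).
  rewrite (_ : [set _ | _] = ~` [set x | dot a x < c] `&` ~` [set x | - dot a x < - c]); last first.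
    apply/seteqP; split => x /=.
      by move=> ->; split; rewrite ltxx.
    by rewrite ltrN2 => -[/negP h1 /negP h2]; apply/eqP; rewrite eq_le leNgt h2 leNgt h1.
  apply: measurableI; apply: measurableC; apply: measurable_open_plane.
    exact: open_halfplane.
  rewrite (_ : [set _ | _] = [set x | dot (- a) x < - c]); first exact: open_halfplane.
  by apply/seteqP; split => x /=; rewrite dotNl.
have [a2|a2] := eqVneq a.2 0.
  have a1 : a.1 != 0.
    by apply/eqP => a1; apply: a0; exact: plane_ext.
  rewrite (_ : [set x | dot a x = c] = [set c / a.1] `*` setT); last first.
    apply/seteqP; split => x /=; rewrite /dot a2 mul0r addr0.
      by move=> <-; split=> //; rewrite mulrAC divff// mul1r.
    by move=> [->] _; rewrite mulrC divfK.
  rewrite leb2X//.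
  have -> : leb1 R [set c / a.1] = 0%E := lebesgue_measure_set1 _.
  by rewrite mul0e.
rewrite /leb2 /= /product_measure1 /=.
rewrite (eq_integral (cst 0%E)) ?integral0// => x _ /=.
have S : xsection [set x | dot a x = c] x `<=` [set (c - a.1 * x) / a.2].
  move=> y; rewrite /xsection /= inE /= /dot /= => <-.
  by rewrite addrAC subrr add0r mulrAC divff// mul1r.
have mS : measurable ([set (c - a.1 * x) / a.2] : set (measurableTypeR R)).
  exact: measurable_set1.
apply: (subset_measure0 (measurable_xsection x mL) mS S).
exact: lebesgue_measure_set1.
Qed.

Lemma integrable_bounded (A : set (plane R)) (f : plane R -> R) (K : R) :
  measurable (A : set (mplane R)) -> (leb2 R A < +oo)%E ->
  measurable_fun (A : set (mplane R)) (f : mplane R -> measurableTypeR R) ->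
  (forall x, A x -> `|f x| <= K) ->
  (leb2 R).-integrable (A : set (mplane R)) (EFin \o f).
Proof.
move=> mA fA mf fK; apply: measurable_bounded_integrable => //.
exists K; split; first exact: num_real.
by move=> M KM x Ax /=; exact: le_trans (fK _ Ax) (ltW KM).
Qed.

End plane_measure.

(** * Lattice and fundamental cell *)

Section torus_coordinates.
Context {R : realType}.
Variables (l1 l2 : plane R).
Implicit Types (x y : plane R).

(** Coordinates in the basis [(l1, l2)], written as inner products with the dual
   basis, so that they inherit linearity and the Cauchy-Schwarz bound. *)
Let det := l1.1 * l2.2 - l1.2 * l2.1.
Definition coord1 x := dot (det^-1 *: (l2.2, - l2.1)) x.
Definition coord2 x := dot (det^-1 *: (- l1.2, l1.1)) x.

Hypothesis indep : forall a b : R, a *: l1 + b *: l2 = 0 -> a = 0 /\ b = 0.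

Lemma lattice_det_neq0 : det != 0.
Proof.
apply/eqP => d0.
have [] := indep (a := l2.2) (b := - l1.2).
  by apply: plane_ext; move: d0; rewrite /= /GRing.scale /= /det => d0; lra.
move=> l22 /eqP; rewrite oppr_eq0 => /eqP l12.
have [] := indep (a := l2.1) (b := - l1.1).
  by apply: plane_ext; move: d0; rewrite /= /GRing.scale /= /det => d0; lra.
move=> l21 /eqP; rewrite oppr_eq0 => /eqP l11.
have [] := indep (a := 1) (b := 0); last by move=> /eqP; rewrite oner_eq0.
by apply: plane_ext; rewrite /= /GRing.scale /= ?l11 ?l12 ?mulr0 ?mul0r addr0.
Qed.

Lemma coordE x : x = coord1 x *: l1 + coord2 x *: l2.
Proof.
have := lattice_det_neq0; rewrite /coord1 /coord2 /dot /=.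
by move=> d0; apply: plane_ext; rewrite /= /GRing.scale /= /det; field.
Qed.

Lemma coord_comb (a b : R) : coord1 (a *: l1 + b *: l2) = a /\ coord2 (a *: l1 + b *: l2) = b.
Proof.
have := lattice_det_neq0; rewrite /coord1 /coord2 /dot /=.
by move=> d0; rewrite /GRing.scale /= /det; split; field.
Qed.

Lemma coord1D x y : coord1 (x + y) = coord1 x + coord1 y.
Proof. exact: dotDr. Qed.

Lemma coord2D x y : coord2 (x + y) = coord2 x + coord2 y.
Proof. exact: dotDr. Qed.

Definition coord_bound := enorm (det^-1 *: (l2.2, - l2.1)) + enorm (det^-1 *: (- l1.2, l1.1)).

Lemma norm_coord1 x : `|coord1 x| <= coord_bound * enorm x.
Proof.
apply: le_trans (norm_dot _ _) _; rewrite ler_wpM2r ?enorm_ge0//.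
by rewrite lerDl enorm_ge0.
Qed.

Lemma norm_coord2 x : `|coord2 x| <= coord_bound * enorm x.
Proof.
apply: le_trans (norm_dot _ _) _; rewrite ler_wpM2r ?enorm_ge0//.
by rewrite lerDr enorm_ge0.
Qed.

Lemma coord_bound_gt0 : 0 < coord_bound.
Proof.
rewrite lt_neqAle addr_ge0 ?enorm_ge0// andbT eq_sym paddr_eq0 ?enorm_ge0//.
apply/negP => /andP[/eqP/enorm0_eq0 h1 _].
have [/eqP] := coord_comb 1 0; rewrite /coord1 h1 /dot /= !mul0r addr0 => /eqP/esym/eqP.
by rewrite oner_eq0.
Qed.

End torus_coordinates.

Section region_geometry.
Context {R : realType}.
Variable (Om : region R).
Hypothesis hOm : admissible Om.
Implicit Types (x y z k : plane R).

Lemma lattice0 : lattice Om 0.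
Proof.
case: Om => [U|l1 l2] //=; exists 0, 0.
by rewrite mulr0z !scale0r addr0.
Qed.

Lemma latticeD k k' : lattice Om k -> lattice Om k' -> lattice Om (k + k').
Proof.
case: Om => [U|l1 l2] /=; first by move=> -> ->; rewrite addr0.
move=> [m [n ->]] [m' [n' ->]]; exists (m + m'), (n + n').
by rewrite !intrD !scalerDl addrACA.
Qed.

Lemma latticeN k : lattice Om k -> lattice Om (- k).
Proof.
case: Om => [U|l1 l2] /=; first by move=> ->; rewrite oppr0.
move=> [m [n ->]]; exists (- m), (- n).
by rewrite !mulrNz !scaleNr opprD.
Qed.

Lemma latticeB k k' : lattice Om k -> lattice Om k' -> lattice Om (k - k').
Proof. by move=> hk hk'; apply: latticeD => //; exact: latticeN. Qed.

(** An injective enumeration of the lattice; the indices that code nothing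
   map to [None]. *)
Definition lattice_seq (n : nat) : option (plane R) :=
  match Om with
  | Bounded _ => if n == 0%N then Some 0 else None
  | Torus l1 l2 =>
      omap (fun p : int * int => p.1%:~R *: l1 + p.2%:~R *: l2) (pickle_inv n)
  end.

Lemma lattice_seq_in n k : lattice_seq n = Some k -> lattice Om k.
Proof.
rewrite /lattice_seq; case: Om => [U|l1 l2] /=.
  by case: eqP => // _ [<-].
by case: pickle_inv => [[m n']|//] /= [<-]; exists m, n'.
Qed.

Lemma lattice_seq_surj k : lattice Om k -> exists n, lattice_seq n = Some k.
Proof.
rewrite /lattice_seq; case: Om => [U|l1 l2] /=.
  by move=> ->; exists 0%N; rewrite eqxx.
by move=> [m [n ->]]; exists (pickle (m, n)); rewrite pickleK_inv.
Qed.

Lemma lattice_seq_inj n n' k : lattice_seq n = Some k -> lattice_seq n' = Some k ->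
  n = n'.
Proof.
move: hOm; rewrite /lattice_seq; case: Om => [U|l1 l2] /= h.
  by case: eqP => // -> _; case: eqP.
have := pickle_invK (T := (int * int)%type) n; have := pickle_invK (T := (int * int)%type) n'.
case: pickle_inv => [[a b]|//] /= <-; case: pickle_inv => [[c d]|//] /= <-.
move=> /Some_inj <- /Some_inj E.
have [A B] := coord_comb h a%:~R b%:~R; have [C F] := coord_comb h c%:~R d%:~R.
by move: C F; rewrite -E A B => /intr_inj -> /intr_inj ->.
Qed.

Lemma carrierD x k : lattice Om k -> carrier Om (x + k) <-> carrier Om x.
Proof. by case: Om => [U|l1 l2] //= ->; rewrite addr0. Qed.

Lemma cell_carrier x : cell Om x -> carrier Om x.
Proof. by case: Om. Qed.

Lemma carrier_cell x : carrier Om x -> exists2 k, lattice Om k & cell Om (x - k).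
Proof.
move: hOm; case: Om => [U|l1 l2] /= h; first by exists 0 => //; rewrite subr0.
move=> _; pose m := Num.floor (coord1 l1 l2 x); pose n := Num.floor (coord2 l1 l2 x).
exists (m%:~R *: l1 + n%:~R *: l2); first by exists m, n.
exists (coord1 l1 l2 x - m%:~R), (coord2 l1 l2 x - n%:~R).
have /andP[m1 m2] := floor_itv (coord1 l1 l2 x).
have /andP[n1 n2] := floor_itv (coord2 l1 l2 x).
move: m2 n2; rewrite !intrD => m2 n2.
split; [apply/andP; split; rewrite /m; lra|apply/andP; split; rewrite /n; lra|].
by rewrite !scalerBl {1}(coordE h x) opprD addrACA.
Qed.

(** The coordinates of two points of the cell differ by less than 1, and those of a
   lattice point are integers. *)
Lemma cell_unique x k : lattice Om k -> cell Om x -> cell Om (x - k) -> k = 0.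
Proof.
move: hOm; case: Om => [U|l1 l2] /= h; first by move=> ->.
move=> [m [n ->]] [s [u [s1 u1 ->]]] [s' [u' [s2 u2]]] E.
have [A B] := coord_comb h s u; have [C F] := coord_comb h s' u'.
have [G H] := coord_comb h m%:~R n%:~R.
have : s *: l1 + u *: l2 = (s' *: l1 + u' *: l2) + (m%:~R *: l1 + n%:~R *: l2).
  by rewrite -E subrK.
move=> E'.
have E1 := congr1 (coord1 l1 l2) E'; have E2 := congr1 (coord2 l1 l2) E'.
move: E1 E2; rewrite A B coord1D coord2D C F G H => E1 E2.
have Z (a b : R) (p : int) : 0 <= a < 1 -> 0 <= b < 1 -> a = b + p%:~R -> p = 0.
  move=> /andP[a0 a1] /andP[b0 b1] ab.
  have p1 : p < 1 by rewrite -(ltr_int R) mulr1z; lra.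
  have p2 : -1 < p by rewrite -(ltr_int R) mulrN1z; lra.
  by move: p1 p2; clear; case: p => [[|n]|[|n]].
by rewrite (Z _ _ _ s1 s2 E1) (Z _ _ _ u1 u2 E2) mulr0z !scale0r addr0.
Qed.

Lemma open_carrier : open (carrier Om).
Proof. by move: hOm; case: Om => [U []|l1 l2 _] /= *; [assumption|exact: openT]. Qed.

Lemma measurable_carrier : measurable (carrier Om : set (mplane R)).
Proof. apply: measurable_open_plane; exact: open_carrier. Qed.

Lemma measurable_cell : measurable (cell Om : set (mplane R)).
Proof.
move: hOm; case: Om => [U []|l1 l2 h] /=; first by move=> *; exact: measurable_open_plane.
rewrite (_ : [set _ | _] =
    (~` [set x | coord1 l1 l2 x < 0] `&` [set x | coord1 l1 l2 x < 1]) `&`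
    (~` [set x | coord2 l1 l2 x < 0] `&` [set x | coord2 l1 l2 x < 1])).
  by do 2 apply: measurableI; (try apply: measurableC);
    apply: measurable_open_plane; exact: open_halfplane.
apply/seteqP; split => x /=.
  move=> [s [u [/andP[s0 s1] /andP[u0 u1] ->]]].
  by have [-> ->] := coord_comb h s u; do 2 split => //; apply/negP; rewrite -leNgt.
move=> [[/negP h1 h2] [/negP h3 h4]]; exists (coord1 l1 l2 x), (coord2 l1 l2 x).
by rewrite -coordE// leNgt h1 h2 leNgt h3 h4.
Qed.

Lemma cell_bounded : exists2 B : R, 0 < B & forall x, cell Om x -> enorm x <= B.
Proof.
move: hOm; case: Om => [U [_ _ bU _ _]|l1 l2 h] /=.
  have [M [_ /(_ (`|M| + 1))]] := bU.
  rewrite (le_lt_trans (ler_norm _)) ?ltrDl// => /(_ isT) H.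
  exists (2 * (`|M| + 1)) => [|x Ux].
    by rewrite mulr_gt0// ltr_wpDl.
  have := H x Ux; rewrite /= prod_normE ge_max => /andP[h1 h2].
  apply: le_trans (enorm_le_sum _) _; lra.
exists (enorm l1 + enorm l2 + 1); first by rewrite ltr_wpDl// addr_ge0 ?enorm_ge0.
move=> x [s [u [/andP[s0 s1] /andP[u0 u1] ->]]].
apply: le_trans (enormD _ _) _; rewrite !enormZ !ger0_norm//.
have := enorm_ge0 l1; have := enorm_ge0 l2; nra.
Qed.

Lemma leb2_cell_lty : (leb2 R (cell Om) < +oo)%E.
Proof.
have [B B0 hB] := cell_bounded.
apply: le_lt_trans (ltry (4 * B ^+ 2)); apply: (@leb2_ball_le _ 0).
- exact: ltW.
- exact: measurable_cell.
- by move=> y /hB; rewrite subr0.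
Qed.

End region_geometry.

(** * The distance of the region *)

Section pdist_theory.
Context {R : realType}.
Variable (Om : region R).
Hypothesis hOm : admissible Om.
Implicit Types (x y z k : plane R).

(** A lattice point closer to [z] than the origin has norm at most [2 * enorm z], hence
   integer coordinates in a fixed range: the minimum is taken over a finite set. *)
Lemma lattice_nearest z : exists2 k, lattice Om k &
  forall k', lattice Om k' -> enorm (z - k) <= enorm (z - k').
Proof.
move: hOm; case: Om => [U|l1 l2] /= h; first by exists 0 => // k ->.
pose B := coord_bound l1 l2 * (2 * enorm z).
have B0 : 0 <= B by rewrite mulr_ge0 ?(ltW (coord_bound_gt0 h))// mulr_ge0 ?enorm_ge0.
pose N := (Num.truncn B).+1.
have BN : B <= N%:R by exact/ltW/truncnS_gt.
pose kk (p : 'I_(2 * N).+1 * 'I_(2 * N).+1) : plane R :=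
  ((p.1 : nat)%:Z - N%:Z)%:~R *: l1 + ((p.2 : nat)%:Z - N%:Z)%:~R *: l2.
have [p _ Hp] := arg_minP (fun p => enorm (z - kk p)) (isT : xpredT (ord0, ord0)).
exists (kk p); first by exists ((p.1 : nat)%:Z - N%:Z), ((p.2 : nat)%:Z - N%:Z).
have surj (m : int) : `|m%:~R| <= B -> exists i : 'I_(2 * N).+1, m = (i : nat)%:Z - N%:Z.
  move=> mB; have : `|m%:~R| <= N%:R :> R by exact: le_trans mB BN.
  rewrite -intr_norm -[N%:R]/(N%:Z%:~R) ler_int => mN.
  have i1 : (absz (m + N%:Z)%R < (2 * N).+1)%N by clear -mN; lia.
  by exists (Ordinal i1) => /=; clear -mN; lia.
have small k : lattice (Torus l1 l2) k -> enorm (z - k) <= enorm z -> exists p, k = kk p.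
  move=> [m [n ->]] hk.
  have k2 : enorm (m%:~R *: l1 + n%:~R *: l2) <= 2 * enorm z.
    have := enorm_dist (m%:~R *: l1 + n%:~R *: l2) z 0; rewrite !subr0 enormC; lra.
  have cb := ltW (coord_bound_gt0 h).
  have [A C] := coord_comb h m%:~R n%:~R.
  have [|i Ei] := surj m.
    by rewrite -A (le_trans (norm_coord1 _ _ _))// ler_wpM2l.
  have [|j Ej] := surj n.
    by rewrite -C (le_trans (norm_coord2 _ _ _))// ler_wpM2l.
  by exists (i, j); rewrite Ei Ej.
move=> k' hk'.
have [hz|hz] := leP (enorm (z - k')) (enorm z).
  by have [q ->] := small _ hk' hz; exact: Hp.
have [q q0] : exists q, 0 = kk q.
  by apply: small; [exists 0, 0; rewrite mulr0z !scale0r addr0|rewrite subr0].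
apply: le_trans (ltW hz); have := Hp q isT; rewrite -q0 subr0; exact.
Qed.

(** The infimum that defines the distance is a minimum, which turns every statement
   about [pdist] into one about a single translate. *)
Lemma pdist_attained x y : exists k, [/\ lattice Om k,
  pdist Om x y = enorm (x - y - k) &
  forall k', lattice Om k' -> enorm (x - y - k) <= enorm (x - y - k')].
Proof.
have [k hk H] := lattice_nearest (x - y); exists k; split => //.
apply/eqP; rewrite eq_le; apply/andP; split.
  apply: ge_inf; last by exists k.
  by exists 0 => _ [k' _ <-]; exact: enorm_ge0.
apply: lb_le_inf; first by exists (enorm (x - y - k)), k.
by move=> _ [k' hk' <-]; exact: H.
Qed.

Lemma pdist_le x y k : lattice Om k -> pdist Om x y <= enorm (x - y - k).
Proof. by move=> hk; have [k' [_ -> ]] := pdist_attained x y; apply. Qed.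

Lemma pdist_le_enorm x y : pdist Om x y <= enorm (x - y).
Proof. by have := pdist_le x y (lattice0 Om); rewrite subr0. Qed.

Lemma pdist_ge0 x y : 0 <= pdist Om x y.
Proof. by have [k [_ -> _]] := pdist_attained x y; exact: enorm_ge0. Qed.

Lemma pdistxx x : pdist Om x x = 0.
Proof.
by apply/eqP; rewrite eq_le pdist_ge0 andbT; have := pdist_le_enorm x x; rewrite subrr enorm0.
Qed.

Lemma pdist_eq0 x y : pdist Om x y = 0 -> lattice Om (x - y).
Proof.
have [k [hk -> _]] := pdist_attained x y => /enorm0_eq0/eqP.
by rewrite subr_eq0 => /eqP ->.
Qed.

Lemma pdistC x y : pdist Om x y = pdist Om y x.
Proof.
suff H u w : pdist Om u w <= pdist Om w u by apply/eqP; rewrite eq_le !H.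
have [k [hk -> _]] := pdist_attained w u.
have -> : enorm (w - u - k) = enorm (u - w - (- k)).
  by rewrite -enormN !opprB opprK addrC.
by apply: pdist_le; exact: latticeN.
Qed.

Lemma pdist_triangle x y z : pdist Om x z <= pdist Om x y + pdist Om y z.
Proof.
have [k [hk -> _]] := pdist_attained x y; have [k' [hk' -> _]] := pdist_attained y z.
apply: le_trans (pdist_le x z (latticeD hk hk')) _.
have -> : x - z - (k + k') = (x - y - k) + (y - z - k').
  by rewrite addrACA -opprD; congr (_ - _); rewrite addrA subrK.
exact: enormD.
Qed.

Lemma pdistDl x y k : lattice Om k -> pdist Om (x + k) y = pdist Om x y.
Proof.
move=> hk; suff H u c : lattice Om c -> pdist Om (u + c) y <= pdist Om u y.
  apply/eqP; rewrite eq_le H//=.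
  by have := H (x + k) _ (latticeN hk); rewrite addrK.
move=> hc; have [k' [hk' -> _]] := pdist_attained u y.
have -> : u - y - k' = u + c - y - (c + k').
  by apply: plane_ext => /=; ring.
by apply: pdist_le; exact: latticeD.
Qed.

Lemma pdistDr x y k : lattice Om k -> pdist Om x (y + k) = pdist Om x y.
Proof. by move=> hk; rewrite pdistC pdistDl// pdistC. Qed.

Lemma pdist_lipschitz x y z : `|pdist Om x z - pdist Om y z| <= enorm (x - y).
Proof.
have h u w : pdist Om u z - pdist Om w z <= enorm (u - w).
  rewrite lerBlDr; apply: le_trans (pdist_triangle u w z) _.
  by rewrite lerD2r pdist_le_enorm.
by rewrite ler_norml h andbT lerNl opprB enormC h.
Qed.

Lemma pdist_gt0 x y : ~ lattice Om (x - y) -> 0 < pdist Om x y.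
Proof.
by move=> h; rewrite lt_neqAle pdist_ge0 andbT eq_sym; apply/eqP => /pdist_eq0.
Qed.

Lemma pdist_bounded : exists2 B : R, 0 < B & forall x y, carrier Om x -> carrier Om y ->
  pdist Om x y <= B.
Proof.
have [B B0 H] := cell_bounded hOm; exists (2 * B); first by rewrite mulr_gt0.
move=> x y /(carrier_cell hOm)[k hk cx] /(carrier_cell hOm)[k' hk' cy].
rewrite -(pdistDl _ _ (latticeN hk)) -(pdistDr _ _ (latticeN hk')).
apply: le_trans (pdist_le_enorm _ _) _; apply: le_trans (enormD _ _) _.
rewrite enormN; have := H _ cx; have := H _ cy; lra.
Qed.

(** The diameter of a part of the region really bounds distances: the set of
   distances is bounded, so its supremum is the least upper bound. *)
Lemma pdist_le_diam (A : set (plane R)) x y : A `<=` carrier Om -> A x -> A y ->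
  pdist Om x y <= diam Om A.
Proof.
move=> AO Ax Ay; have [B _ H] := pdist_bounded.
apply: ub_le_sup; last by exists (x, y).
by exists B => _ [[u w] /= [Au Aw] <-]; apply: H; exact: AO.
Qed.

(** A nonzero lattice point has an integer coordinate of absolute value at least 1. *)
Lemma lattice_gap : exists2 s0 : R, 0 < s0 & forall k, lattice Om k -> k <> 0 -> s0 <= enorm k.
Proof.
move: hOm; case: Om => [U _|l1 l2 /= h]; first by exists 1 => // k /= ->.
have cb := coord_bound_gt0 h.
exists (coord_bound l1 l2)^-1; first by rewrite invr_gt0.
move=> _ [m [n ->]] k0; rewrite -(ler_pM2l cb) divff ?gt_eqF//.
have [A C] := coord_comb h m%:~R n%:~R.
have [m0|m0] := eqVneq m 0; last first.
  apply: le_trans (norm_coord1 _ _ _); rewrite A -intr_norm -[1]/(1%:~R) ler_int.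
  by rewrite -gtz0_ge1 normr_gt0.
have [n0|n0] := eqVneq n 0; last first.
  apply: le_trans (norm_coord2 _ _ _); rewrite C -intr_norm -[1]/(1%:~R) ler_int.
  by rewrite -gtz0_ge1 normr_gt0.
by case: k0; rewrite m0 n0 mulr0z !scale0r addr0.
Qed.

End pdist_theory.

(** * Folding and strict Voronoi cells *)

Lemma addr_eq_self (V : zmodType) (x k : V) : x + k = x -> k = 0.
Proof. by move=> /(congr1 (fun t => - x + t)); rewrite addKr addNr. Qed.

Section folding.
Context {R : realType}.
Variable (Om : region R).
Hypothesis hOm : admissible Om.
Implicit Types (x y z k : plane R) (S : set (plane R)).

(** The set of all representatives of the points of the quotient that have one in [S]. *)
Definition saturation S := [set x : plane R | exists2 k, lattice Om k & S (x + k)].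

Lemma measurable_lattice_bigcup (F : plane R -> set (plane R)) :
  (forall k, lattice Om k -> measurable (F k : set (mplane R))) ->
  measurable ([set x | exists2 k, lattice Om k & F k x] : set (mplane R)).
Proof.
move=> mF; pose G n := if lattice_seq Om n is Some k then F k else set0.
rewrite (_ : [set _ | _] = \bigcup_n G n).
  apply: bigcupT_measurable => n; rewrite /G.
  case E : (lattice_seq Om n) => [k|]; last exact: measurable0.
  by apply: mF; exact: lattice_seq_in E.
apply/seteqP; split => [x [k hk Fx]|x [n _]].
  by have [n E] := lattice_seq_surj hk; exists n; [exact: I|rewrite /G E].
rewrite /G; case E : (lattice_seq Om n) => [k|//] Fx; exists k => //.
exact: lattice_seq_in E.
Qed.

Lemma measurable_saturation S : measurable (S : set (mplane R)) ->
  measurable (saturation S : set (mplane R)).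
Proof. by move=> mS; apply: measurable_lattice_bigcup => k _; exact: measurable_shift. Qed.

(** A part of the region that meets each orbit of the lattice at most once can
   be cut along the translates of the cell and moved back into the cell without
   overlap. *)
Lemma integral_fold S (f : plane R -> \bar R) :
  measurable (S : set (mplane R)) -> S `<=` carrier Om ->
  (forall k y, lattice Om k -> k <> 0 -> S y -> ~ S (y + k)) ->
  measurable_fun (carrier Om : set (mplane R)) (f : mplane R -> \bar R) ->
  (forall x, carrier Om x -> 0 <= f x)%E -> lattice_periodic Om f ->
  (\int[leb2 R]_(x in S) f x = \int[leb2 R]_(x in cell Om `&` saturation S) f x)%E.
Proof.
move=> mS SO Sdisj mf f0 fper.
have mC := measurable_cell hOm.
pose piece n := if lattice_seq Om n is Some k then S `&` [set x | cell Om (x - k)] else set0.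
pose moved n := if lattice_seq Om n is Some k then cell Om `&` [set x | S (x + k)] else set0.
have mpiece n : measurable (piece n : set (mplane R)).
  rewrite /piece; case: lattice_seq => [k|]; last exact: measurable0.
  by apply: measurableI => //; exact: measurable_shift.
have mmoved n : measurable (moved n : set (mplane R)).
  rewrite /moved; case: lattice_seq => [k|]; last exact: measurable0.
  by apply: measurableI => //; exact: measurable_shift.
have SE : S = \bigcup_n piece n.
  apply/seteqP; split => [x Sx|x [n _]]; last first.
    by rewrite /piece; case: lattice_seq => [k []|].
  have [k hk cx] := carrier_cell hOm (SO _ Sx).
  by have [n E] := lattice_seq_surj hk; exists n; [exact: I|rewrite /piece E].
have ME : cell Om `&` saturation S = \bigcup_n moved n.
  apply/seteqP; split => [x [cx [k hk Sx]]|x [n _]]; last first.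
    rewrite /moved; case E : lattice_seq => [k|//] [cx Sx]; split => //; exists k => //.
    exact: lattice_seq_in E.
  by have [n E] := lattice_seq_surj hk; exists n; [exact: I|rewrite /moved E].
have tpiece : trivIset setT piece.
  apply/trivIsetP => n n' _ _ nn'; apply/seteqP; split => // x [].
  rewrite /piece; case E : (lattice_seq Om n) => [k|//]; case E' : (lattice_seq Om n') => [k'|//].
  move=> [_ /= c1] [_ /= c2]; move/negP: nn'; apply; apply/eqP.
  apply: (lattice_seq_inj hOm E); rewrite E'; congr Some.
  have hk := latticeB (lattice_seq_in E') (lattice_seq_in E).
  apply/eqP; rewrite -subr_eq0; apply/eqP; apply: (cell_unique hOm hk c1).
  by have -> : x - k - (k' - k) = x - k' by apply: plane_ext => /=; ring.
have tmoved : trivIset setT moved.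
  apply/trivIsetP => n n' _ _ nn'; apply/seteqP; split => // x [].
  rewrite /moved; case E : (lattice_seq Om n) => [k|//]; case E' : (lattice_seq Om n') => [k'|//].
  move=> [_ /= c1] [_ /= c2]; move/negP: nn'; apply; apply/eqP.
  apply: (lattice_seq_inj hOm E); rewrite E'; congr Some.
  have hk := latticeB (lattice_seq_in E') (lattice_seq_in E).
  apply/eqP; rewrite -subr_eq0; apply/eqP; apply: contrapT => k0.
  apply: (Sdisj _ _ hk k0 c1).
  by have -> : x + k + (k' - k) = x + k' by apply: plane_ext => /=; ring.
have mfS A : measurable (A : set (mplane R)) -> A `<=` carrier Om ->
    measurable_fun (A : set (mplane R)) (f : mplane R -> \bar R).
  by move=> mA AO; apply: measurable_funS mf => //; exact: measurable_carrier.
have CO : cell Om `&` saturation S `<=` carrier Om.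
  by move=> x [cx _]; exact: cell_carrier.
rewrite ME {1}SE ge0_integral_bigcup//; last 2 first.
- by rewrite -SE; exact: mfS.
- by rewrite -SE => x /SO; exact: f0.
rewrite ge0_integral_bigcup//; last 2 first.
- by rewrite -ME; apply: mfS => //; apply: measurableI => //; exact: measurable_saturation.
- by rewrite -ME => x /CO; exact: f0.
apply: eq_eseriesr => n _; rewrite /piece /moved.
case E : (lattice_seq Om n) => [k|]; last by rewrite !integral_set0.
have hk := lattice_seq_in E.
rewrite -(@integral_shift _ k); last 2 first.
- by apply: measurableI => //; exact: measurable_shift.
- apply: mfS; last by move=> x [/SO].
  by apply: measurableI => //; exact: measurable_shift.
rewrite (_ : [set x | _] = cell Om `&` [set x | S (x + k)]); last first.
  by apply/seteqP; split => x /=; rewrite addrK => -[].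
by apply: eq_integral => x _; rewrite fper.
Qed.

End folding.

Section voronoi_partition.
Context {R : realType}.
Variable (Om : region R).
Hypothesis hOm : admissible Om.
Implicit Types (x y z k : plane R).

Definition closer (a b : plane R) := [set y : plane R | enorm (y - a) < enorm (y - b)].

Lemma closerE a b : closer a b =
  [set y | dot (b - a) y < (enorm b ^+ 2 - enorm a ^+ 2) / 2].
Proof.
apply/seteqP; split => y /=; rewrite /closer /=.
  rewrite -ltr_sqr ?nnegrE ?enorm_ge0// !sqr_enormB dotDl dotNl /dot => h; lra.
move=> h; rewrite -ltr_sqr ?nnegrE ?enorm_ge0// !sqr_enormB.
move: h; rewrite dotDl dotNl /dot => h; lra.
Qed.

Lemma measurable_closer a b : measurable (closer a b : set (mplane R)).
Proof. by rewrite closerE; apply: measurable_open_plane; exact: open_halfplane. Qed.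

(** The bisector is the line orthogonal to [b - a] through the midpoint. *)
Lemma leb2_bisector a b : a <> b -> leb2 R [set y | enorm (y - a) = enorm (y - b)] = 0%E.
Proof.
move=> ab.
rewrite (_ : [set y | _] = [set y | dot (b - a) y = (enorm b ^+ 2 - enorm a ^+ 2) / 2]).
  by apply: leb2_line => /eqP; rewrite subr_eq0 => /eqP /esym.
apply/seteqP; split => y /=.
  move=> /(congr1 (fun t => t ^+ 2)); rewrite !sqr_enormB dotDl dotNl /dot => h; lra.
rewrite dotDl dotNl => h.
apply/eqP; rewrite -(@eqrXn2 _ 2%N) ?enorm_ge0// !sqr_enormB; apply/eqP.
by move: h; rewrite /dot => h; lra.
Qed.

Lemma measurable_bisector a b :
  measurable ([set y | enorm (y - a) = enorm (y - b)] : set (mplane R)).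
Proof.
rewrite (_ : [set y | _] = ~` closer a b `&` ~` closer b a).
  by apply: measurableI; apply: measurableC; exact: measurable_closer.
apply/seteqP; split => y /=; rewrite /closer /=; first by move=> ->; rewrite ltxx; split.
by move=> [/negP h1 /negP h2]; apply/eqP; rewrite eq_le leNgt h2 leNgt h1.
Qed.

Variables (N : nat) (X : config R N).

(** The part of the region strictly closer to the representative [X i] than to
   every other translate of a generator. On the torus, this is the interior of
   the planar Voronoi cell, a set of representatives of the Voronoi cell of
   the quotient up to the boundary. *)
Definition site_cell (i : 'I_N) : set (plane R) :=
  [set y | carrier Om y /\ forall j k, lattice Om k -> X j + k <> X i ->
     enorm (y - X i) < enorm (y - (X j + k))].

Lemma site_cell_carrier i : site_cell i `<=` carrier Om.
Proof. by move=> y []. Qed.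

Lemma measurable_site_cell i : measurable (site_cell i : set (mplane R)).
Proof.
rewrite (_ : site_cell i = carrier Om `&` \bigcap_(j in [set: 'I_N])
    ~` [set x | exists2 k, lattice Om k &
      (if X j + k == X i then set0 else ~` closer (X i) (X j + k)) x]).
  apply: measurableI; first exact: measurable_carrier.
  apply: fin_bigcap_measurable; first exact: finite_finset.
  move=> j _; apply: measurableC; apply: measurable_lattice_bigcup => k _.
  case: eqP => _; first exact: measurable0.
  by apply: measurableC; exact: measurable_closer.
apply/seteqP; split => [y [Cy H]|y [Cy H]]; split => //.
- move=> j _ [k hk]; case: eqP => // ji; apply; exact: H.
- move=> j k hk ji; apply: contrapT => h; apply: (H j I).
  by exists k => //; case: eqP.
Qed.

(** A point and its translate by [k] would each be strictly closer to [X i] than to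
   [X i] translated by [-k] or [k], and these comparisons contradict each other. *)
Lemma site_cell_disj i k y : lattice Om k -> k <> 0 -> site_cell i y -> ~ site_cell i (y + k).
Proof.
move=> hk k0 [_ H] [_ H'].
have := H' i k hk; rewrite (_ : y + k - (X i + k) = y - X i); last by apply: plane_ext => /=; ring.
have := H i (- k) (latticeN hk).
rewrite (_ : y - (X i - k) = y + k - X i); last by apply: plane_ext => /=; ring.
move=> h1 h2.
have n1 : X i - k <> X i.
  by move=> /addr_eq_self/eqP; rewrite oppr_eq0 => /eqP.
have n2 : X i + k <> X i by move=> /addr_eq_self.
by have := lt_trans (h1 n1) (h2 n2); rewrite ltxx.
Qed.

(** The points at equal distance from two distinct translates of generators: a
   countable union of lines. Any other point of the region lies in a translate of
   exactly one [site_cell]. *)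
Definition ties : set (plane R) :=
  [set y | exists2 k, lattice Om k & exists2 k', lattice Om k' & exists i j,
    X i + k <> X j + k' /\ enorm (y - (X i + k)) = enorm (y - (X j + k'))].

Hypothesis dX : distinct Om X.

Lemma site_cell_pdist i y : site_cell i y -> pdist Om y (X i) = enorm (y - X i).
Proof.
move=> [_ H]; have [k [hk E K]] := pdist_attained hOm y (X i).
have [k0|k0] := pselect (k = 0); first by rewrite E k0 subr0.
apply/eqP; rewrite eq_le pdist_le_enorm//= E.
have := H i k hk; rewrite opprD addrA => h; apply/ltW/h.
by move=> /addr_eq_self.
Qed.

Lemma site_cell_lt i j y : j != i -> site_cell i y -> pdist Om y (X i) < pdist Om y (X j).
Proof.
move=> ji Sy; rewrite (site_cell_pdist Sy); case: Sy => _ H.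
have [k [hk -> _]] := pdist_attained hOm y (X j).
rewrite -addrA -opprD; apply: H => // E.
apply: (dX ji); rewrite (_ : X j - X i = - k); last by rewrite -E opprD addrA subrr add0r.
exact: latticeN.
Qed.

Lemma site_cell_le i j y : site_cell i y -> pdist Om y (X i) <= pdist Om y (X j).
Proof. by move=> Sy; have [->//|ji] := eqVneq j i; exact/ltW/site_cell_lt. Qed.

Lemma site_cell_voronoi i : site_cell i `<=` voronoi Om X i.
Proof.
by move=> y Sy; split; [exact: site_cell_carrier Sy|move=> j ji; exact: site_cell_lt].
Qed.

Lemma voronoiD i y k : lattice Om k -> voronoi Om X i (y + k) <-> voronoi Om X i y.
Proof.
move=> hk; rewrite /voronoi /= carrierD//.
split=> -[cy H]; split => // j ji; have := H j ji; rewrite !pdistDl//.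
Qed.

Lemma voronoi_disj i j y : voronoi Om X i y -> voronoi Om X j y -> i = j.
Proof.
move=> [_ Hi] [_ Hj]; apply/eqP; apply: contraT => ij.
have ji : j != i by rewrite eq_sym.
by have := lt_trans (Hj _ ij) (Hi _ ji); rewrite ltxx.
Qed.

Lemma self_voronoi i : carrier Om (X i) -> voronoi Om X i (X i).
Proof.
move=> cX; split=> // j ji; rewrite pdistxx// pdist_gt0//.
by apply: dX; rewrite eq_sym.
Qed.

Hypothesis N0 : (0 < N)%N.

Lemma measurable_ties : measurable (ties : set (mplane R)).
Proof.
apply: measurable_lattice_bigcup => k _; apply: measurable_lattice_bigcup => k' _.
rewrite [Z in measurable Z](_ : _ = \bigcup_(p in [set: 'I_N * 'I_N])
  (if X p.1 + k == X p.2 + k' then set0 else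
   [set y | enorm (y - (X p.1 + k)) = enorm (y - (X p.2 + k'))])).
  apply: fin_bigcup_measurable; first exact: finite_finset.
  move=> [i j] _ /=; case: eqP => _; first exact: measurable0.
  exact: measurable_bisector.
apply/seteqP; split => [y [i [j [ij E]]]|y [[i j] _ /=]].
  by exists (i, j) => //=; case: eqP.
by case: eqP => // ij E; exists i, j.
Qed.

Lemma negligible_lattice_bigcup (F : plane R -> set (plane R)) :
  (forall k, lattice Om k -> (leb2 R).-negligible (F k)) ->
  (leb2 R).-negligible ([set x | exists2 k, lattice Om k & F k x]).
Proof.
move=> mF; pose G n := if lattice_seq Om n is Some k then F k else set0.
rewrite (_ : [set _ | _] = \bigcup_n G n).
  apply: negligible_bigcup => n; rewrite /G.
  case E : (lattice_seq Om n) => [k|]; last exact: negligible_set0.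
  by apply: mF; exact: lattice_seq_in E.
apply/seteqP; split => [x [k hk Fx]|x [n _]].
  by have [n E] := lattice_seq_surj hk; exists n; [exact: I|rewrite /G E].
rewrite /G; case E : (lattice_seq Om n) => [k|//] Fx; exists k => //.
exact: lattice_seq_in E.
Qed.

Lemma leb2_ties : leb2 R ties = 0%E.
Proof.
apply/negligibleP; first exact: measurable_ties.
apply: negligible_lattice_bigcup => k _; apply: negligible_lattice_bigcup => k' _.
rewrite [Z in _.-negligible Z](_ : _ = \bigcup_n
  (if @unpickle ('I_N * 'I_N)%type n is Some p then
     if X p.1 + k == X p.2 + k' then set0 else
     [set y | enorm (y - (X p.1 + k)) = enorm (y - (X p.2 + k'))] else set0)).
  apply: negligible_bigcup => n; case: unpickle => [[i j]|]; last exact: negligible_set0.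
  rewrite /=; case: eqP => ij; first exact: negligible_set0.
  apply/negligibleP; first exact: measurable_bisector.
  exact: leb2_bisector.
apply/seteqP; split => [y [i [j [ij E]]]|y [n _]].
  by exists (pickle (i, j)); [exact: I|rewrite pickleK /=; case: eqP].
by case: unpickle => [[i j] /=|//]; case: eqP => // ij E; exists i, j.
Qed.

(** Translate the point by the lattice vector that realizes its distance to the nearest
   generator; every comparison is strict when there is no tie. *)
Lemma site_cell_cover y : carrier Om y -> ~ ties y -> exists i, saturation Om (site_cell i) y.
Proof.
move=> cy nt.
have [i _ Hi] := arg_minP (fun i => pdist Om y (X i)) (isT : xpredT (Ordinal N0)).
have [k [hk E K]] := pdist_attained hOm y (X i).
exists i, (- k); first exact: latticeN.
split; first by rewrite carrierD//; exact: latticeN.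
move=> j k' hk' ji.
have -> : y - k - X i = y - X i - k by apply: plane_ext => /=; ring.
have -> : y - k - (X j + k') = y - X j - (k + k') by apply: plane_ext => /=; ring.
rewrite lt_neqAle -E; apply/andP; split; last first.
  by apply: le_trans (Hi j isT) _; apply: pdist_le => //; exact: latticeD.
apply/eqP; rewrite E => EE; apply: nt.
exists k => //; exists (k + k'); first exact: latticeD.
exists i, j; split.
  by move=> /(congr1 (fun t => t - k)); rewrite addrK addrA addrAC addrK => /esym.
by rewrite !opprD !addrA -[y - X j - k - k']addrA -opprD.
Qed.

End voronoi_partition.

(** * Tiling by the cells of a configuration *)

Section tiling.
Context {R : realType}.
Variable (Om : region R).
Hypothesis hOm : admissible Om.
Implicit Types (x y z k : plane R).

Lemma integral_null_diff (A B : set (plane R)) (f : plane R -> \bar R) (Z : set (plane R)) :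
  measurable (A : set (mplane R)) -> measurable (B : set (mplane R)) ->
  measurable (Z : set (mplane R)) -> leb2 R Z = 0%E ->
  A `\` Z = B `\` Z ->
  measurable_fun (A `|` B : set (mplane R)) (f : mplane R -> \bar R) ->
  (forall x, (A `|` B) x -> 0 <= f x)%E ->
  (\int[leb2 R]_(x in A) f x = \int[leb2 R]_(x in B) f x)%E.
Proof.
move=> mA mB mZ Z0 AB mf f0.
rewrite (ge0_negligible_integral mZ mA)//; last 2 first.
- by apply: measurable_funS mf; [exact: measurableU|move=> x; left].
- by move=> x Ax; apply: f0; left.
rewrite AB -(ge0_negligible_integral mZ mB)//.
- by apply: measurable_funS mf; [exact: measurableU|move=> x; right].
- by move=> x Bx; apply: f0; right.
Qed.

Variables (N : nat) (X : config R N).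
Hypothesis (N0 : (0 < N)%N) (dX : distinct Om X).

(** Each site cell is folded back into [cell Om]; the folded pieces are disjoint, since
   their points lie in distinct Voronoi cells, and miss only ties. *)
Lemma integral_tile (f : plane R -> \bar R) :
  measurable_fun (carrier Om : set (mplane R)) (f : mplane R -> \bar R) ->
  (forall x, carrier Om x -> 0 <= f x)%E -> lattice_periodic Om f ->
  (\int[leb2 R]_(x in cell Om) f x =
   \sum_(i < N) \int[leb2 R]_(x in site_cell Om X i) f x)%E.
Proof.
move=> mf f0 fper.
have FE i : (\int[leb2 R]_(x in site_cell Om X i) f x =
    \int[leb2 R]_(x in cell Om `&` saturation Om (site_cell Om X i)) f x)%E.
  apply: integral_fold => //; first exact: measurable_site_cell.
    exact: site_cell_carrier.
  by move=> k y; exact: site_cell_disj.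
rewrite (eq_bigr _ (fun i _ => FE i)).
have mF i : measurable (cell Om `&` saturation Om (site_cell Om X i) : set (mplane R)).
  by apply: measurableI; [exact: measurable_cell|apply: measurable_saturation; exact: measurable_site_cell].
have tF : trivIset setT (fun i => cell Om `&` saturation Om (site_cell Om X i)).
  apply/trivIsetP => i j _ _ ij; apply/seteqP; split => // x [[_ [k hk Si]] [_ [k' hk' Sj]]].
  have Vi := (voronoiD hOm X i x hk).1 (site_cell_voronoi hOm dX Si).
  have Vj := (voronoiD hOm X j x hk').1 (site_cell_voronoi hOm dX Sj).
  by move/negP: ij; apply; apply/eqP; exact: (voronoi_disj Vi Vj).
set U := \big[setU/set0]_(i < N) (cell Om `&` saturation Om (site_cell Om X i)).
have UE x : U x <-> exists i, (cell Om `&` saturation Om (site_cell Om X i)) x.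
  rewrite /U -bigcup_seq; split; first by move=> [i _ Ui]; exists i.
  by move=> [i Ui]; exists i => //=; rewrite mem_index_enum.
have UC : U `<=` carrier Om by move=> x /UE[i [cx _]]; exact: cell_carrier.
have mU : measurable (U : set (mplane R)) by exact: bigsetU_measurable.
rewrite -ge0_integral_bigsetU//; last 4 first.
- exact: index_enum_uniq.
- by apply: sub_trivIset tF.
- by apply: measurable_funS mf => //; exact: measurable_carrier.
- by move=> x /UC; exact: f0.
have mO := measurable_carrier hOm; have mC := measurable_cell hOm.
have sub : cell Om `|` U `<=` carrier Om.
  by move=> x [|/UC//]; exact: cell_carrier.
apply: (@integral_null_diff _ _ _ (ties Om X)) => //.
- exact: measurable_ties.
- exact: leb2_ties.
- apply/seteqP; split => x [xC xt]; split => //.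
    have [i Si] := site_cell_cover hOm N0 (cell_carrier xC) xt.
    by apply/UE; exists i.
  by have [i []] := (UE x).1 xC.
- by apply: measurable_funS mf.
- by move=> x /sub; exact: f0.
Qed.

Lemma leb2_site_cell_lty i : (leb2 R (site_cell Om X i) < +oo)%E.
Proof.
have := @integral_tile (cst 1%E) (@measurable_cst _ _ _ _ _ _) (fun _ _ => lee01) (fun _ _ _ => erefl).
rewrite integral_cst//; last exact: measurable_cell.
rewrite mul1e => E; apply: le_lt_trans (leb2_cell_lty hOm).
have mS j := measurable_site_cell hOm X j.
rewrite E (bigD1 i)//= integral_cst// mul1e; apply: leeDl.
by apply: sume_ge0 => j _; apply: integral_ge0.
Qed.

Lemma integrable_site_cell i (f : plane R -> R) (K : R) :
  measurable_fun (carrier Om : set (mplane R)) (f : mplane R -> measurableTypeR R) ->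
  (forall x, site_cell Om X i x -> `|f x| <= K) ->
  (leb2 R).-integrable (site_cell Om X i : set (mplane R)) (EFin \o f).
Proof.
move=> mf fK; apply: (@integrable_bounded _ _ _ K) => //.
- exact: measurable_site_cell.
- exact: leb2_site_cell_lty.
- apply: measurable_funS mf; first exact: measurable_carrier.
  exact: site_cell_carrier.
Qed.

Lemma integrable_cell (f : plane R -> R) (K : R) :
  measurable_fun (carrier Om : set (mplane R)) (f : mplane R -> measurableTypeR R) ->
  (forall x, cell Om x -> `|f x| <= K) ->
  (leb2 R).-integrable (cell Om : set (mplane R)) (EFin \o f).
Proof.
move=> mf fK; apply: (@integrable_bounded _ _ _ K) => //.
- exact: measurable_cell.
- exact: leb2_cell_lty.
- apply: measurable_funS mf; first exact: measurable_carrier.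
  by move=> x; exact: cell_carrier.
Qed.

Lemma Rintegral_tile (f : plane R -> R) (K : R) :
  measurable_fun (carrier Om : set (mplane R)) (f : mplane R -> measurableTypeR R) ->
  (forall x, carrier Om x -> `|f x| <= K) -> lattice_periodic Om f ->
  \int[leb2 R]_(x in cell Om) f x =
   \sum_(i < N) \int[leb2 R]_(x in site_cell Om X i) f x.
Proof.
move=> mf fK fper.
have ge0 (g : plane R -> R) (L : R) :
    measurable_fun (carrier Om : set (mplane R)) (g : mplane R -> measurableTypeR R) ->
    (forall x, carrier Om x -> 0 <= g x) -> (forall x, carrier Om x -> `|g x| <= L) ->
    lattice_periodic Om g ->
    \int[leb2 R]_(x in cell Om) g x =
    \sum_(i < N) \int[leb2 R]_(x in site_cell Om X i) g x.
  move=> mg g0 gL gper; rewrite /Rintegral integral_tile.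
  - apply/esym/sum_fine => i _; apply: integrable_fin_num.
      exact: measurable_site_cell.
    by apply: (@integrable_site_cell _ _ L) => // x /site_cell_carrier; exact: gL.
  - exact/measurable_EFinP.
  - by move=> x /g0; rewrite lee_fin.
  - by move=> x k hk; rewrite gper.
have mS j := measurable_site_cell hOm X j; have mC := measurable_cell hOm.
have mK : measurable_fun (carrier Om : set (mplane R)) (cst K : mplane R -> measurableTypeR R).
  exact: measurable_cst.
have KK x : carrier Om x -> `|K| <= `|K| by [].
have [[x0 cx0]|nx0] := pselect (exists x, carrier Om x); last first.
  have E0 (A : set (plane R)) : A `<=` carrier Om -> A = set0.
    by move=> AO; apply/seteqP; split => // x /AO cx; case: nx0; exists x.
  rewrite (E0 (cell Om)); last by move=> x; exact: cell_carrier.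
  rewrite Rintegral_set0 big1// => i _.
  by rewrite (E0 (site_cell Om X i)) ?Rintegral_set0//; exact: site_cell_carrier.
have K0 : 0 <= K by exact: le_trans (fK _ cx0).
(* The nonnegative case applies to [f + K] and to the constant [K]. *)
have H : \int[leb2 R]_(x in cell Om) (f x + K) =
    \sum_(i < N) \int[leb2 R]_(x in site_cell Om X i) (f x + K).
  apply: (ge0 _ (K + K)) => [|x cx|x cx|x k hk].
  - by apply: measurable_funD.
  - by have := fK _ cx; rewrite ler_norml => /andP[]; lra.
  - by apply: le_trans (ler_normD _ _) _; rewrite (ger0_norm K0) lerD2r fK.
  - by rewrite fper.
have HK : \int[leb2 R]_(x in cell Om) K = \sum_(i < N) \int[leb2 R]_(x in site_cell Om X i) K.
  by apply: (ge0 (cst K) `|K|).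
apply: (addIr (\int[leb2 R]_(x in cell Om) K)).
rewrite {2}HK -big_split /= -RintegralD//; last 2 first.
- by apply: (@integrable_cell _ K) => // x /cell_carrier; exact: fK.
- by apply: (@integrable_cell _ `|K|).
rewrite H; apply: eq_bigr => i _; rewrite RintegralD//.
- by apply: (@integrable_site_cell _ _ K) => // x /site_cell_carrier; exact: fK.
- by apply: (@integrable_site_cell _ _ `|K|).
Qed.

End tiling.

(** * Volumes and displacements *)

Section cell_quantities.
Context {R : realType}.
Variable (Om : region R).
Hypothesis hOm : admissible Om.
Implicit Types (x y z k : plane R).

Lemma measurable_pdist (a : plane R) :
  measurable_fun (carrier Om : set (mplane R)) ((fun x => pdist Om x a) : mplane R -> measurableTypeR R).
Proof.
apply: (@measurable_lipschitz _ _ _ 1); first exact: open_carrier.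
by move=> x y _ _; rewrite mul1r pdist_lipschitz.
Qed.

Lemma measurable_linear (b a : plane R) (D : set (plane R)) :
  measurable (D : set (mplane R)) ->
  measurable_fun (D : set (mplane R)) ((fun x => dot (x - b) a) : mplane R -> measurableTypeR R).
Proof.
move=> mD; apply: (@measurable_funS _ _ _ _ setT) => //.
apply: (@measurable_lipschitz _ _ _ (enorm a)); first exact: openT.
move=> x y _ _; rewrite mulrC -dotNl -dotDl opprB addrA subrK.
exact: norm_dot.
Qed.

Variables (N : nat) (X : config R N).

Lemma measurable_voronoi i : measurable (voronoi Om X i : set (mplane R)).
Proof.
rewrite (_ : voronoi Om X i = carrier Om `&` \bigcap_(j in [set j : 'I_N | j != i])
   [set x | carrier Om x /\ pdist Om x (X i) < pdist Om x (X j)]).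
  apply: measurableI; first exact: measurable_carrier.
  apply: fin_bigcap_measurable; first exact: finite_finset.
  move=> j _.
  have mO := measurable_carrier hOm.
  have /(_ mO [set true] Logic.I) := measurable_fun_ltr (measurable_pdist (X i)) (measurable_pdist (X j)).
  by rewrite (_ : _ `&` _ = [set x | carrier Om x /\ pdist Om x (X i) < pdist Om x (X j)]).
apply/seteqP; split => [y [cy H]|y [cy H]]; split => //.
  by move=> j ji; split => //; exact: H.
by move=> j ji; have [] := H j ji.
Qed.

Hypothesis (N0 : (0 < N)%N) (dX : distinct Om X).

(** The indicator of a Voronoi cell is periodic, so its integral can be computed on the
   site cells, all of which it misses but one. *)
Lemma leb2_voronoi i : leb2 R (cell Om `&` voronoi Om X i) = leb2 R (site_cell Om X i).
Proof.
have mV := measurable_voronoi i.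
have := @integral_tile _ _ hOm N X N0 dX (fun x => (\1_(voronoi Om X i) x)%:E).
rewrite integral_indic//; last exact: measurable_cell.
rewrite setIC => ->.
- rewrite (bigD1 i)//= big1 ?adde0 => [|j ji]; rewrite integral_indic//; try exact: measurable_site_cell.
    rewrite setIidr//; exact: site_cell_voronoi.
  rewrite (_ : _ `&` _ = set0) ?measure0//.
  apply/seteqP; split => // x [Vi Sj]; have Vj := site_cell_voronoi hOm dX Sj.
  by move/negP: ji; apply; apply/eqP; exact: voronoi_disj Vj Vi.
- by apply/measurable_EFinP; apply: measurable_indic.
- by move=> x _; rewrite lee_fin.
- move=> x k hk; rewrite !indicE; congr ((_ : bool)%:R%:E).
  by apply/idP/idP; rewrite !inE => /(voronoiD hOm X i x hk).
Qed.

Lemma volumeE i : volume Om X i = fine (leb2 R (site_cell Om X i)).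
Proof. by rewrite /volume /area leb2_voronoi. Qed.

Lemma volume_ge0 i : 0 <= volume Om X i.
Proof. by rewrite volumeE fine_ge0. Qed.

Lemma EFin_volume i : (volume Om X i)%:E = leb2 R (site_cell Om X i).
Proof. by rewrite volumeE fineK// ge0_fin_numE//; exact: leb2_site_cell_lty. Qed.

Lemma Rintegral_site_cell_cst i (c : R) :
  \int[leb2 R]_(x in site_cell Om X i) c = c * volume Om X i.
Proof. by rewrite Rintegral_cst ?volumeE//; exact: measurable_site_cell. Qed.

Lemma sum_volume : \sum_(i < N) volume Om X i = area Om (carrier Om).
Proof.
have := @Rintegral_tile _ _ hOm N X N0 dX (cst 1) 1.
rewrite Rintegral_cst; last exact: measurable_cell.
rewrite mul1r /area setIidl; last by move=> x; exact: cell_carrier.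
move=> ->; [|exact: measurable_cst|by move=> x _; rewrite normr1|by []].
by apply: eq_bigr => i _; rewrite Rintegral_site_cell_cst mul1r.
Qed.

Lemma site_cell_radius_bounded i : carrier Om (X i) -> exists K, forall x, site_cell Om X i x ->
  enorm (x - X i) <= K.
Proof.
move=> cX; have [B _ H] := pdist_bounded hOm; exists B => x Sx.
by rewrite -(site_cell_pdist hOm Sx); apply: H => //; case: Sx.
Qed.

Lemma integrable_dot i a : carrier Om (X i) ->
  (leb2 R).-integrable (site_cell Om X i : set (mplane R)) (EFin \o (fun y => dot (y - X i) a)).
Proof.
move=> cX; have [K hK] := site_cell_radius_bounded cX.
apply: (@integrable_site_cell _ _ hOm _ _ N0 dX _ _ (K * enorm a)).
  by apply: measurable_linear; exact: measurable_carrier.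
move=> x Sx; apply: le_trans (norm_dot _ _) _; rewrite ler_wpM2r ?enorm_ge0//.
exact: hK.
Qed.

(** On the torus the closed planar cell and [site_cell] differ by ties only, so that both
   have the same moments. *)
Lemma planar_voronoi_site_cell i : carrier Om = setT ->
  measurable (planar_voronoi Om X i : set (mplane R)) /\
  planar_voronoi Om X i `\` ties Om X = site_cell Om X i `\` ties Om X.
Proof.
move=> cT; split.
  rewrite (_ : planar_voronoi Om X i = \bigcap_(j in [set: 'I_N])
      ~` [set x | exists2 k, lattice Om k & closer (X j + k) (X i) x]).
    apply: fin_bigcap_measurable; first exact: finite_finset.
    move=> j _; apply: measurableC; apply: measurable_lattice_bigcup => k _.
    exact: measurable_closer.
  apply/seteqP; split => [y H j _ [k hk]|y H j k hk].
    by rewrite /closer /=; have := H j k hk; rewrite leNgt -addrA -opprD => /negP.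
  rewrite leNgt; apply/negP => h; apply: (H j I); exists k => //.
  by rewrite /closer /= opprD addrA.
apply/seteqP; split => y [H nt]; split => //; last first.
  move=> j k hk; rewrite -addrA -opprD.
  have [->//|/eqP ji] := eqVneq (X j + k) (X i).
  by case: H => _ H; apply/ltW/H.
split; first by rewrite cT.
move=> j k hk ji; have := H j k hk; rewrite -addrA -opprD le_eqVlt => /orP[/eqP E|//].
exfalso; apply: nt; exists 0; first exact: lattice0.
exists k => //; exists i, j; rewrite addr0; split => //.
by move=> /esym.
Qed.

Lemma Rintegral_planar_voronoi i (f : plane R -> R) : carrier Om = setT ->
  measurable_fun setT (f : mplane R -> measurableTypeR R) ->
  (forall y, `|f y| <= enorm (y - X i)) ->
  \int[leb2 R]_(y in planar_voronoi Om X i) f y = \int[leb2 R]_(y in site_cell Om X i) f y.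
Proof.
move=> cT mf fle.
have [mP PS] := planar_voronoi_site_cell i cT.
have [B B0 HB] := pdist_bounded hOm.
have PB y : planar_voronoi Om X i y -> enorm (y - X i) <= B.
  move=> H; have [k [hk E _]] := pdist_attained hOm y (X i).
  by apply: le_trans (H i k hk) _; rewrite -E; apply: HB; rewrite cT.
have mS := measurable_site_cell hOm X i.
have mT := measurable_ties Om X; have T0 := leb2_ties Om X.
have cX : carrier Om (X i) by rewrite cT.
have iP : (leb2 R).-integrable (planar_voronoi Om X i : set (mplane R)) (EFin \o f).
  apply: (@integrable_bounded _ _ _ B) => //.
  - apply: le_lt_trans (ltry (4 * B ^+ 2)); apply: (@leb2_ball_le _ (X i)) => //.
    exact: ltW.
  - exact: measurable_funS mf.
  - by move=> y Py; apply: le_trans (fle y) _; exact: PB.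
have [K hK] := site_cell_radius_bounded cX.
have iS : (leb2 R).-integrable (site_cell Om X i : set (mplane R)) (EFin \o f).
  apply: (@integrable_site_cell _ _ hOm _ _ N0 dX _ _ K).
    exact: measurable_funS mf.
  by move=> y Sy; apply: le_trans (fle y) _; exact: hK.
by rewrite /Rintegral (negligible_integral mT mP iP T0) PS -(negligible_integral mT mS iS T0).
Qed.

Lemma integrable_moments i : carrier Om (X i) ->
  (leb2 R).-integrable (site_cell Om X i : set (mplane R)) (EFin \o (fun y => y.1 - (X i).1)) /\
  (leb2 R).-integrable (site_cell Om X i : set (mplane R)) (EFin \o (fun y => y.2 - (X i).2)).
Proof.
move=> cX; split.
- apply: eq_integrable (@integrable_dot i (1, 0) cX); first exact: measurable_site_cell.
  by move=> y _ /=; rewrite /dot /= mulr1 mulr0 addr0.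
- apply: eq_integrable (@integrable_dot i (0, 1) cX); first exact: measurable_site_cell.
  by move=> y _ /=; rewrite /dot /= mulr1 mulr0 add0r.
Qed.

Lemma scale_displacement i : carrier Om (X i) -> volume Om X i != 0 ->
  volume Om X i *: displacement Om X i =
    (\int[leb2 R]_(y in site_cell Om X i) (y.1 - (X i).1),
     \int[leb2 R]_(y in site_cell Om X i) (y.2 - (X i).2)).
Proof.
move=> cX V0; have [i1 i2] := integrable_moments cX.
have mS := measurable_site_cell hOm X i.
have cs c := @integrable_site_cell _ _ hOm _ _ N0 dX i (cst c) `|c|
  (@measurable_cst _ _ _ _ _ c) (fun _ _ => lexx _).
case E : Om => [U|l1 l2].
- have VS : voronoi Om X i = site_cell Om X i.
    apply/seteqP; split; last exact: site_cell_voronoi.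
    move=> y [cy H]; split => // j k hk ji.
    have k0 : k = 0 by move: hk; rewrite E.
    move: ji; rewrite k0 addr0 => ji.
    have ne : j != i by apply/eqP => ij; apply: ji; rewrite ij.
    have pd a : pdist Om y a = enorm (y - a).
      have [k' [hk' -> _]] := pdist_attained hOm y a.
      by move: hk'; rewrite E /= => ->; rewrite subr0.
    by have := H j ne; rewrite !pd.
  rewrite -E; set D := displacement Om X i.
  have -> : D = ((volume Om X i)^-1 * \int[leb2 R]_(x in site_cell Om X i) (x.1 : R),
    (volume Om X i)^-1 * \int[leb2 R]_(x in site_cell Om X i) (x.2 : R)) - X i.
    by rewrite /D /displacement VS E.
  have F (g : plane R -> R) c :
      (leb2 R).-integrable (site_cell Om X i : set (mplane R)) (EFin \o (fun y => g y - c)) ->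
      \int[leb2 R]_(x in site_cell Om X i) (g x - c) =
      \int[leb2 R]_(x in site_cell Om X i) g x - volume Om X i * c.
    move=> ig; rewrite (mulrC _ c) -Rintegral_site_cell_cst.
    apply/eqP; rewrite eq_sym subr_eq -RintegralD//; last exact: cs.
    by apply/eqP; apply: eq_Rintegral => x _; rewrite subrK.
  rewrite (F (fun y => y.1))// (F (fun y => y.2))//.
  by apply: plane_ext; rewrite /= /GRing.scale /= mulrBr mulrA divff// mul1r.
- have cT : carrier Om = setT by rewrite E.
  have m1 : measurable_fun setT ((fun y => y.1 - (X i).1) : mplane R -> measurableTypeR R).
    apply: (@measurable_funB _ _ R); first exact: measurable_fst.
    exact: measurable_cst.
  have m2 : measurable_fun setT ((fun y => y.2 - (X i).2) : mplane R -> measurableTypeR R).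
    apply: (@measurable_funB _ _ R); first exact: measurable_snd.
    exact: measurable_cst.
  have P1 := Rintegral_planar_voronoi cT m1 (fun y => fst_le_enorm (y - X i)).
  have P2 := Rintegral_planar_voronoi cT m2 (fun y => snd_le_enorm (y - X i)).
  rewrite -E -P1 -P2; set D := displacement Om X i.
  have -> : D = ((volume Om X i)^-1 * \int[leb2 R]_(y in planar_voronoi Om X i) (y.1 - (X i).1),
       (volume Om X i)^-1 * \int[leb2 R]_(y in planar_voronoi Om X i) (y.2 - (X i).2)).
    by rewrite /D /displacement E.
  by apply: plane_ext; rewrite /= /GRing.scale /= mulrA divff// mul1r.
Qed.

(** The displacement is the first moment of the strict cell, whichever formula
   defines it. *)
Lemma dot_displacement i a : carrier Om (X i) -> volume Om X i != 0 ->
  \int[leb2 R]_(y in site_cell Om X i) dot (y - X i) a =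
  volume Om X i * dot (displacement Om X i) a.
Proof.
move=> cX V0; have [i1 i2] := integrable_moments cX.
have mS := measurable_site_cell hOm X i.
rewrite -dotZl scale_displacement// /dot /=.
rewrite RintegralD//; last 2 first.
- exact: (integrableZr mS _ i1).
- exact: (integrableZr mS _ i2).
by rewrite !RintegralZr.
Qed.

End cell_quantities.

(** * The energy and its semiconcavity *)

Section energy_theory.
Context {R : realType}.
Variable (Om : region R).
Hypothesis hOm : admissible Om.
Implicit Types (x y z k : plane R).

Section one_configuration.
Variables (N : nat) (X : config R N).
Hypothesis (N0 : (0 < N)%N).

Definition near_sq x := inf (range (fun i => pdist Om x (X i) ^+ 2)).

Lemma near_sq_le x i : near_sq x <= pdist Om x (X i) ^+ 2.
Proof.
apply: ge_inf; last by exists i.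
by exists 0 => _ [j _ <-]; exact: sqr_ge0.
Qed.

Lemma near_sq_attained x : exists2 i, near_sq x = pdist Om x (X i) ^+ 2 &
  forall j, pdist Om x (X i) <= pdist Om x (X j).
Proof.
have [i _ Hi] := arg_minP (fun i => pdist Om x (X i)) (isT : xpredT (Ordinal N0)).
exists i; last by move=> j; exact: Hi.
apply/eqP; rewrite eq_le near_sq_le /=.
apply: lb_le_inf; first by exists (pdist Om x (X i) ^+ 2), i.
by move=> _ [j _ <-]; rewrite ler_sqr ?nnegrE ?pdist_ge0//; exact: Hi.
Qed.

Lemma near_sq_ge0 x : 0 <= near_sq x.
Proof. by have [i -> _] := near_sq_attained x; exact: sqr_ge0. Qed.

Lemma near_sq_periodic : lattice_periodic Om near_sq.
Proof.
move=> x k hk; rewrite /near_sq; congr inf.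
by apply/seteqP; split => _ [i _ <-]; exists i => //; rewrite pdistDl.
Qed.

(** On its site cell, the distance to the generator is the Euclidean distance to the
   representative: the integrand of the energy becomes a polynomial. *)
Lemma near_sq_site_cell i x : distinct Om X -> site_cell Om X i x ->
  near_sq x = enorm (x - X i) ^+ 2.
Proof.
move=> dX Sx; have [j E Hj] := near_sq_attained x.
rewrite -(site_cell_pdist hOm Sx); apply/eqP; rewrite eq_le near_sq_le/= E.
by rewrite ler_sqr ?nnegrE ?pdist_ge0//; apply: (site_cell_le hOm dX).
Qed.

Hypothesis cX : configs Om N X.

Lemma near_sq_bounded : exists2 B : R, 0 < B & forall x, carrier Om x -> near_sq x <= B.
Proof.
have [B B0 H] := pdist_bounded hOm; exists (B ^+ 2); first exact: exprn_gt0.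
move=> x cx; have [i -> _] := near_sq_attained x.
rewrite ler_sqr ?nnegrE ?pdist_ge0// ?(ltW B0)//.
by apply: H => //; exact: cX.
Qed.

Lemma measurable_near_sq :
  measurable_fun (carrier Om : set (mplane R)) (near_sq : mplane R -> measurableTypeR R).
Proof.
have [B B0 H] := pdist_bounded hOm.
apply: (@measurable_lipschitz _ _ _ (2 * B)); first exact: open_carrier.
have h x y : carrier Om x -> carrier Om y -> near_sq x - near_sq y <= 2 * B * enorm (x - y).
  move=> hx hy; have [i -> _] := near_sq_attained y.
  apply: le_trans (lerB (near_sq_le x i) (lexx _)) _.
  have := pdist_lipschitz hOm x y (X i); rewrite ler_norml => /andP[h1 h2].
  have := H _ _ hx (cX i); have := H _ _ hy (cX i).
  have := pdist_ge0 hOm x (X i); have := pdist_ge0 hOm y (X i); have := enorm_ge0 (x - y).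
  nra.
move=> x y hx hy; rewrite ler_norml; apply/andP; split; last exact: h.
by rewrite lerNl opprB enormC; exact: h.
Qed.

Lemma energyE : energy Om X = \int[leb2 R]_(x in cell Om) near_sq x.
Proof. by []. Qed.

Lemma integrable_near_sq : (leb2 R).-integrable (cell Om : set (mplane R)) (EFin \o near_sq).
Proof.
have [B _ H] := near_sq_bounded.
apply: (@integrable_cell _ _ hOm _ B); first exact: measurable_near_sq.
by move=> x /cell_carrier cx; rewrite ger0_norm ?near_sq_ge0//; exact: H.
Qed.

End one_configuration.

Lemma le_energy (N : nat) (X Y : config R N) (c : R) : (0 < N)%N ->
  configs Om N X -> configs Om N Y ->
  (forall x, cell Om x -> near_sq X x <= near_sq Y x + c) ->
  energy Om X <= energy Om Y + c * area Om (carrier Om).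
Proof.
move=> N0 cX cY H; have mC := measurable_cell hOm.
have -> : c * area Om (carrier Om) = \int[leb2 R]_(x in cell Om) c.
  by rewrite Rintegral_cst// /area setIidl// => x; exact: cell_carrier.
have ic : (leb2 R).-integrable (cell Om : set (mplane R)) (EFin \o (fun _ => c)).
  by apply: (@integrable_cell _ _ hOm _ `|c|) => //; exact: measurable_cst.
rewrite !energyE -RintegralD//; last exact: integrable_near_sq.
apply: le_Rintegral => //; first exact: integrable_near_sq.
exact: (integrableD mC (integrable_near_sq N0 cY) ic).
Qed.

(** The distances involved are bounded by the diameter of the region, so squaring them is
   Lipschitz, uniformly in the number of generators. *)
Lemma energy_lipschitz : exists2 C : R, 0 <= C & forall (N : nat) (X Y : config R N), (0 < N)%N ->
  configs Om N X -> configs Om N Y ->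
  `|energy Om X - energy Om Y| <= C * \sum_(i < N) enorm (X i - Y i).
Proof.
have [B B0 H] := pdist_bounded hOm.
have a0 : 0 <= area Om (carrier Om) by apply: fine_ge0.
exists (2 * B * area Om (carrier Om)); first by rewrite !mulr_ge0// ltW.
move=> N.
have h (X Y : config R N) : (0 < N)%N -> configs Om N X -> configs Om N Y ->
    energy Om X - energy Om Y <= 2 * B * area Om (carrier Om) * \sum_(i < N) enorm (X i - Y i).
  move=> N0 cX cY; rewrite lerBlDl mulrAC; apply: le_energy => // x cx.
  have cx' := cell_carrier cx.
  have [i -> _] := near_sq_attained Y N0 x.
  apply: le_trans (near_sq_le X x i) _.
  have s1 : enorm (X i - Y i) <= \sum_(i < N) enorm (X i - Y i).
    by rewrite (bigD1 i)//= lerDl; apply: sumr_ge0 => j _; exact: enorm_ge0.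
  have := pdist_lipschitz hOm (X i) (Y i) x; rewrite ![pdist Om _ x]pdistC// ler_norml => /andP[h1 h2].
  have := H _ _ cx' (cX i); have := H _ _ cx' (cY i).
  have := pdist_ge0 hOm x (X i); have := pdist_ge0 hOm x (Y i); have := enorm_ge0 (X i - Y i).
  nra.
move=> X Y N0 cX cY; rewrite ler_norml; apply/andP; split; last exact: h.
rewrite lerNl opprB; under eq_bigr do rewrite enormC; exact: h.
Qed.

(** The energy is semiconcave: assigning each point to its old generator
   overestimates the energy of a perturbed configuration. *)
Lemma energy_perturbation (N : nat) (X Y : config R N) : (0 < N)%N ->
  configs Om N X -> configs Om N Y -> distinct Om X ->
  (forall i, volume Om X i != 0) ->
  energy Om Y <= energy Om X + \sum_(i < N) volume Om X i *
    (enorm (Y i - X i) ^+ 2 - 2 * dot (displacement Om X i) (Y i - X i)).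
Proof.
move=> N0 cX cY dX V0.
have [BX _ HX] := near_sq_bounded N0 cX; have [BY _ HY] := near_sq_bounded N0 cY.
have mS i := measurable_site_cell hOm X i.
rewrite !energyE.
rewrite (Rintegral_tile hOm N0 dX (K := BY) (measurable_near_sq N0 cY)); last 2 first.
- by move=> x cx; rewrite ger0_norm ?near_sq_ge0//; exact: HY.
- exact: near_sq_periodic.
rewrite (Rintegral_tile hOm N0 dX (K := BX) (measurable_near_sq N0 cX)); last 2 first.
- by move=> x cx; rewrite ger0_norm ?near_sq_ge0//; exact: HX.
- exact: near_sq_periodic.
(* Cell by cell: the new integrand is at most the squared distance to [Y i], which
   expands into the old one plus a first moment and a constant. *)
rewrite -big_split; apply: ler_sum => i _ /=.
set a := Y i - X i.
have -> : volume Om X i * (enorm a ^+ 2 - 2 * dot (displacement Om X i) a) =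
   \int[leb2 R]_(x in site_cell Om X i) (enorm a ^+ 2) -
   2 * \int[leb2 R]_(x in site_cell Om X i) dot (x - X i) a.
  by rewrite dot_displacement// (Rintegral_site_cell_cst hOm N0 dX); ring.
have i1 : (leb2 R).-integrable (site_cell Om X i : set (mplane R)) (EFin \o near_sq X).
  apply: (@integrable_site_cell _ _ hOm _ _ N0 dX _ _ BX); first exact: measurable_near_sq.
  by move=> x [cx _]; rewrite ger0_norm ?near_sq_ge0//; exact: HX.
have i2 : (leb2 R).-integrable (site_cell Om X i : set (mplane R)) (EFin \o near_sq Y).
  apply: (@integrable_site_cell _ _ hOm _ _ N0 dX _ _ BY); first exact: measurable_near_sq.
  by move=> x [cx _]; rewrite ger0_norm ?near_sq_ge0//; exact: HY.
have i3 : (leb2 R).-integrable (site_cell Om X i : set (mplane R)) (EFin \o (fun=> enorm a ^+ 2)).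
  apply: (@integrable_site_cell _ _ hOm _ _ N0 dX _ _ `|enorm a ^+ 2|); last by [].
  exact: measurable_cst.
have i4 := integrable_dot hOm N0 dX a (cX i).
have i5 : (leb2 R).-integrable (site_cell Om X i : set (mplane R)) (EFin \o (fun x => 2 * dot (x - X i) a)).
  exact: (integrableZl (mS i) _ i4).
have i6 : (leb2 R).-integrable (site_cell Om X i : set (mplane R))
    (EFin \o (fun x => enorm a ^+ 2 - 2 * dot (x - X i) a)).
  exact: (integrableB (mS i) i3 i5).
rewrite -RintegralZl// -RintegralB// -RintegralD//.
apply: le_Rintegral => //; first exact: (integrableD (mS i) i1 i6).
move=> x Sx; apply: le_trans (near_sq_le Y x i) _.
rewrite (near_sq_site_cell N0 dX Sx).
have -> : enorm (x - X i) ^+ 2 + (enorm a ^+ 2 - 2 * dot (x - X i) a) = enorm (x - Y i) ^+ 2.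
  rewrite (_ : x - Y i = (x - X i) - a); last by apply: plane_ext => /=; ring.
  by rewrite [RHS]sqr_enormB; ring.
by rewrite ler_sqr ?nnegrE ?pdist_ge0 ?enorm_ge0// pdist_le_enorm.
Qed.

Section diameter_bounds.
Variables (N : nat) (X : config R N) (d : R).
Hypothesis (N0 : (0 < N)%N) (cX : configs Om N X) (dX : distinct Om X).
Hypothesis hd : max_diam Om X <= d.

Lemma site_cell_radius i y : site_cell Om X i y -> enorm (y - X i) <= d.
Proof.
move=> Sy; rewrite -(site_cell_pdist hOm Sy); apply: le_trans hd.
apply: le_trans (le_bigmax _ _ i).
apply: pdist_le_diam => //; first by move=> z [].
- exact: site_cell_voronoi.
- exact: self_voronoi.
Qed.

Lemma radius_ge0 : 0 <= d.
Proof.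
apply: le_trans hd; rewrite /max_diam; elim/big_ind : _ => // [a b a0 b0|i _].
  by rewrite le_max a0.
apply: le_trans (pdist_le_diam hOm _ (self_voronoi hOm dX (cX i)) (self_voronoi hOm dX (cX i))).
  by rewrite pdistxx.
by move=> z [].
Qed.

Lemma volume_le i : volume Om X i <= 4 * d ^+ 2.
Proof.
rewrite -lee_fin (EFin_volume hOm N0 dX); apply: (@leb2_ball_le _ (X i)).
- exact: radius_ge0.
- exact: measurable_site_cell.
- by move=> y; exact: site_cell_radius.
Qed.

(** The first moment is tested against the displacement itself. *)
Lemma displacement_le i : volume Om X i != 0 -> enorm (displacement Om X i) <= d.
Proof.
move=> V0; set D := displacement Om X i.
have [->|D0] := eqVneq (enorm D) 0; first exact: radius_ge0.
have Dp : 0 < enorm D by rewrite lt_neqAle eq_sym D0 enorm_ge0.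
have Vp : 0 < volume Om X i by rewrite lt_neqAle eq_sym V0 volume_ge0.
rewrite -(ler_pM2l Vp) -(ler_pM2r Dp) -mulrA -expr2 -dotxx -dot_displacement//.
rewrite -mulrA [leRHS]mulrC -(Rintegral_site_cell_cst hOm N0 dX).
apply: le_Rintegral.
- exact: measurable_site_cell.
- exact: integrable_dot.
- apply: (@integrable_site_cell _ _ hOm _ _ N0 dX _ _ `|d * enorm D|); last by [].
  exact: measurable_cst.
- move=> y Sy; apply: le_trans (ler_norm _) _; apply: le_trans (norm_dot _ _) _.
  by rewrite ler_wpM2r ?enorm_ge0//; exact: site_cell_radius.
Qed.

Lemma energy_le : energy Om X <= d ^+ 2 * area Om (carrier Om).
Proof.
have [BX _ HX] := near_sq_bounded N0 cX.
rewrite energyE (Rintegral_tile hOm N0 dX (K := BX) (measurable_near_sq N0 cX)); last 2 first.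
- by move=> x cx; rewrite ger0_norm ?near_sq_ge0//; exact: HX.
- exact: near_sq_periodic.
rewrite -(sum_volume hOm N0 dX) mulr_sumr; apply: ler_sum => i _.
rewrite -(Rintegral_site_cell_cst hOm N0 dX); apply: le_Rintegral.
- exact: measurable_site_cell.
- apply: (@integrable_site_cell _ _ hOm _ _ N0 dX _ _ BX); first exact: measurable_near_sq.
  by move=> x [cx _]; rewrite ger0_norm ?near_sq_ge0//; exact: HX.
- apply: (@integrable_site_cell _ _ hOm _ _ N0 dX _ _ `|d ^+ 2|); last by [].
  exact: measurable_cst.
- move=> y Sy; rewrite (near_sq_site_cell N0 dX Sy) ler_sqr ?nnegrE ?enorm_ge0 ?radius_ge0//.
  exact: site_cell_radius.
Qed.

Lemma energy_ge0 : 0 <= energy Om X.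
Proof. by rewrite energyE; apply: Rintegral_ge0 => x _; exact: near_sq_ge0. Qed.

End diameter_bounds.

End energy_theory.

(** * Density of balls *)

Section density.
Context {R : realType}.
Variable (Om : region R).
Hypothesis hOm : admissible Om.
Implicit Types (x y z k : plane R).

Lemma convex_plane (U : set (plane R)) x y (t : R) :
  convex_set (U : set (convex_lmodType (plane R))) -> U x -> U y -> 0 <= t <= 1 ->
  U (y + t *: (x - y)).
Proof.
move=> cU Ux Uy /andP[t0 t1].
have := cU x y (Itv01 t0 t1); rewrite !inE => /(_ Ux Uy).
have -> : y + t *: (x - y) = t *: x + (1 - t) *: y.
  by apply: plane_ext; rewrite /= /GRing.scale /=; ring.
exact.
Qed.

Definition site (z : plane R) : config R 1 := fun _ => z.

Lemma distinct_site z : distinct Om (site z).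
Proof. by move=> i j; rewrite !ord1 eqxx. Qed.

(** [site_cell Om (site z) ord0] is the Dirichlet domain of [z]: the whole region in
   the bounded case; on the torus, the points of the plane with [z] as the nearest
   of its translates. *)
Definition ball_dense (c L : R) : Prop := forall z (r : R),
  carrier Om z -> 0 < r -> r <= L ->
  ((c * r ^+ 2)%:E <= leb2 R (site_cell Om (site z) ord0 `&` [set y : plane R | (enorm (y - z)%R < r)%R]))%E.

(** Every ball centred in the region keeps a fixed proportion of its area
   inside the Dirichlet domain of its centre. On the torus that domain contains
   a ball of fixed radius; in the convex case it is the whole region, which
   contains homothetic copies of a fixed ball close to every point. *)
Lemma ball_density (L : R) : 0 < L -> exists2 c : R, 0 < c & ball_dense c L.
Proof.
move=> L0.
have mA z r : measurable (site_cell Om (site z) ord0 `&` [set y | enorm (y - z) < r] : set (mplane R)).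
  by apply: measurableI; [exact: measurable_site_cell|exact: measurable_enorm_lt].
have [s0 s00 gap] := lattice_gap hOm.
rewrite /ball_dense; case E : Om => [U|l1 l2]; last first.
  pose th := Num.min 1 (s0 / (2 * L)).
  have th0 : 0 < th by rewrite /th lt_min ltr01 divr_gt0// mulr_gt0.
  exists (th ^+ 2); first exact: exprn_gt0.
  move=> z r cz r0 rL; rewrite -exprMn -E.
  have tr : 0 < th * r by rewrite mulr_gt0.
  apply: (@leb2_ball_ge _ z) => // y yz.
  have yr : enorm (y - z) < r.
    by apply: lt_le_trans yz _; rewrite ger_pMl// /th ge_min lexx.
  split=> //; split; first by rewrite E.
  move=> j k hk; rewrite /site => zk.
  have k0 : k <> 0 by move=> k0; apply: zk; rewrite k0 addr0.
  have := gap k hk k0.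
  have : th * r <= s0 / 2.
    apply: le_trans (_ : s0 / (2 * L) * L <= _); last first.
      by rewrite invfM mulrA divfK ?gt_eqF.
    by rewrite ler_pM ?(ltW th0) ?(ltW r0)// /th ge_min lexx orbT.
  have : enorm k <= enorm (y - (z + k)) + enorm (y - z).
    have -> : enorm k = enorm (z + k - z) by rewrite addrAC subrr add0r.
    by rewrite enormC [leRHS]addrC -[enorm (y - z)]enormC; apply: le_trans (enorm_dist _ y _) _; rewrite enormC.
  lra.
have [[x0 Ux0] oU bU cU _] : admissible (Bounded U) by rewrite -E.
have [r0 r00 Hr0] := open_enorm_ball oU Ux0.
have [B B0 HB] := pdist_bounded hOm.
have Bd x y : U x -> U y -> enorm (x - y) <= B.
  move=> Ux Uy; have [k [hk Ek _]] := pdist_attained hOm x y.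
  have k0 : k = 0 by move: hk; rewrite E.
  by have := HB x y; rewrite Ek k0 subr0 E; apply.
pose K := B + L.
have K0 : 0 < K by rewrite addr_gt0.
exists ((r0 / K) ^+ 2); first by rewrite exprn_gt0// divr_gt0.
move=> z r cz rp rL; rewrite -exprMn -E.
(* Contracting the region towards [z] by the factor [t] maps the ball of radius [r0]
   around [x0] into the region and into the ball of radius [r] around [z]. *)
pose t := r / K.
have t0 : 0 < t by rewrite divr_gt0.
have t1 : t < 1 by rewrite ltr_pdivrMr// mul1r /K; lra.
have -> : r0 / K * r = t * r0 by rewrite /t; ring.
apply: (@leb2_ball_ge _ (z + t *: (x0 - z))) => //; first by rewrite mulr_gt0.
move=> y yz.
pose w := x0 + t^-1 *: (y - (z + t *: (x0 - z))).
have Uw : U w.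
  apply: Hr0; rewrite /w addrAC subrr add0r enormZ ger0_norm ?invr_ge0 ?ltW//.
  by rewrite mulrC ltr_pdivrMr// mulrC.
have yE : y = z + t *: (w - z).
  apply: plane_ext; rewrite /w /= /GRing.scale /=; field; exact: lt0r_neq0.
have Uy : U y.
  by rewrite yE; apply: convex_plane => //; apply/andP; split; exact: ltW.
split.
  split; first by rewrite E.
  move=> j k hk; have -> : k = 0 by move: hk; rewrite E.
  by rewrite addr0.
rewrite /= {1}yE addrAC subrr add0r enormZ (gtr0_norm t0).
apply: le_lt_trans (_ : t * B < _); first by rewrite ler_pM2l// Bd.
by rewrite /t mulrAC ltr_pdivrMr// ltr_pM2l// ltrDl.
Qed.

Lemma area_gt0 : 0 < area Om (carrier Om).
Proof.
have [z cz] : exists z, carrier Om z.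
  by move: hOm; case: Om => [U [[x Ux] _ _ _ _]|l1 l2 _] /=; [exists x|exists 0].
have [c c0 dense] := ball_density ltr01.
have H := dense z 1 cz ltr01 (lexx _).
rewrite -(sum_volume hOm (ltn0Sn 0) (@distinct_site z)) big_ord1.
rewrite -lte_fin (EFin_volume hOm (ltn0Sn 0) (@distinct_site z)).
apply: lt_le_trans (_ : (c * 1 ^+ 2)%:E <= _)%E; first by rewrite lte_fin expr1n mulr1.
apply: le_trans H _; apply: le_measure; rewrite ?inE//.
- by apply: measurableI; [exact: measurable_site_cell|exact: measurable_enorm_lt].
- exact: measurable_site_cell.
Qed.

(** Within distance [s] of [X i] no other generator is as close, and the Dirichlet domain
   of [X i] excludes the other translates of [X i] itself. *)
Lemma separated_volume (c L : R) :
  ball_dense c L ->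
  forall (N : nat) (X : config R N) (i : 'I_N) (s : R), (0 < N)%N -> configs Om N X -> distinct Om X ->
  0 < s -> s <= L -> (forall j, j != i -> 2 * s <= pdist Om (X i) (X j)) ->
  c * s ^+ 2 <= volume Om X i.
Proof.
move=> H N X i s N0 cX dX s0 sL sep.
rewrite -lee_fin (EFin_volume hOm N0 dX); apply: le_trans (H (X i) s (cX i) s0 sL) _.
apply: le_measure; rewrite ?inE.
- by apply: measurableI; [exact: measurable_site_cell|exact: measurable_enorm_lt].
- exact: measurable_site_cell.
move=> y [[cy Hy] /= ys]; split => // j k hk ji.
have [ij|ij] := eqVneq j i.
  by have := Hy ord0 k hk; rewrite /site ij; apply => E; apply: ji; rewrite ij.
have h1 := sep j ij; have h2 := pdist_le hOm (X i) (X j) hk.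
have h3 : enorm (X i - X j - k) <= enorm (y - X i) + enorm (y - (X j + k)).
  by rewrite -addrA -opprD [enorm (y - X i)]enormC; exact: enorm_dist.
lra.
Qed.

End density.

(** * Separation of the generators of a minimizer *)

Section separation_arithmetic.
Context {R : realFieldType}.
Implicit Types (h e d : R).

Lemma far_from_generators h zm zx xm : h / 4 <= zm -> zm <= zx + xm -> zx < h / 16 ->
  3 * (h / 16) <= xm.
Proof. by move=> *; lra. Qed.

(** In a ball of radius [h / 16] around a point at distance [h / 4] from the generators, the
   squared distance drops from at least [9 * (h / 16) ^+ 2] to at most [(h / 16) ^+ 2],
   which is a gain of [h ^+ 2 / 32]. *)
Lemma relocation_gain h n n' q : n' <= (h / 16) ^+ 2 -> (3 * (h / 16)) ^+ 2 <= n -> 0 <= q ->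
  n' + h ^+ 2 / 32 <= n + q.
Proof. by move=> *; lra. Qed.

Lemma reassignment_cost p e dl d : p <= e + dl -> e <= d -> 0 <= p -> 0 <= dl ->
  p ^+ 2 <= e ^+ 2 + (2 * d * dl + dl ^+ 2).
Proof.
move=> h1 h2 p0 dl0; apply: le_trans (_ : (e + dl) ^+ 2 <= _).
  by rewrite ler_sqr ?nnegrE//; exact: le_trans h1.
have := ler_wpM2r dl0 h2; lra.
Qed.

(** Here [En] and [En'] are the energies before and after the relocation, [a] is the area of
   the ball that gains, [V] that of the cell that loses and [dl] the distance to the
   generator that takes over. The gain is of order [h ^+ 4] and the loss at most of order
   [dl * h ^+ 3], hence the bound on [dl]. *)
Lemma separation_estimate h C1 dl c a V En En' :
  0 < h -> 0 < C1 -> 0 <= dl -> dl <= h -> 0 < c ->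
  En <= En' -> En' + h ^+ 2 / 32 * a <= En + (2 * (C1 * h) * dl + dl ^+ 2) * V ->
  c * (h / 16) ^+ 2 <= a -> V <= 4 * (C1 * h) ^+ 2 ->
  c / (32 * 16 ^+ 2 * (4 * C1 ^+ 2 * (2 * C1 + 1))) * h <= dl.
Proof.
move=> h0 C10 dl0 dlh c0 E1 E2 E3 E4.
have Q0 : 0 < 32 * 16 ^+ 2 * (4 * C1 ^+ 2 * (2 * C1 + 1)).
  by rewrite !mulr_gt0 ?exprn_gt0// addr_gt0// mulr_gt0.
set K := 2 * (C1 * h) * dl + dl ^+ 2 in E2.
have K0 : 0 <= K.
  apply: addr_ge0; last exact: sqr_ge0.
  by apply: mulr_ge0 => //; rewrite !mulr_ge0// ltW.
have F2 : K <= dl * h * (2 * C1 + 1).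
  have := ler_wpM2l dl0 dlh; rewrite /K; lra.
have F1 : h ^+ 2 / 32 * (c * (h / 16) ^+ 2) <= K * (4 * (C1 * h) ^+ 2).
  apply: le_trans (_ : h ^+ 2 / 32 * a <= _).
    by rewrite ler_wpM2l// divr_ge0// sqr_ge0.
  apply: le_trans (_ : K * V <= _); last by rewrite ler_wpM2l.
  clear -E1 E2; lra.
have F3 : h ^+ 2 / 32 * (c * (h / 16) ^+ 2) <= dl * h * (2 * C1 + 1) * (4 * (C1 * h) ^+ 2).
  by apply: le_trans F1 _; rewrite ler_wpM2r// mulr_ge0// sqr_ge0.
rewrite mulrAC ler_pdivrMr// -(ler_pM2r (exprn_gt0 3 h0)).
have -> : c * h * h ^+ 3 = 32 * 16 ^+ 2 * (h ^+ 2 / 32 * (c * (h / 16) ^+ 2)) by field.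
have -> : dl * (32 * 16 ^+ 2 * (4 * C1 ^+ 2 * (2 * C1 + 1))) * h ^+ 3 =
  32 * 16 ^+ 2 * (dl * h * (2 * C1 + 1) * (4 * (C1 * h) ^+ 2)) by ring.
by rewrite ler_pM2l// mulr_gt0// exprn_gt0.
Qed.

End separation_arithmetic.

Section separation.
Context {R : realType}.
Variable (Om : region R).
Hypothesis hOm : admissible Om.
Implicit Types (x y z k : plane R).

Lemma mesh_gt0 (N : nat) : (0 < N)%N -> 0 < mesh Om N.
Proof. by move=> N0; rewrite sqrtr_gt0 divr_gt0 ?area_gt0// ltr0n. Qed.

Lemma sqr_mesh (N : nat) : (0 < N)%N -> mesh Om N ^+ 2 = area Om (carrier Om) / N%:R.
Proof. by move=> N0; rewrite sqr_sqrtr// divr_ge0// ltW// area_gt0. Qed.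

Lemma mesh_le (N : nat) : (0 < N)%N -> mesh Om N <= Num.sqrt (area Om (carrier Om)).
Proof.
move=> N0; apply: ler_wsqrtr; have a0 := area_gt0 hOm.
by rewrite ler_pdivrMr ?ltr0n// ler_peMr ?ler1n// ltW.
Qed.

(** Some cell has at least the average area, hence a point far from its
   generator, which is far from every generator. *)
Lemma far_point (N : nat) (X : config R N) : (0 < N)%N -> configs Om N X -> distinct Om X ->
  exists2 z, carrier Om z & forall j, mesh Om N / 4 <= pdist Om z (X j).
Proof.
move=> N0 cX dX; apply: contrapT => nz.
have h0 := mesh_gt0 N0.
have small i y : site_cell Om X i y -> enorm (y - X i) <= mesh Om N / 4.
  move=> Sy; apply: contrapT => /negP; rewrite -ltNge => far; apply: nz.
  exists y; first by case: Sy.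
  move=> j; apply: le_trans (ltW far) _; rewrite -(site_cell_pdist hOm Sy).
  exact: site_cell_le.
have V i : volume Om X i <= mesh Om N ^+ 2 / 4.
  rewrite -lee_fin (EFin_volume hOm N0 dX).
  have -> : mesh Om N ^+ 2 / 4 = 4 * (mesh Om N / 4) ^+ 2 by field.
  apply: (@leb2_ball_le _ (X i)); first by rewrite divr_ge0// ltW.
    exact: measurable_site_cell.
  exact: small.
have : \sum_(i < N) volume Om X i <= \sum_(i < N) mesh Om N ^+ 2 / 4.
  by apply: ler_sum => i _; exact: V.
rewrite sum_volume// sumr_const card_ord -[_ *+ N]mulr_natr sqr_mesh//.
have a0 := area_gt0 hOm.
have -> : area Om (carrier Om) / N%:R / 4 * N%:R = area Om (carrier Om) / 4.
  by field; rewrite pnatr_eq0 -lt0n N0.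
lra.
Qed.

(** The integral over [cell Om] of the indicator of a ball for [pdist] is the area of
   that ball in the quotient, which the site cell of its centre sees as a Euclidean
   ball. *)
Lemma leb2_cell_ball (c L : R) :
  ball_dense Om c L ->
  forall z (r : R), carrier Om z -> 0 < r -> r <= L ->
  c * r ^+ 2 <= \int[leb2 R]_(x in cell Om) \1_[set x | pdist Om x z < r] x.
Proof.
move=> H z r cz r0 rL.
have mA : measurable (carrier Om `&` [set x | pdist Om x z < r] : set (mplane R)).
  apply: measurable_open_plane; apply: open_enorm_ball_sub => x [cx /= xr].
  have [e e0 He] := open_enorm_ball (open_carrier hOm) cx.
  exists (Num.min e (r - pdist Om x z)); first by rewrite lt_min e0 subr_gt0.
  move=> y; rewrite lt_min => /andP[ye yr]; split; first exact: He.
  have := pdist_lipschitz hOm y x z; rewrite /= ler_norml => /andP[_]; lra.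
have -> : \int[leb2 R]_(x in cell Om) \1_[set x | pdist Om x z < r] x =
    \int[leb2 R]_(x in cell Om) \1_(carrier Om `&` [set x | pdist Om x z < r]) x.
  apply: eq_Rintegral => x; rewrite inE => /cell_carrier cx; rewrite !indicE; congr (_ : bool)%:R.
  by apply/idP/idP; rewrite !inE => //= -[].
rewrite (@Rintegral_tile _ _ hOm 1 (site z) (ltn0Sn 0) (@distinct_site _ _ z) _ 1); last 3 first.
- exact: measurable_indic.
- by move=> x _; rewrite indicE; case: (_ \in _); rewrite ?normr1// normr0.
- move=> x k hk; rewrite !indicE; congr (_ : bool)%:R.
  by apply/idP/idP; rewrite !inE /= carrierD// pdistDl.
rewrite big_ord1 /Rintegral integral_indic//; last exact: measurable_site_cell.
rewrite -lee_fin fineK; last first.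
  rewrite ge0_fin_numE//; apply: le_lt_trans (leb2_site_cell_lty hOm (ltn0Sn 0) (@distinct_site _ _ z) ord0).
  apply: le_measure; rewrite ?inE; last exact: subIsetr.
    by apply: measurableI => //; exact: measurable_site_cell.
  exact: measurable_site_cell.
apply: le_trans (H z r cz r0 rL) _; apply: le_measure; rewrite ?inE.
- by apply: measurableI; [exact: measurable_site_cell|exact: measurable_enorm_lt].
- by apply: measurableI => //; exact: measurable_site_cell.
move=> y [Sy yr]; split => //; split; first by case: Sy.
by apply: le_lt_trans yr; exact: pdist_le_enorm.
Qed.

(** If two generators of a minimizer were too close, moving one of them to a
   far point would lower the energy: its cell is served almost as well by the
   other one, and a ball around the far point is served much better. *)
Lemma minimizer_separation (C1 : R) : 0 < C1 -> exists2 kp : R, 0 < kp &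
  forall (N : nat) (Y : config R N), (0 < N)%N -> minimizers Om N Y -> distinct Om Y ->
  max_diam Om Y <= C1 * mesh Om N ->
  forall i j, i != j -> kp * mesh Om N <= pdist Om (Y i) (Y j).
Proof.
move=> C10.
have L0 : 0 < Num.sqrt (area Om (carrier Om)) by rewrite sqrtr_gt0 area_gt0.
have [c c0 Hc] := ball_density hOm L0.
pose kp := Num.min 1 (c / (32 * 16 ^+ 2 * (4 * C1 ^+ 2 * (2 * C1 + 1)))).
have Q0 : 0 < 32 * 16 ^+ 2 * (4 * C1 ^+ 2 * (2 * C1 + 1)).
  by rewrite !mulr_gt0 ?exprn_gt0// addr_gt0// mulr_gt0.
exists kp; first by rewrite /kp lt_min ltr01 divr_gt0.
move=> N Y N0 [cY minY] dY diamY i j ij.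
set h := mesh Om N; set dl := pdist Om (Y i) (Y j).
have h0 : 0 < h by exact: mesh_gt0.
have dl0 : 0 <= dl by exact: pdist_ge0.
have [dlh|/ltW dlh] := leP dl h; last first.
  by apply: le_trans dlh; rewrite ger_pMl// /kp ge_min lexx.
have [z cz far] := far_point N0 cY dY.
pose Y' : config R N := fun l => if l == i then z else Y l.
have cY' : configs Om N Y' by move=> l; rewrite /Y'; case: eqP => // _; exact: cY.
have minE := minY Y' cY'.
(* The far point is at least [4 * r] away from the generators. *)
pose r := h / 16.
have r0 : 0 < r by rewrite divr_gt0.
have rL : r <= Num.sqrt (area Om (carrier Om)).
  by apply: le_trans (mesh_le N0); rewrite ler_pdivrMr// ler_peMr ?ler1n//; exact: ltW.
have ballA := leb2_cell_ball Hc cz r0 rL.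
set A := [set x | pdist Om x z < r] in ballA.
pose g := h ^+ 2 / 32; pose d := C1 * h; pose K := 2 * d * dl + dl ^+ 2.
have g0 : 0 <= g by rewrite divr_ge0// sqr_ge0.
have d0 : 0 <= d by rewrite mulr_ge0// ltW.
have K0 : 0 <= K.
  by apply: addr_ge0; [apply: mulr_ge0 => //; exact: mulr_ge0|exact: sqr_ge0].
have mA : measurable_fun (carrier Om : set (mplane R)) (\1_A : mplane R -> measurableTypeR R).
  have mO := measurable_carrier hOm.
  apply: (eq_measurable_fun (\1_(carrier Om `&` A) : mplane R -> measurableTypeR R)).
    move=> x; rewrite inE => cx; rewrite !indicE; congr (_ : bool)%:R.
    by apply/idP/idP; rewrite !inE => //= -[].
  apply: measurable_indic.
  exact: (measurable_fun_ltr (measurable_pdist hOm z)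
    (@measurable_cst _ _ _ _ (carrier Om) r) mO (Y := [set true]) Logic.I).
have A1 x : `|\1_A x| <= 1 :> R by rewrite indicE; case: (_ \in _); rewrite ?normr1// normr0.
have perA : lattice_periodic Om (\1_A : plane R -> R).
  move=> x k hk; rewrite !indicE; congr (_ : bool)%:R.
  by apply/idP/idP; rewrite !inE /A /= pdistDl.
have [B B0 HB] := near_sq_bounded hOm N0 cY; have [B' B'0 HB'] := near_sq_bounded hOm N0 cY'.
have mO := measurable_carrier hOm; have mC := measurable_cell hOm.
have mf : measurable_fun (carrier Om : set (mplane R)) ((fun x => near_sq Om Y' x + g * \1_A x) : mplane R -> measurableTypeR R).
  apply: (@measurable_funD _ _ R); first exact: measurable_near_sq.
  by apply: (@measurable_funM _ _ R) => //; exact: measurable_cst.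
have fB x : carrier Om x -> `|near_sq Om Y' x + g * \1_A x| <= B' + g.
  move=> cx; apply: le_trans (ler_normD _ _) _; rewrite lerD//.
    by rewrite ger0_norm ?near_sq_ge0//; exact: HB'.
  by rewrite normrM (ger0_norm g0) ler_piMr.
have iA : (leb2 R).-integrable (cell Om : set (mplane R)) (EFin \o (\1_A : plane R -> R)).
  exact: (@integrable_cell _ _ hOm _ 1).
have E1 : energy Om Y' + g * \int[leb2 R]_(x in cell Om) \1_A x =
    \sum_(l < N) \int[leb2 R]_(x in site_cell Om Y l) (near_sq Om Y' x + g * \1_A x).
  rewrite -(Rintegral_tile hOm N0 dY (K := B' + g))//; last first.
    by move=> x k hk; rewrite perA// near_sq_periodic.
  rewrite RintegralD//; first by rewrite RintegralZl.
    exact: integrable_near_sq.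
  exact: (integrableZl mC _ iA).
have E2 : energy Om Y = \sum_(l < N) \int[leb2 R]_(x in site_cell Om Y l) near_sq Om Y x.
  rewrite energyE (Rintegral_tile hOm N0 dY (K := B))//.
  - exact: measurable_near_sq.
  - by move=> x cx; rewrite ger0_norm ?near_sq_ge0//; exact: HB.
  - exact: near_sq_periodic.
(* Pointwise balance: [g] is gained on the ball, and [K] lost at most on the cell of
   the generator that has left. *)
have point l x : site_cell Om Y l x ->
    near_sq Om Y' x + g * \1_A x <= near_sq Om Y x + (if l == i then K else 0).
  move=> Sx; rewrite indicE; case: (boolP (x \in A)) => xA; rewrite ?mulr1 ?mulr0 ?addr0.
  - move: xA; rewrite inE /A /= => xA.
    have h1 : near_sq Om Y' x <= r ^+ 2.
      apply: le_trans (near_sq_le Om Y' x i) _; rewrite /Y' eqxx.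
      by rewrite ler_sqr ?nnegrE ?pdist_ge0// ?ltW.
    have h2 : (3 * r) ^+ 2 <= near_sq Om Y x.
      have [m -> _] := near_sq_attained hOm Y N0 x.
      rewrite ler_sqr ?nnegrE ?pdist_ge0//; last by rewrite mulr_ge0// ltW.
      apply: (far_from_generators (far m) (pdist_triangle hOm z x (Y m))).
      by rewrite pdistC.
    have h3 : 0 <= if l == i then K else 0 by case: eqP.
    exact: relocation_gain h1 h2 h3.
  - case: eqP => [li|/eqP li]; rewrite ?addr0.
      rewrite (near_sq_site_cell hOm N0 dY Sx).
      apply: le_trans (near_sq_le Om Y' x j) _; rewrite /Y' eq_sym (negbTE ij).
      have := pdist_triangle hOm x (Y l) (Y j); rewrite (site_cell_pdist hOm Sx) li -/dl => h1.
      have h2 := site_cell_radius hOm cY dY diamY Sx.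
      rewrite li -/h -/d in h2.
      by apply: reassignment_cost h1 h2 (pdist_ge0 hOm _ _) dl0.
    rewrite (near_sq_site_cell hOm N0 dY Sx).
    apply: le_trans (near_sq_le Om Y' x l) _; rewrite /Y' (negbTE li).
    by rewrite (site_cell_pdist hOm Sx).
have E3 : energy Om Y' + g * \int[leb2 R]_(x in cell Om) \1_A x <= energy Om Y + K * volume Om Y i.
  have EK := esym (Rintegral_site_cell_cst hOm N0 dY i K).
  rewrite [leLHS]E1 E2 EK.
  have -> : \int[leb2 R]_(x in site_cell Om Y i) K =
     \sum_(l < N) \int[leb2 R]_(x in site_cell Om Y l) (if l == i then K else 0).
    rewrite (bigD1 i)//= eqxx big1 ?addr0// => l li.
    by rewrite (Rintegral_site_cell_cst hOm N0 dY) (negbTE li) mul0r.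
  rewrite -big_split; apply: ler_sum => l _ /=.
  have mS := measurable_site_cell hOm Y l.
  have iY : (leb2 R).-integrable (site_cell Om Y l : set (mplane R)) (EFin \o near_sq Om Y).
    apply: (@integrable_site_cell _ _ hOm _ _ N0 dY _ _ B); first exact: measurable_near_sq.
    by move=> x [cx _]; rewrite ger0_norm ?near_sq_ge0//; exact: HB.
  have iK : (leb2 R).-integrable (site_cell Om Y l : set (mplane R)) (EFin \o (fun=> if l == i then K else 0)).
    apply: (@integrable_site_cell _ _ hOm _ _ N0 dY _ _ `|if l == i then K else 0|); last by [].
    exact: measurable_cst.
  rewrite -RintegralD//; apply: le_Rintegral => //; last exact: point.
    apply: (@integrable_site_cell _ _ hOm _ _ N0 dY _ _ (B' + g)) => //.
    by move=> x [cx _]; exact: fB.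
  exact: (integrableD mS iY iK).
have Vi := volume_le hOm N0 cY dY diamY i.
apply: le_trans (_ : c / (32 * 16 ^+ 2 * (4 * C1 ^+ 2 * (2 * C1 + 1))) * h <= _).
  by apply: ler_wpM2r; [exact: ltW|rewrite /kp ge_min lexx orbT].
exact: separation_estimate h0 C10 dl0 dlh c0 minE E3 ballA Vi.
Qed.

End separation.

(** * Boundary strips and translations of the region *)

Section strips.
Context {R : realType}.
Implicit Types (x y z a b : plane R).

Definition axis_unit a := [\/ a = (1, 0), a = (-1, 0), a = (0, 1) | a = (0, -1)].

Lemma axis_unitN a : axis_unit a -> axis_unit (- a).
Proof.
by case=> ->; [apply: Or42|apply: Or41|apply: Or44|apply: Or43];
  apply: plane_ext; rewrite /= ?oppr0 ?opprK.
Qed.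

Lemma enorm_axis_unit a : axis_unit a -> enorm a = 1.
Proof. by case=> ->; rewrite /enorm /= ?sqrrN expr1n expr0n ?addr0 ?add0r sqrtr1. Qed.

Lemma leb1_small (A : set (measurableTypeR R)) (t : R) : measurable A -> 0 <= t ->
  (forall s s', A s -> A s' -> s' <= s + t) -> (leb1 R A <= (2 * t)%:E)%E.
Proof.
move=> mA t0 H; have [A0|/set0P[s As]] := eqVneq A set0.
  by rewrite A0 measure0 lee_fin mulr_ge0.
have E : leb1 R [set` `[s - t, s + t]] = (2 * t)%:E.
  by rewrite leb1_itv; [congr EFin; ring|lra].
rewrite -E; apply: le_measure; rewrite ?inE//.
move=> s' As'; rewrite /= in_itv /=; have := H _ _ As As'; have := H _ _ As' As.
by move=> h1 h2; apply/andP; split; lra.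
Qed.

Lemma leb2_xsections (A : set (plane R)) (B t : R) : measurable (A : set (mplane R)) ->
  0 <= B -> 0 <= t ->
  (forall x, A x -> `|x.1| <= B) ->
  (forall x x', A x -> A x' -> x.1 = x'.1 -> x'.2 <= x.2 + t) ->
  (leb2 R A <= (4 * B * t)%:E)%E.
Proof.
move=> mA B0 t0 AB H.
have E : (\int[leb1 R]_(s in [set` `[(- B)%R, B%R]]) (2 * t)%:E)%E = (4 * B * t)%:E.
  rewrite integral_cst//= leb1_itv; last by lra.
  by rewrite -EFinM; congr EFin; ring.
rewrite -E /leb2 /= /product_measure1 [leRHS]integral_mkcond.
apply: ge0_le_integral => //.
- exact: measurable_fun_xsection.
- by apply: (measurable_restrictT _ _).1; [exact: measurable_itv|exact: measurable_cst].
move=> x _; rewrite patchE; case: ifPn => [_|xB] /=.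
  apply: leb1_small => //; first exact: measurable_xsection.
  by move=> s s'; rewrite /xsection /= !inE => h1 h2; exact: (H (x, s) (x, s')).
rewrite (_ : xsection A x = set0) ?measure0//.
apply/seteqP; split => // s; rewrite /xsection /= inE => Axs.
move/negP: xB; apply; rewrite inE /= in_itv /=.
by have := AB _ Axs; rewrite ler_norml.
Qed.

(** The product measure is computed by vertical sections; by uniqueness it is also
   computed by horizontal ones. *)
Lemma leb2_ysections (A : set (plane R)) (B t : R) : measurable (A : set (mplane R)) ->
  0 <= B -> 0 <= t ->
  (forall x, A x -> `|x.2| <= B) ->
  (forall x x', A x -> A x' -> x.2 = x'.2 -> x'.1 <= x.1 + t) ->
  (leb2 R A <= (4 * B * t)%:E)%E.
Proof.
move=> mA B0 t0 AB H.
have E : (\int[leb1 R]_(s in [set` `[(- B)%R, B%R]]) (2 * t)%:E)%E = (4 * B * t)%:E.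
  rewrite integral_cst//= leb1_itv; last by lra.
  by rewrite -EFinM; congr EFin; ring.
have -> : leb2 R A = ((@lebesgue_measure R) \x^ (@lebesgue_measure R))%E A.
  apply: (@product_measure_unique _ _ _ _ R (@lebesgue_measure R) (@lebesgue_measure R)) => //.
  by move=> C D mC mD; exact: product_measure2E.
rewrite -E /= /product_measure2 [leRHS]integral_mkcond.
apply: ge0_le_integral => //.
- exact: measurable_fun_ysection.
- by apply: (measurable_restrictT _ _).1; [exact: measurable_itv|exact: measurable_cst].
move=> x _; rewrite patchE; case: ifPn => [_|xB] /=.
  apply: leb1_small => //; first exact: measurable_ysection.
  by move=> s s'; rewrite /ysection /= !inE => h1 h2; exact: (H (s, x) (s', x)).
rewrite (_ : ysection A x = set0) ?measure0//.
apply/seteqP; split => // s; rewrite /ysection /= inE => Axs.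
move/negP: xB; apply; rewrite inE /= in_itv /=.
by have := AB _ Axs; rewrite ler_norml.
Qed.

Variable (Om : region R).
Hypothesis hOm : admissible Om.

Lemma measurable_strip a : measurable (cell Om `\` [set x | carrier Om (x + a)] : set (mplane R)).
Proof.
apply: measurableD; first exact: measurable_cell.
by apply: measurable_shift; exact: measurable_carrier.
Qed.

(** The points pushed out of the region by a small translation: by convexity
   they form an interval of length at most [t] on each line parallel to it. *)
Lemma strip_small : exists2 Cs : R, 0 <= Cs & forall a (t : R), axis_unit a -> 0 < t ->
  (leb2 R (cell Om `\` [set x | carrier Om (x + t *: a)%R]) <= (Cs * t)%:E)%E.
Proof.
have [B B0 HB] := cell_bounded hOm; have B0' := ltW B0.
exists (4 * B); first by rewrite mulr_ge0.
move=> a t au t0; have mA := measurable_strip (t *: a).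
case E : Om => [U|l1 l2]; last first.
  rewrite (_ : _ `\` _ = set0); first by rewrite measure0 lee_fin !mulr_ge0// ltW.
  by apply/seteqP; split => // x [_ []].
have [_ _ _ cU _] : admissible (Bounded U) by rewrite -E.
have cE : cell Om = U by rewrite E.
have oE : carrier Om = U by rewrite E.
have seg x y s : U x -> U y -> t < s -> y = x + s *: a -> U (x + t *: a).
  move=> Ux Uy ts ys; have s0 : 0 < s by exact: lt_trans t0 ts.
  have -> : x + t *: a = x + (t / s) *: (y - x).
    by rewrite ys [x + s *: a]addrC addrK scalerA divfK ?gt_eqF.
  apply: convex_plane => //.
  by rewrite divr_ge0 ?(ltW t0) ?(ltW s0)//= ler_pdivrMr// mul1r ltW.
have no x s : (U `\` [set x | U (x + t *: a)]) x -> t < s -> ~ U (x + s *: a).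
  by move=> [Ux nU] ts Uy; apply: nU; exact: seg Ux Uy ts erefl.
rewrite -E cE oE in mA *.
case: au no => a_def no.
- apply: leb2_ysections => //; first exact: ltW.
    by move=> x [Ux _]; apply: le_trans (snd_le_enorm x) (HB x _); rewrite cE.
  move=> x x' Sx [Ux' _] xx; rewrite leNgt; apply/negP => h.
  apply: (no x (x'.1 - x.1) Sx); first by rewrite ltrBrDl.
  by rewrite a_def (_ : _ + _ = x')//; apply: plane_ext; rewrite /= /GRing.scale /= ?xx; ring.
- apply: leb2_ysections => //; first exact: ltW.
    by move=> x [Ux _]; apply: le_trans (snd_le_enorm x) (HB x _); rewrite cE.
  move=> x x' [Ux _] Sx' xx; rewrite leNgt; apply/negP => h.
  apply: (no x' (x'.1 - x.1) Sx'); first by rewrite ltrBrDl.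
  by rewrite a_def (_ : _ + _ = x)//; apply: plane_ext; rewrite /= /GRing.scale /= ?xx; ring.
- apply: leb2_xsections => //; first exact: ltW.
    by move=> x [Ux _]; apply: le_trans (fst_le_enorm x) (HB x _); rewrite cE.
  move=> x x' Sx [Ux' _] xx; rewrite leNgt; apply/negP => h.
  apply: (no x (x'.2 - x.2) Sx); first by rewrite ltrBrDl.
  by rewrite a_def (_ : _ + _ = x')//; apply: plane_ext; rewrite /= /GRing.scale /= ?xx; ring.
- apply: leb2_xsections => //; first exact: ltW.
    by move=> x [Ux _]; apply: le_trans (fst_le_enorm x) (HB x _); rewrite cE.
  move=> x x' [Ux _] Sx' xx; rewrite leNgt; apply/negP => h.
  apply: (no x' (x'.2 - x.2) Sx'); first by rewrite ltrBrDl.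
  by rewrite a_def (_ : _ + _ = x)//; apply: plane_ext; rewrite /= /GRing.scale /= ?xx; ring.
Qed.

(** Change of variables by a translation [b]: on the torus the cell is traded
   for the Dirichlet domains of [0] and [b], which are translates of each
   other. *)
Lemma integral_cell_shift b (f : plane R -> \bar R) :
  measurable_fun setT (f : mplane R -> \bar R) ->
  (forall x, 0 <= f x)%E -> lattice_periodic Om f -> (forall x, ~ carrier Om x -> f x = 0%E) ->
  (\int[leb2 R]_(x in cell Om) f (x + b)%R =
   \int[leb2 R]_(x in cell Om `&` [set x | carrier Om (x - b)%R]) f x)%E.
Proof.
move=> mf f0 fper fout.
have mfb : measurable_fun setT ((fun x => f (x + b)) : mplane R -> \bar R).
  exact: measurableT_comp mf (measurable_fun_shift b).
have mC := measurable_cell hOm; have mO := measurable_carrier hOm.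
case E : Om => [U|l1 l2].
- have cE : cell Om = U by rewrite E.
  have oE : carrier Om = U by rewrite E.
  rewrite -E cE oE; rewrite cE in mC.
  transitivity (\int[leb2 R]_(x in [set x | U (x - b)%R]) f x)%E.
    have mU : measurable ([set x | U (x - b)] : set (mplane R)) by exact: measurable_shift.
    have := @integral_shift _ b _ f mU (measurable_funS measurableT (@subsetT _ _) mf).
    rewrite (_ : [set x | [set y | U (y - b)] (x + b)] = U)//.
    by apply/seteqP; split => x; rewrite /= addrK.
  rewrite setIC integral_mkcondr; apply: eq_integral => x _.
  by rewrite patchE; case: ifPn => //; rewrite notin_setE => nU; rewrite fout// oE.
- have oE : carrier Om = setT by rewrite E.
  have SE : [set x | site_cell Om (site b) ord0 (x + b)] = site_cell Om (site 0) ord0.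
    apply/seteqP; split => x /= [_ H]; split; rewrite ?oE// => j k hk; rewrite /site => kb.
      have := H ord0 k hk; rewrite /site.
      have -> : x + b - b = x - 0 by rewrite addrK subr0.
      have -> : x + b - (b + k) = x - (0 + k) by apply: plane_ext => /=; ring.
      by apply => /addr_eq_self k0; apply: kb; rewrite k0 addr0.
    have := H ord0 k hk; rewrite /site.
    have -> : x - 0 = x + b - b by rewrite addrK subr0.
    have -> : x - (0 + k) = x + b - (b + k) by apply: plane_ext => /=; ring.
    by apply => /addr_eq_self k0; apply: kb; rewrite k0 addr0.
  rewrite -E.
  rewrite (@integral_tile _ _ hOm 1 (site 0) (ltn0Sn 0) (@distinct_site _ _ 0)); last 3 first.
  + exact: measurable_funS mfb.
  + by move=> x _.
  + by move=> x k hk; rewrite addrAC; exact: fper.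
  rewrite big_ord1 -SE integral_shift; last 2 first.
  + exact: measurable_site_cell.
  + by apply: measurable_funS mf => //; exact: measurable_site_cell.
  rewrite (_ : _ `&` _ = cell Om); last by rewrite oE; apply/seteqP; split => x // [].
  rewrite (@integral_tile _ _ hOm 1 (site b) (ltn0Sn 0) (@distinct_site _ _ b)) ?big_ord1//.
  exact: measurable_funS mf.
Qed.

End strips.

(** * The transport term along an axis *)

Section transport_arithmetic.
Context {R : realFieldType}.
Implicit Types (t s e w : R).

(** Here [e] and [n'] are the squared distances to the generator before and after a
   translation of length [t], [s] is the component of the initial displacement along it, and
   [w], [w'] are the values of the weight at both points. *)
Lemma translation_gain t s e n' w w' K L D : 0 < t -> n' <= e + 2 * t * s + t ^+ 2 ->
  0 <= n' -> n' <= D -> 0 <= w -> w <= K -> `|w - w'| <= L * t ->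
  t * (2 * (- s) * w) <= e * w - n' * w' + (L * t * D + t ^+ 2 * K).
Proof.
move=> t0 H n0 nD w0 wK; rewrite ler_norml => /andP[h1 h2].
have A : 0 <= (e + 2 * t * s + t ^+ 2 - n') * w by rewrite mulr_ge0// subr_ge0.
have B : n' * (w' - w) <= n' * (L * t) by rewrite ler_wpM2l//; lra.
have C : n' * (L * t) <= D * (L * t).
  by rewrite ler_wpM2r//; lra.
have F : t ^+ 2 * w <= t ^+ 2 * K by rewrite ler_wpM2l// sqr_ge0.
lra.
Qed.

(** The same for a point that leaves the region: the term after translation is lost, and
   only the trivial bound on [s] remains. *)
Lemma boundary_loss t s e w K L d D : 0 < t -> `|s| <= d -> 0 <= e -> 0 <= w -> w <= K ->
  0 <= L -> 0 <= D ->
  t * (2 * (- s) * w) <= e * w - 0 + (L * t * D + t ^+ 2 * K) + 2 * t * d * K.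
Proof.
move=> t0; rewrite ler_norml => /andP[h1 h2] e0 w0 wK L0 D0.
have d0 : 0 <= d by lra.
have A : (- s) * w <= d * K.
  apply: le_trans (_ : d * w <= _); last by rewrite ler_wpM2l.
  by rewrite ler_wpM2r// lerNl.
have B := mulr_ge0 e0 w0; have t0' := ltW t0.
have C : 0 <= L * t * D by rewrite !mulr_ge0.
have K0 : 0 <= K by lra.
have F : 0 <= t ^+ 2 * K by rewrite mulr_ge0// sqr_ge0.
have G := ler_wpM2l t0' A; lra.
Qed.

Lemma transport_total A O d t K Cs L ar : A <= d ^+ 2 * K * (Cs * t) ->
  2 * t * d * K * O <= 2 * t * d * K * (Cs * t) ->
  A + (L * t * d ^+ 2 + t ^+ 2 * K) * ar + 2 * t * d * K * O <=
  t * (d ^+ 2 * (K * Cs + L * ar) + t * (K * ar + 2 * d * K * Cs)).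
Proof. by move=> *; lra. Qed.

End transport_arithmetic.

Section transport.
Context {R : realType}.
Variable (Om : region R).
Hypothesis hOm : admissible Om.
Implicit Types (x y z a b : plane R).

Lemma ler_small_error (A B P : R) : (forall t, 0 < t -> A <= B + t * P) -> A <= B.
Proof.
move=> H; apply/ler_addgt0Pr => e e0.
have P0 : 0 < `|P| + 1 by rewrite ltr_wpDl.
apply: le_trans (H (e / (`|P| + 1)) _) _; first by rewrite divr_gt0.
rewrite lerD2l mulrAC ler_pdivrMr// ler_pM2l//.
by apply: le_trans (ler_norm P) _; rewrite lerDl.
Qed.

(** The left-hand side is minus the integral of [w] times the derivative of the
   squared distance to the generators along [a]. Semiconcavity bounds it by a
   difference quotient, which a translation moves onto [w] and the strips lost
   at the boundary. *)
Lemma transport_axis (Cs : R) : 0 <= Cs ->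
  (forall a (t : R), axis_unit a -> 0 < t ->
  (leb2 R (cell Om `\` [set x | carrier Om (x + t *: a)%R]) <= (Cs * t)%:E)%E) ->
  forall (N : nat) (X : config R N) (d K L : R) (w : plane R -> R) a,
  (0 < N)%N -> configs Om N X -> distinct Om X -> max_diam Om X <= d ->
  axis_unit a -> lattice_periodic Om w ->
  (forall x, carrier Om x -> 0 <= w x <= K) -> 0 <= L ->
  (forall x y, carrier Om x -> carrier Om y -> `|w x - w y| <= L * enorm (x - y)) ->
  \sum_(i < N) \int[leb2 R]_(x in site_cell Om X i) (2 * dot (X i - x) a * w x) <=
  d ^+ 2 * (K * Cs + L * area Om (carrier Om)).
Proof.
move=> Cs0 strip N X d K L w a N0 cX dX hd au wper wK L0 wL.
have mC := measurable_cell hOm; have mO := measurable_carrier hOm.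
have d0 : 0 <= d by exact: (radius_ge0 hOm cX dX hd).
have [z cz] : exists z, carrier Om z by exists (X (Ordinal N0)); exact: cX.
have K0 : 0 <= K by have /andP[h1 h2] := wK z cz; exact: le_trans h1 h2.
have a1 := enorm_axis_unit au.
set ar := area Om (carrier Om).
have ar0 : 0 <= ar by exact: fine_ge0.
(* Difference quotient of step [t]; the error is linear in [t]. *)
apply: (@ler_small_error _ _ (K * ar + 2 * d * K * Cs)) => t t0.
pose b := t *: a.
have bt : enorm b = t by rewrite enormZ a1 mulr1 gtr0_norm.
(* The cells have radius at most [d], so the truncation is not felt on them; it makes
   the bound hold at the ties as well. Outside the region [psi] vanishes, and [out]
   marks the points that the translation pushes there. *)
pose phi x := Num.min (near_sq Om X x) (d ^+ 2).
pose psi := (fun x => phi x * w x) \_ (carrier Om).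
have phi0 x : 0 <= phi x by rewrite /phi le_min near_sq_ge0// sqr_ge0.
have phid x : phi x <= d ^+ 2 by rewrite /phi ge_min lexx orbT.
have psiE x : carrier Om x -> psi x = phi x * w x.
  by move=> cx; rewrite /psi patchE ifT// inE.
have psi_out x : ~ carrier Om x -> psi x = 0.
  by move=> cx; rewrite /psi patchE ifF//; apply/negP; rewrite inE.
have psi_ge0 x : 0 <= psi x.
  rewrite /psi patchE; case: ifPn => //; rewrite inE => cx.
  by have /andP[h1 h2] := wK x cx; rewrite mulr_ge0.
have psi_le x : psi x <= d ^+ 2 * K.
  rewrite /psi patchE; case: ifPn => [|_]; last by rewrite mulr_ge0// sqr_ge0.
  by rewrite inE => cx; have /andP[h1 h2] := wK x cx; rewrite ler_pM.
have psi_norm x : `|psi x| <= d ^+ 2 * K by rewrite ger0_norm.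
have mw : measurable_fun (carrier Om : set (mplane R)) (w : mplane R -> measurableTypeR R).
  by apply: (@measurable_lipschitz _ _ _ L); [exact: open_carrier|exact: wL].
have mpsi : measurable_fun setT (psi : mplane R -> measurableTypeR R).
  apply: (measurable_restrictT _ mO).1; apply: (@measurable_funM _ _ R) => //.
  apply: (@measurable_minr _ _ R); first exact: measurable_near_sq.
  exact: measurable_cst.
have psi_per : lattice_periodic Om psi.
  move=> x k hk; have [cx|cx] := pselect (carrier Om x).
    rewrite !psiE//; last by rewrite carrierD.
    by rewrite /phi near_sq_periodic// wper.
  by rewrite !psi_out// carrierD.
have mpsib : measurable_fun setT ((fun x => psi (x + b)) : mplane R -> measurableTypeR R).
  exact: measurableT_comp mpsi (measurable_fun_shift b).
pose out x : R := \1_(~` [set x | carrier Om (x + b)]) x.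
have mout : measurable_fun setT (out : mplane R -> measurableTypeR R).
  by apply: measurable_indic; apply: measurableC; exact: measurable_shift.
have out1 x : `|out x| <= 1 by rewrite /out indicE; case: (_ \in _); rewrite ?normr1// normr0.
pose c1 := L * t * d ^+ 2 + t ^+ 2 * K; pose c2 := 2 * t * d * K.
pose H x := psi x - psi (x + b) + c1 + c2 * out x.
have c20 : 0 <= c2 by rewrite /c2 !mulr_ge0// ltW.
have mT (f : plane R -> R) (D : set (plane R)) : measurable_fun setT (f : mplane R -> measurableTypeR R) ->
    measurable_fun (D : set (mplane R)) (f : mplane R -> measurableTypeR R).
  by move=> mf; exact: (measurable_funS measurableT (@subsetT _ _) mf).
have mH : measurable_fun setT (H : mplane R -> measurableTypeR R).
  apply: (@measurable_funD _ _ R); last first.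
    by apply: (@measurable_funM _ _ R) => //; exact: measurable_cst.
  apply: (@measurable_funD _ _ R); last exact: measurable_cst.
  exact: (@measurable_funB _ _ R).
have HB x : `|H x| <= d ^+ 2 * K + d ^+ 2 * K + `|c1| + c2.
  apply: le_trans (ler_normD _ _) _; apply: lerD.
    apply: le_trans (ler_normD _ _) _; apply: lerD => //.
    by apply: le_trans (ler_normB _ _) _; apply: lerD.
  by rewrite normrM (ger0_norm c20) ler_piMr.
have Hper : lattice_periodic Om H.
  move=> x k hk; rewrite /H [x + k + b]addrAC (psi_per x k hk) (psi_per (x + b) k hk).
  congr (_ + _ * _).
  rewrite /out !indicE; congr (_ : bool)%:R.
  by apply/idP/idP; rewrite !inE /= [x + k + b]addrAC => h1 h2; apply: h1;
    apply/(carrierD (x + b) hk).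
have point i x : site_cell Om X i x -> t * (2 * dot (X i - x) a * w x) <= H x.
  move=> Sx; have cx := site_cell_carrier Sx.
  have xd := site_cell_radius hOm cX dX hd Sx.
  have phix : phi x = enorm (x - X i) ^+ 2.
    rewrite /phi (near_sq_site_cell hOm N0 dX Sx); apply/min_idPl.
    by rewrite ler_sqr ?nnegrE ?enorm_ge0.
  have /andP[w0 wk] := wK x cx.
  have -> : dot (X i - x) a = - dot (x - X i) a by rewrite -dotNl opprB.
  rewrite /H (psiE x cx) phix.
  have [cxb|cxb] := pselect (carrier Om (x + b)).
    have -> : out x = 0 by rewrite /out indicE memNset//; apply.
    rewrite mulr0 addr0 psiE//; apply: translation_gain => //.
      apply: le_trans (_ : near_sq Om X (x + b) <= _); first by rewrite /phi ge_min lexx.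
      apply: le_trans (near_sq_le Om X (x + b) i) _.
      apply: le_trans (_ : enorm (x + b - X i) ^+ 2 <= _).
        by rewrite ler_sqr ?nnegrE ?enorm_ge0 ?pdist_ge0// pdist_le_enorm.
      rewrite (_ : x + b - X i = (x - X i) + b); last by rewrite addrAC.
      by rewrite sqr_enormD bt dotZr; lra.
    apply: le_trans (wL _ _ cx cxb) _.
    by rewrite (_ : x - (x + b) = - b) ?enormN ?bt//; apply: plane_ext => /=; ring.
  have -> : out x = 1 by rewrite /out indicE mem_set.
  rewrite mulr1 (psi_out _ cxb); apply: boundary_loss => //; rewrite ?sqr_ge0//.
  by apply: le_trans (norm_dot _ _) _; rewrite a1 mulr1.
have iT i : (leb2 R).-integrable (site_cell Om X i : set (mplane R))
    (EFin \o (fun x => 2 * dot (X i - x) a * w x)).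
  apply: (@integrable_site_cell _ _ hOm _ _ N0 dX _ _ (2 * d * K)).
    apply: (@measurable_funM _ _ R) => //; apply: (@measurable_funM _ _ R).
      exact: measurable_cst.
    have := @measurable_linear R (X i) (- a) (carrier Om) mO.
    by apply: eq_measurable_fun => x _; rewrite dotNr -dotNl opprB.
  move=> x Sx; have /andP[w0 wk] := wK x (site_cell_carrier Sx).
  rewrite !normrM (ger0_norm w0) (ger0_norm (ler0n _ 2)).
  apply: ler_pM => //.
  rewrite ler_pM2l//; apply: le_trans (norm_dot _ _) _; rewrite a1 mulr1 enormC.
  exact: (site_cell_radius hOm cX dX hd).
have step1 : t * \sum_(i < N) \int[leb2 R]_(x in site_cell Om X i) (2 * dot (X i - x) a * w x)
    <= \int[leb2 R]_(x in cell Om) H x.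
  rewrite (Rintegral_tile hOm N0 dX (K := d ^+ 2 * K + d ^+ 2 * K + `|c1| + c2))//; last exact: mT.
  rewrite mulr_sumr; apply: ler_sum => i _.
  have mS := measurable_site_cell hOm X i.
  rewrite -RintegralZl//; apply: le_Rintegral => //; last exact: point.
    exact: (integrableZl mS _ (iT i)).
  apply: (@integrable_site_cell _ _ hOm _ _ N0 dX _ _ (d ^+ 2 * K + d ^+ 2 * K + `|c1| + c2)) => //.
  exact: mT.
have ic (f : plane R -> R) (B : R) : measurable_fun setT (f : mplane R -> measurableTypeR R) ->
    (forall x, `|f x| <= B) -> (leb2 R).-integrable (cell Om : set (mplane R)) (EFin \o f).
  by move=> mf fB; apply: (@integrable_cell _ _ hOm _ B) => //; exact: mT.
have i1 := ic _ _ mpsi psi_norm.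
have i2 : (leb2 R).-integrable (cell Om : set (mplane R)) (EFin \o (fun x => psi (x + b))).
  by apply: (ic _ (d ^+ 2 * K)).
have i3 : (leb2 R).-integrable (cell Om : set (mplane R)) (EFin \o out) by exact: (ic _ 1).
have i4 : (leb2 R).-integrable (cell Om : set (mplane R)) (EFin \o (fun=> c1)).
  by apply: (ic _ `|c1|) => //; exact: measurable_cst.
have i5 := integrableB mC i1 i2.
have i6 := integrableD mC i5 i4.
have i7 := integrableZl mC c2 i3.
have E1 : \int[leb2 R]_(x in cell Om) H x =
    \int[leb2 R]_(x in cell Om) psi x - \int[leb2 R]_(x in cell Om) psi (x + b) +
    c1 * ar + c2 * \int[leb2 R]_(x in cell Om) out x.
  rewrite /H RintegralD//; rewrite RintegralD//; rewrite RintegralB// RintegralZl// Rintegral_cst//.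
  by rewrite /ar /area setIidl// => x; exact: cell_carrier.
have stripE a' : axis_unit a' -> exists2 V, V <= Cs * t &
    leb2 R (cell Om `\` [set x | carrier Om (x + t *: a')]) = V%:E.
  move=> au'; exists (fine (leb2 R (cell Om `\` [set x | carrier Om (x + t *: a')]))).
    by rewrite -lee_fin fineK ?strip// ge0_fin_numE//; apply: le_lt_trans (strip a' t au' t0) (ltry _).
  by rewrite fineK// ge0_fin_numE//; apply: le_lt_trans (strip a' t au' t0) (ltry _).
have outE : \int[leb2 R]_(x in cell Om) out x <= Cs * t.
  have [V VC VE] := stripE a au.
  rewrite /Rintegral /out integral_indic//; last first.
    by apply: measurableC; exact: measurable_shift.
  by rewrite setIC -setDE VE.
(* Translation invariance: the two integrals differ by the strip of points that are
   not reached. *)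
have diffE : \int[leb2 R]_(x in cell Om) psi x - \int[leb2 R]_(x in cell Om) psi (x + b) <=
    d ^+ 2 * K * (Cs * t).
  have -> : \int[leb2 R]_(x in cell Om) psi (x + b) =
      \int[leb2 R]_(x in cell Om `&` [set x | carrier Om (x - b)]) psi x.
    rewrite /Rintegral (@integral_cell_shift _ _ hOm b (EFin \o psi))//.
    + exact/measurable_EFinP.
    + by move=> x k hk /=; rewrite psi_per.
    + by move=> x cx /=; rewrite psi_out.
  have mD := measurable_strip hOm (t *: (- a)).
  have mI : measurable (cell Om `&` [set x | carrier Om (x - b)] : set (mplane R)).
    by apply: measurableI => //; exact: measurable_shift.
  have CE : cell Om = (cell Om `&` [set x | carrier Om (x - b)]) `|`
      (cell Om `\` [set x | carrier Om (x + t *: - a)]).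
    by rewrite scalerN -/b setDE -setIUr setUv setIT.
  have [V VC VE] := stripE _ (axis_unitN au).
  have iD : (leb2 R).-integrable (cell Om `\` [set x | carrier Om (x + t *: - a)] : set (mplane R)) (EFin \o psi).
    by apply: integrableS i1 => //; exact: subIsetl.
  rewrite {1}CE Rintegral_setU//; last 2 first.
  + by rewrite -CE.
  + by rewrite disj_set2E scalerN -/b setDE setIACA setICr setI0.
  rewrite addrAC subrr add0r.
  apply: le_trans (_ : \int[leb2 R]_(x in cell Om `\` [set x | carrier Om (x + t *: - a)]) (d ^+ 2 * K) <= _).
    apply: le_Rintegral => //.
    apply: (@integrable_bounded _ _ _ `|d ^+ 2 * K|) => //.
    by rewrite VE ltry.
  rewrite Rintegral_cst// VE /= ler_wpM2l//; first by rewrite mulr_ge0// sqr_ge0.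
rewrite -(ler_pM2l t0); apply: le_trans step1 _; rewrite E1.
have outE2 := ler_wpM2l c20 outE.
exact: transport_total diffE outE2.
Qed.

End transport.

(** * The transport term for a Lipschitz field *)

Section transport_bound.
Context {R : realType}.
Variable (Om : region R).
Hypothesis hOm : admissible Om.
Implicit Types (x y z a b : plane R).

(** Two distinct points are what makes the suprema in [c01norm] nonnegative. *)
Lemma carrier_two_points : exists x y, [/\ carrier Om x, carrier Om y & x <> y].
Proof.
have [z cz] : exists z, carrier Om z.
  by move: hOm; case: Om => [U [[x Ux] _ _ _ _]|l1 l2 _] /=; [exists x|exists 0].
have [e e0 He] := open_enorm_ball (open_carrier hOm) cz.
exists z, (z + (e / 2, 0)); split => //.
  apply: He; rewrite addrAC subrr add0r; apply: le_lt_trans (enorm_le_sum _) _.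
  by rewrite /= normr0 addr0 gtr0_norm ?divr_gt0//; lra.
move=> /esym /(congr1 (fun t => - z + t)); rewrite addKr addNr => /(congr1 fst) /= /eqP.
by rewrite gt_eqF// divr_gt0.
Qed.

(** Values of the Lipschitz quotient at points that coincide on the torus are not controlled
   by the norm, but there periodicity makes the increment vanish. *)
Lemma enorm_fin_c01norm (u : plane R -> plane R) : C01 Om u ->
  [/\ forall x, carrier Om x -> enorm (u x) <= fine (c01norm Om u) &
      forall x y, carrier Om x -> carrier Om y ->
        enorm (u x - u y) <= fine (c01norm Om u) * pdist Om x y].
Proof.
move=> [uper]; rewrite /c01norm.
set S1 := ereal_sup _; set S2 := ereal_sup _ => fin.
have up x : carrier Om x -> ((enorm (u x))%:E <= S1)%E.
  by move=> cx; apply: ereal_sup_ubound; exists x.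
have lip x y : carrier Om x -> carrier Om y -> x <> y ->
    ((enorm (u x - u y) / pdist Om x y)%:E <= S2)%E.
  by move=> cx cy xy; apply: ereal_sup_ubound; exists (x, y).
have [x0 [y0 [cx0 cy0 xy0]]] := carrier_two_points.
have S10 : (0 <= S1)%E by apply: le_trans (up _ cx0); rewrite lee_fin enorm_ge0.
have S20 : (0 <= S2)%E.
  by apply: le_trans (lip _ _ cx0 cy0 xy0); rewrite lee_fin divr_ge0 ?enorm_ge0 ?pdist_ge0.
have f1 : S1 \is a fin_num.
  by rewrite ge0_fin_numE//; apply: le_lt_trans fin; exact: leeDl.
have f2 : S2 \is a fin_num.
  by rewrite ge0_fin_numE//; apply: le_lt_trans fin; exact: leeDr.
have F1 : fine S1 <= fine (S1 + S2) by rewrite fineD// lerDl fine_ge0.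
have F2 : fine S2 <= fine (S1 + S2) by rewrite fineD// lerDr fine_ge0.
split=> [x cx|x y cx cy].
  by apply: le_trans F1; rewrite -lee_fin fineK//; exact: up.
have [xy|xy] := pselect (x = y).
  by rewrite xy subrr enorm0 mulr_ge0 ?pdist_ge0//; exact: le_trans (fine_ge0 S10) F1.
have [p0|p0] := eqVneq (pdist Om x y) 0.
  have hk := pdist_eq0 hOm p0.
  have -> : u x = u y by rewrite -(uper y _ hk) addrC subrK.
  by rewrite subrr enorm0 p0 mulr0.
have pp : 0 < pdist Om x y by rewrite lt_neqAle eq_sym p0 pdist_ge0.
rewrite -ler_pdivrMr//; apply: le_trans F2.
by rewrite -lee_fin fineK//; exact: lip.
Qed.

(** The sum is the derivative of the energy along the field [u]. The value of [u] at the
   generator is first replaced by its value at the current point, at a cost of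
   [M * d ^+ 2] per unit area. The components of [u], made nonnegative by adding [M], then
   serve as weights along the axes, and the constant [M] as a weight along the opposite
   directions. *)
Lemma transport_bound : exists2 C : R, 0 < C &
  forall (N : nat) (X : config R N) (d M : R) (u : plane R -> plane R),
  (0 < N)%N -> configs Om N X -> distinct Om X -> max_diam Om X <= d ->
  (forall i, volume Om X i != 0) ->
  lattice_periodic Om u -> 0 <= M ->
  (forall x, carrier Om x -> enorm (u x) <= M) ->
  (forall x y, carrier Om x -> carrier Om y -> enorm (u x - u y) <= M * pdist Om x y) ->
  - (2 * \sum_(i < N) volume Om X i * dot (displacement Om X i) (u (X i))) <= C * d ^+ 2 * M.
Proof.
have [Cs Cs0 strip] := strip_small hOm.
set ar := area Om (carrier Om).
have ar0 : 0 < ar by exact: area_gt0.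
exists (6 * Cs + 4 * ar); first by rewrite ltr_wpDl ?mulr_ge0// mulr_gt0.
move=> N X d M u N0 cX dX hd V0 uper M0 uM uL.
have mO := measurable_carrier hOm.
have d0 : 0 <= d by exact: (radius_ge0 hOm cX dX hd).
have uL' x y : carrier Om x -> carrier Om y -> enorm (u x - u y) <= M * enorm (x - y).
  by move=> cx cy; apply: le_trans (uL x y cx cy) _; rewrite ler_wpM2l// pdist_le_enorm.
pose W (a : plane R) (w : plane R -> R) :=
  \sum_(i < N) \int[leb2 R]_(x in site_cell Om X i) (2 * dot (X i - x) a * w x).
pose w1 x := (u x).1 + M; pose w2 x := (u x).2 + M.
have b1 x : carrier Om x -> - M <= (u x).1 <= M.
  by move=> cx; rewrite -ler_norml; apply: le_trans (fst_le_enorm _) _; exact: uM.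
have b2 x : carrier Om x -> - M <= (u x).2 <= M.
  by move=> cx; rewrite -ler_norml; apply: le_trans (snd_le_enorm _) _; exact: uM.
have T1 : W (1, 0) w1 <= d ^+ 2 * (2 * M * Cs + M * ar).
  apply: (transport_axis hOm Cs0 strip N0 cX dX hd) => //.
  - exact: Or41.
  - by move=> x k hk; rewrite /w1 uper.
  - by move=> x /b1 /andP[? ?]; rewrite /w1; apply/andP; split; lra.
  - move=> x y cx cy; rewrite /w1 opprD addrACA subrr addr0.
    by apply: le_trans (uL' x y cx cy); exact: (fst_le_enorm (u x - u y)).
have T2 : W (-1, 0) (cst M) <= d ^+ 2 * (M * Cs + 0 * ar).
  apply: (transport_axis hOm Cs0 strip N0 cX dX hd) => //.
  - exact: Or42.
  - by move=> x _; rewrite M0 lexx.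
  - by move=> x y _ _; rewrite subrr normr0 mul0r.
have T3 : W (0, 1) w2 <= d ^+ 2 * (2 * M * Cs + M * ar).
  apply: (transport_axis hOm Cs0 strip N0 cX dX hd) => //.
  - exact: Or43.
  - by move=> x k hk; rewrite /w2 uper.
  - by move=> x /b2 /andP[? ?]; rewrite /w2; apply/andP; split; lra.
  - move=> x y cx cy; rewrite /w2 opprD addrACA subrr addr0.
    by apply: le_trans (uL' x y cx cy); exact: (snd_le_enorm (u x - u y)).
have T4 : W (0, -1) (cst M) <= d ^+ 2 * (M * Cs + 0 * ar).
  apply: (transport_axis hOm Cs0 strip N0 cX dX hd) => //.
  - exact: Or44.
  - by move=> x _; rewrite M0 lexx.
  - by move=> x y _ _; rewrite subrr normr0 mul0r.
have mcoord (f : plane R -> R) : (forall x y, `|f x - f y| <= enorm (x - y)) ->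
    measurable_fun (carrier Om : set (mplane R)) ((fun x => f (u x)) : mplane R -> measurableTypeR R).
  move=> fl; apply: (@measurable_lipschitz _ _ _ M); first exact: open_carrier.
  by move=> x y cx cy; apply: le_trans (fl _ _) _; exact: uL'.
have m1 := mcoord fst (fun x y => fst_le_enorm (x - y)).
have m2 := mcoord snd (fun x y => snd_le_enorm (x - y)).
have mX i a : measurable_fun (carrier Om : set (mplane R))
    ((fun x => 2 * dot (X i - x) a) : mplane R -> measurableTypeR R).
  apply: (@measurable_funM _ _ R); first exact: measurable_cst.
  have := @measurable_linear R (X i) (- a) (carrier Om) mO.
  by apply: eq_measurable_fun => x _; rewrite dotNr -dotNl opprB.
have iW i a (w : plane R -> R) (K : R) : measurable_fun (carrier Om : set (mplane R)) (w : mplane R -> measurableTypeR R) ->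
    (forall x, carrier Om x -> `|w x| <= K) ->
    (leb2 R).-integrable (site_cell Om X i : set (mplane R))
      (EFin \o (fun x => 2 * dot (X i - x) a * w x)).
  move=> mw wK; apply: (@integrable_site_cell _ _ hOm _ _ N0 dX _ _ (2 * (d * enorm a) * K)).
    by apply: (@measurable_funM _ _ R) => //; exact: mX.
  move=> x Sx; have cx := site_cell_carrier Sx.
  rewrite normrM; apply: ler_pM => //; last exact: wK.
  rewrite normrM (ger0_norm (ler0n _ 2)) ler_pM2l//.
  apply: le_trans (norm_dot _ _) _; rewrite ler_wpM2r ?enorm_ge0// enormC.
  exact: (site_cell_radius hOm cX dX hd).
have i1 i : (leb2 R).-integrable (site_cell Om X i : set (mplane R))
      (EFin \o (fun x => 2 * dot (X i - x) (1, 0) * w1 x)).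
  apply: (iW _ _ _ (M + M)).
    by apply: (@measurable_funD _ _ R) => //; exact: measurable_cst.
  by move=> x /b1 /andP[? ?]; rewrite /w1 ger0_norm; lra.
have i3 i : (leb2 R).-integrable (site_cell Om X i : set (mplane R))
      (EFin \o (fun x => 2 * dot (X i - x) (0, 1) * w2 x)).
  apply: (iW _ _ _ (M + M)).
    by apply: (@measurable_funD _ _ R) => //; exact: measurable_cst.
  by move=> x /b2 /andP[? ?]; rewrite /w2 ger0_norm; lra.
have iM i a : (leb2 R).-integrable (site_cell Om X i : set (mplane R))
      (EFin \o (fun x => 2 * dot (X i - x) a * M)).
  apply: (iW _ _ (cst M) `|M|) => //.
have mS i := measurable_site_cell hOm X i.
have iE i : (leb2 R).-integrable (site_cell Om X i : set (mplane R)) (EFin \o (fun=> 2 * M * d ^+ 2)).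
  apply: (@integrable_site_cell _ _ hOm _ _ N0 dX _ _ `|2 * M * d ^+ 2|); last by [].
  exact: measurable_cst.
have cell_bound i : - (2 * (volume Om X i * dot (displacement Om X i) (u (X i)))) <=
    \int[leb2 R]_(x in site_cell Om X i) (2 * dot (X i - x) (1, 0) * w1 x) +
    \int[leb2 R]_(x in site_cell Om X i) (2 * dot (X i - x) (-1, 0) * M) +
    \int[leb2 R]_(x in site_cell Om X i) (2 * dot (X i - x) (0, 1) * w2 x) +
    \int[leb2 R]_(x in site_cell Om X i) (2 * dot (X i - x) (0, -1) * M) +
    2 * M * d ^+ 2 * volume Om X i.
  have j1 := integrableD (mS i) (i1 i) (iM i (-1, 0)).
  have j2 := integrableD (mS i) j1 (i3 i).
  have j3 := integrableD (mS i) j2 (iM i (0, -1)).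
  have j4 := integrableD (mS i) j3 (iE i).
  have iL := integrable_dot hOm N0 dX (u (X i)) (cX i).
  rewrite -dot_displacement// -mulNr -RintegralZl//.
  rewrite -(Rintegral_site_cell_cst hOm N0 dX).
  rewrite -RintegralD//; rewrite -RintegralD//; rewrite -RintegralD//; rewrite -RintegralD//.
  apply: le_Rintegral => //; first exact: (integrableZl (mS i) (-2) iL).
  move=> x Sx; have cx := site_cell_carrier Sx.
  have xd := site_cell_radius hOm cX dX hd Sx.
  have h : dot (X i - x) (u (X i) - u x) <= M * d ^+ 2.
    apply: le_trans (ler_norm _) _; apply: le_trans (norm_dot _ _) _.
    rewrite expr2 mulrA mulrC; apply: ler_pM; rewrite ?enorm_ge0//; last by rewrite enormC.
    apply: le_trans (uL' _ _ (cX i) cx) _; rewrite ler_wpM2l//.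
    by rewrite enormC.
  move: h; rewrite dotDr dotNr /w1 /w2 /dot /=; lra.
have sumV := sum_volume hOm N0 dX.
have -> : - (2 * \sum_(i < N) volume Om X i * dot (displacement Om X i) (u (X i))) =
   \sum_(i < N) - (2 * (volume Om X i * dot (displacement Om X i) (u (X i)))).
  by rewrite mulr_sumr sumrN.
apply: le_trans (_ : W (1, 0) w1 + W (-1, 0) (cst M) + W (0, 1) w2 + W (0, -1) (cst M) +
   2 * M * d ^+ 2 * ar <= _).
  rewrite /ar -sumV mulr_sumr /W -!big_split; apply: ler_sum => i _; exact: cell_bound.
move: T1 T2 T3 T4; move: (W _ _) (W _ _) (W _ _) (W _ _) => A1 A2 A3 A4.
clear; lra.
Qed.

End transport_bound.

(** * Monotonicity of absolutely continuous functions *)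

Section absolute_continuity.
Context {R : realType}.

Definition intervals_in (a b : R) (m : nat) (p q : 'I_m -> R) :=
  (forall k, a <= p k /\ p k <= q k /\ q k <= b) /\
  trivIset setT (fun k => `]p k, q k[%classic).

Definition abs_cont (a b : R) (h : R -> R) : Prop :=
  forall e : R, 0 < e -> exists2 d : R, 0 < d &
    forall (m : nat) (p q : 'I_m -> R), intervals_in a b p q ->
      \sum_(k < m) (q k - p k) < d ->
      \sum_(k < m) `|h (q k) - h (p k)| < e.

(** Disjoint intervals inside a set of small measure have a small total length: this is how
   null sets meet absolute continuity. *)
Lemma sum_length (a b : R) (m : nat) (p q : 'I_m -> R) (W : set (measurableTypeR R)) :
  measurable W -> intervals_in a b p q -> (forall k, `]p k, q k[ `<=` W) ->
  ((\sum_(k < m) (q k - p k))%:E <= leb1 R W)%E.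
Proof.
move=> mW [pq dis] sub.
have -> : (\sum_(k < m) (q k - p k))%:E = (\sum_(k < m) leb1 R `]p k, q k[%classic)%E.
  rewrite -sumEFin; apply: eq_bigr => k _.
  by rewrite leb1_itv//; have [_ []] := pq k.
have mI k : measurable (`]p k, q k[%classic : set (measurableTypeR R)).
  exact: measurable_itv.
have := @ge0_integral_bigsetU _ _ _ (leb1 R) _ (fun k => `]p k, q k[%classic)
  (cst 1%E) (index_enum 'I_m) mI (index_enum_uniq _) (sub_trivIset (@subsetT _ _) dis)
  (@measurable_cst _ _ _ _ _ _) (fun _ _ => lee01).
have IC (A : set (measurableTypeR R)) : measurable A ->
    (\int[leb1 R]_(x in A) cst 1%E x = leb1 R A)%E.
  by move=> mA; rewrite integral_cst// mul1e.
have mU : measurable (\big[setU/set0]_(k < m) `]p k, q k[%classic : set (measurableTypeR R)).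
  by apply: bigsetU_measurable => k _; exact: mI.
rewrite IC// (eq_bigr _ (fun k _ => IC _ (mI k))) => <-.
apply: le_measure; rewrite ?inE//.
by rewrite -bigcup_seq => x [k _]; exact: sub.
Qed.

Lemma abs_cont_cvg (a b : R) (h : R -> R) : abs_cont a b h ->
  forall c, a <= c <= b -> forall e : R, 0 < e -> exists2 d : R, 0 < d &
    forall t, a <= t <= c -> c - t < d -> `|h c - h t| < e.
Proof.
move=> ach c /andP[ac cb] e e0; have [d d0 H] := ach e e0; exists d => // t /andP[at_ tc] ctd.
have := H 1%N (fun=> t) (fun=> c); rewrite !big_ord1; apply => //.
split; first by move=> _; split => //.
by apply/trivIsetP => i j _ _; rewrite !ord1 eqxx.
Qed.

Section dini.
Variables (T : R) (h : R -> R).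
Hypothesis (T0 : 0 < T) (ach : abs_cont 0 T h).

(** A lower Dini condition that holds outside a null set is enough for
   monotonicity: the exceptional points are covered by an open set of small
   measure, on which an absolutely continuous function varies little. *)
Lemma abs_cont_nonincreasing (E : set R) : (leb1 R).-negligible E ->
  (forall t, 0 < t < T -> ~ E t -> forall e : R, 0 < e -> exists2 d : R, 0 < d &
    forall s, 0 < s < d -> h (t + s) - h t <= e * s) ->
  h T <= h 0.
Proof.
move=> [A [mA A0 EA]] dini.
suff H e : 0 < e -> h T - h 0 <= e * T + e.
  rewrite -subr_le0; apply/ler_addgt0Pr => e e0; rewrite add0r.
  have T1 : 0 < T + 1 by rewrite addr_gt0.
  apply: le_trans (H (e / (T + 1)) (divr_gt0 e0 T1)) _.
  rewrite (_ : _ + _ = e)//; field; exact: lt0r_neq0.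
move=> e0; have [d d0 Hd] := ach e0.
(* The initial time joins the exceptional set, since the Dini condition concerns
   interior times only. *)
have [W [oW AW Wd]] : exists W : set R, [/\ open W, A `|` [set 0] `<=` W & (leb1 R W < d%:E)%E].
  have m0 : measurable ([set 0] : set (measurableTypeR R)) by exact: measurable_set1.
  have mD : measurable (A `|` [set 0] : set (measurableTypeR R)) by exact: measurableU.
  have D0 : leb1 R (A `|` [set 0]) = 0%E.
    by rewrite measureU0//; exact: lebesgue_measure_set1.
  have [|W [oW AW mW]] := lebesgue_regularity_outer mD _ d0; first by rewrite [ltLHS]D0 ltry.
  exists W; split => //; apply: le_lt_trans mW.
  have mW' : measurable (W : set (measurableTypeR R)) by exact: open_measurable.
  have mWD : measurable (W `\` (A `|` [set 0]) : set (measurableTypeR R)) by exact: measurableD.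
  have <- : leb1 R ((W `\` (A `|` [set 0])) `|` (A `|` [set 0])) =
      leb1 R (W `\` (A `|` [set 0])) by exact: measureU0.
  apply: le_measure; rewrite ?inE//; first exact: measurableU.
  by move=> x Wx; have [Dx|Dx] := pselect ((A `|` [set 0]) x); [right|left].
have mW : measurable (W : set (measurableTypeR R)) by exact: open_measurable.
(* [V t] is the variation of [h] on [W] up to time [t]; it is at most [e] because [W] is
   small. The estimate [Q] is propagated from [0] to [T]: by [V] inside [W], by the
   Dini condition elsewhere. *)
pose fam t (x : R) := exists m (p q : 'I_m -> R), [/\ intervals_in 0 t p q,
  forall k, `]p k, q k[ `<=` W & x = \sum_(k < m) `|h (q k) - h (p k)|].
have fam_bound t x : t <= T -> fam t x -> x <= e.
  move=> tT [m [p [q [[pq dis] sub ->]]]]; apply/ltW/Hd.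
    split => // k; have [? [? ?]] := pq k.
    by do 2 split => //; exact: le_trans tT.
  by rewrite -lte_fin; apply: le_lt_trans Wd; apply: (@sum_length 0 t).
have fam0 t : fam t 0.
  exists 0%N, (fun=> 0), (fun=> 0); split; last by rewrite big_ord0.
    by split; [case|move=> i j; case: i].
  by case.
pose V t := sup (fam t).
have Vub t : t <= T -> has_ubound (fam t).
  by move=> tT; exists e => x; exact: fam_bound.
have Vle t : t <= T -> V t <= e.
  by move=> tT; apply: ge_sup; [exists 0; exact: fam0|move=> x; exact: fam_bound].
have Vmono s t : s <= t -> t <= T -> V s <= V t.
  move=> st tT; apply: ge_sup; first by exists 0; exact: fam0.
  move=> x [m [p [q [[pq dis] sub ->]]]]; apply: ub_le_sup; first exact: Vub.
  exists m, p, q; split => //; split => // k; have [? [? ?]] := pq k.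
  by do 2 split => //; exact: le_trans st.
have Vadd s t : 0 <= s -> s <= t -> t <= T -> `]s, t[ `<=` W -> V s + `|h t - h s| <= V t.
  move=> s0 st tT stO; rewrite -lerBrDr; apply: ge_sup; first by exists 0; exact: fam0.
  move=> x [m [p [q [[pq dis] sub ->]]]]; rewrite lerBrDr; apply: ub_le_sup; first exact: Vub.
  exists m.+1, (fun k => if unlift ord0 k is Some j then p j else s),
    (fun k => if unlift ord0 k is Some j then q j else t); split.
  - split.
      move=> k; case: unliftP => [j _|_]; last by [].
      by have [? [? ?]] := pq j; do 2 split => //; exact: le_trans st.
    apply/trivIsetP => i j _ _; case: unliftP => [i' ->|->]; case: unliftP => [j' ->|->] ij.
    + by move/trivIsetP : dis; apply => //; apply: contra ij => /eqP ->.
    + apply/seteqP; split => // y [/=]; rewrite !in_itv /= => /andP[_ y1] /andP[y2 _].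
      by have [_ [_ y3]] := pq i'; have := lt_trans y2 (lt_le_trans y1 y3); rewrite ltxx.
    + apply/seteqP; split => // y [/=]; rewrite !in_itv /= => /andP[y2 _] /andP[_ y1].
      by have [_ [_ y3]] := pq j'; have := lt_trans y2 (lt_le_trans y1 y3); rewrite ltxx.
    + by rewrite eqxx in ij.
  - by move=> k; case: unliftP.
  - rewrite big_ord_recl unlift_none addrC; congr (_ + _).
    by apply: eq_bigr => k _; rewrite liftK.
pose Q t := 0 <= t <= T /\ h t - h 0 <= e * t + V t.
have V0 t : t <= T -> 0 <= V t.
  by move=> tT; apply: ub_le_sup; [exact: Vub|exact: fam0].
have Q0 : Q 0.
  by split; [rewrite lexx ltW|rewrite subrr mulr0 add0r V0// ltW].
have Qsup : has_sup Q.
  by split; [exists 0|exists T => t [/andP[]]].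
pose c := sup Q.
have cT : c <= T by apply: ge_sup; [exists 0|move=> t [/andP[]]].
have c0 : 0 <= c by apply: ub_le_sup => //; case: Qsup.
have Qc : Q c.
  split; first by rewrite c0.
  apply/ler_addgt0Pr => eta eta0.
  have [dl dl0 Hc] := abs_cont_cvg ach (introT andP (conj c0 cT)) eta0.
  have [t Qt ct] := sup_adherent dl0 Qsup.
  have tc : t <= c by apply: ub_le_sup => //; case: Qsup.
  have [/andP[t0 tT] ht] := Qt.
  have := Hc t; rewrite t0 tc => /(_ isT); rewrite -/c in ct.
  have cdl : c - t < dl by rewrite ltrBlDr -ltrBlDl.
  move=> /(_ cdl); rewrite ltr_norml => /andP[_ h1].
  have h2 := Vmono _ _ tc cT; have h3 := ler_wpM2l (ltW e0) tc.
  by clear -h1 h2 h3 ht; lra.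
(* A step to the right of the supremum [c] that keeps [Q] is a contradiction. *)
have Qnext s : 0 < s -> c + s <= T -> h (c + s) - h c <= e * s + (V (c + s) - V c) -> False.
  move=> s0 csT hs.
  have Qs : Q (c + s).
    split; first by rewrite csT addr_ge0// ltW.
    by case: Qc => _ hc; clear -hs hc; lra.
  have : c + s <= c by apply: ub_le_sup => //; case: Qsup.
  by rewrite gerDl leNgt s0.
have [ceq|cneq] := eqVneq c T.
  by case: Qc => _; rewrite ceq => H; apply: le_trans H _; rewrite lerD2l Vle.
have cltT : c < T by rewrite lt_neqAle cneq.
exfalso.
have [Oc|Oc] := pselect (W c).
  have : nbhs c W by apply: open_nbhs_nbhs; split.
  move=> /nbhs_ballP[r /= r0 br].
  pose s := Num.min (r / 2) (T - c).
  have s0 : 0 < s by rewrite lt_min subr_gt0 cltT divr_gt0.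
  have csT : c + s <= T by rewrite -lerBrDl ge_min lexx orbT.
  apply: (Qnext s) => //.
  have := Vadd c (c + s) c0 _ csT; rewrite lerDl (ltW s0) => /(_ isT) H.
  have {}H : V c + `|h (c + s) - h c| <= V (c + s).
    apply: H => y /=; rewrite in_itv /= => /andP[cy ycs]; apply: br.
    rewrite /ball /= ltr_distl; apply/andP; split; last by rewrite (lt_trans cy)// ltrDl.
    have : s <= r / 2 by rewrite ge_min lexx.
    by clear -ycs r0; lra.
  have := ler_norm (h (c + s) - h c); have := mulr_gt0 e0 s0; clear -H; lra.
have cpos : 0 < c.
  by rewrite lt_neqAle c0 andbT; apply/eqP => c00; apply: Oc; apply: AW; right.
have cin : 0 < c < T by rewrite cpos.
have cE : ~ E c by move=> /EA Ac; apply: Oc; apply: AW; left.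
have [d' d'0 Hd'] := dini c cin cE e e0.
pose s := Num.min (d' / 2) (T - c).
have s0 : 0 < s by rewrite lt_min subr_gt0 cltT divr_gt0.
have csT : c + s <= T by rewrite -lerBrDl ge_min lexx orbT.
have sd : s < d'.
  by apply: le_lt_trans (_ : d' / 2 < _); [rewrite ge_min lexx|rewrite ltr_pdivrMr// ltr_pMr// ltr1n].
apply: (Qnext s) => //.
have cs : c <= c + s by rewrite lerDl ltW.
apply: le_trans (Hd' s _) _; first by rewrite s0.
by rewrite lerDl subr_ge0 Vmono.
Qed.

End dini.

End absolute_continuity.

(** * Comparison of increments with an integral *)

Section derive_expansion.
Context {R : realType} {V : normedModType R}.

Lemma is_derive_expansion (f : R -> V) (t : R) (l : V) : is_derive t 1 f l ->
  forall e : R, 0 < e -> exists2 d : R, 0 < d &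
    forall s, 0 < s < d -> `|f (t + s) - f t - s *: l| <= e * s.
Proof.
move=> [df <-] e e0.
move: df => /cvgrPdist_le /(_ e e0).
rewrite nearE /= => /nbhs_ballP[d /= d0 H]; exists d => // s /andP[s0 sd].
have := H s; rewrite /ball /= sub0r normrN gtr0_norm// => /(_ sd) /(_ (lt0r_neq0 s0)).
rewrite /= [s *: 1]mulr1 [s + t]addrC => h.
rewrite (_ : f (t + s) - f t - s *: 'D_1 f t = - (s *: ('D_1 f t - s^-1 *: (f (t + s) - f t)))).
  rewrite normrN normrZ gtr0_norm// mulrC; apply: ler_wpM2r; [exact: ltW|exact: h].
by rewrite scalerBr scalerA divff ?lt0r_neq0// scale1r opprB.
Qed.

End derive_expansion.

Section integral_comparison.
Context {R : realType}.

Lemma integrable_subT (f : R -> \bar R) (A : set (measurableTypeR R)) : measurable A ->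
  (leb1 R).-integrable setT f -> (leb1 R).-integrable A f.
Proof. by move=> mA; apply: integrableS => //; exact: measurableT. Qed.

Variables (T : R) (g : R -> R).
Hypothesis (T0 : 0 < T).
Hypothesis ig : (leb1 R).-integrable (`]0, T[%classic : set (measurableTypeR R)) (EFin \o g).

Let g0 : R -> R := g \_ `]0, T[%classic.
Let F (x : R) : R := \int[leb1 R]_(t in [set` `]-oo, x]]) g0 t.

Let ig0 : (leb1 R).-integrable setT (EFin \o g0).
Proof.
rewrite /g0 -restrict_EFin; apply/integrable_restrict => //=.
by rewrite setTI.
Qed.

Let F_sub (p q : R) : p <= q -> `|F q - F p| <= \int[leb1 R]_(t in [set` `]p, q[]) `|g0 t|.
Proof.
move=> pq; rewrite /F.
have iq : (leb1 R).-integrable [set` Interval -oo%O (BRight q)] (EFin \o g0).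
  by apply: integrable_subT => //; exact: measurable_itv.
have iabs : (leb1 R).-integrable setT (EFin \o (fun t => `|g0 t|)) by exact: integrable_norm.
rewrite (@Rintegral_itvB R g0 -oo%O (BRight q) p iq)//.
rewrite (@Rintegral_itv_bndo_bndc R (BRight p) q (fun t => `|g0 t|)); last first.
  by apply: integrable_subT => //; exact: measurable_itv.
apply: le_normr_Rintegral => //.
by apply: integrable_subT => //; exact: measurable_itv.
Qed.

Let F_abs_cont : abs_cont 0 T F.
Proof.
move=> e e0; have [d [d0 H]] := integral_normr_continuous ig0 e0.
exists d => // m p q [pq dis] small.
have mI k : measurable (`]p k, q k[%classic : set (measurableTypeR R)).
  exact: measurable_itv.
set U := \big[setU/set0]_(k < m) `]p k, q k[%classic.
have mU : measurable (U : set (measurableTypeR R)).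
  by apply: bigsetU_measurable => k _; exact: mI.
have iabs : (leb1 R).-integrable setT (EFin \o (fun t => `|g0 t|)) by exact: integrable_norm.
have mabs : measurable_fun setT (EFin \o (fun t => `|g0 t|)) := measurable_int _ iabs.
have IE (A : set (measurableTypeR R)) : measurable A ->
    (\int[leb1 R]_(t in A) `|g0 t|%:E)%E = (\int[leb1 R]_(t in A) `|g0 t|)%:E.
  move=> mA; rewrite /Rintegral fineK//; apply: integrable_fin_num => //.
  exact: integrable_subT.
have UE : \sum_(k < m) \int[leb1 R]_(t in [set` `]p k, q k[]) `|g0 t| = \int[leb1 R]_(t in U) `|g0 t|.
  apply: EFin_inj; rewrite -IE// -sumEFin.
  rewrite (@ge0_integral_bigsetU _ _ _ (leb1 R) _ (fun k => `]p k, q k[%classic)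
    (fun t => `|g0 t|%:E) (index_enum 'I_m) mI (index_enum_uniq _) (sub_trivIset (@subsetT _ _) dis)).
  - by apply: eq_bigr => k _; rewrite IE.
  - exact: (measurable_funS measurableT (@subsetT _ _) mabs).
  - by move=> x _; rewrite lee_fin.
apply: le_lt_trans (_ : \int[leb1 R]_(t in U) `|g0 t| < e).
  by rewrite -UE; apply: ler_sum => k _; apply: F_sub; have [_ []] := pq k.
apply: H => //.
apply: le_lt_trans (_ : (\sum_(k < m) (q k - p k))%:E < _)%E; last by rewrite lte_fin.
have -> : (\sum_(k < m) (q k - p k))%:E = (\sum_(k < m) leb1 R `]p k, q k[%classic)%E.
  rewrite -sumEFin; apply: eq_bigr => k _.
  by rewrite leb1_itv//; have [_ []] := pq k.
have IC (A : set (measurableTypeR R)) : measurable A ->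
    (\int[leb1 R]_(x in A) cst 1%E x = leb1 R A)%E.
  by move=> mA; rewrite integral_cst// mul1e.
have := @ge0_integral_bigsetU _ _ _ (leb1 R) _ (fun k => `]p k, q k[%classic)
  (cst 1%E) (index_enum 'I_m) mI (index_enum_uniq _) (sub_trivIset (@subsetT _ _) dis)
  (@measurable_cst _ _ _ _ _ _) (fun _ _ => lee01).
by rewrite IC// (eq_bigr _ (fun k _ => IC _ (mI k))) => <-.
Qed.

Let F_derive : {ae leb1 R, forall t, derivable F t 1 /\ derive1 F t = g0 t}.
Proof.
apply: FTC1Ny.
  by move=> y; apply: integrable_subT => //; exact: measurable_itv.
by apply: integrable_locally => //; exact: measurable_itv.
Qed.

(** The primitive of [g] is absolutely continuous with derivative [g] almost everywhere, so the
   difference of [f] and this primitive falls under the monotonicity criterion. *)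
Lemma abs_cont_le_integral (f : R -> R) : abs_cont 0 T f ->
  {ae leb1 R, forall t, 0 < t < T -> forall e : R, 0 < e -> exists2 d : R, 0 < d &
    forall s, 0 < s < d -> f (t + s) - f t <= s * (g t + e)} ->
  f T - f 0 <= \int[leb1 R]_(t in `]0, T[) g t.
Proof.
move=> acf fder.
have acfF : abs_cont 0 T (fun t => f t - F t).
  move=> e e0; have e2 : 0 < e / 2 by rewrite divr_gt0.
  have [d1 d10 H1] := acf _ e2; have [d2 d20 H2] := F_abs_cont e2.
  exists (Num.min d1 d2); first by rewrite lt_min d10.
  move=> m p q pq; rewrite lt_min => /andP[s1 s2].
  apply: le_lt_trans (_ : \sum_(k < m) (`|f (q k) - f (p k)| + `|F (q k) - F (p k)|) < e).
    apply: ler_sum => k _; apply: le_trans (ler_normB _ _).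
    by rewrite (_ : f (q k) - F (q k) - (f (p k) - F (p k)) = f (q k) - f (p k) - (F (q k) - F (p k))); [|ring].
  by rewrite big_split /= [ltRHS]splitr ltrD// ?H1 ?H2.
have [N [mN N0 subN]] : (leb1 R).-negligible
   (~` [set t | (0 < t < T -> forall e : R, 0 < e -> exists2 d : R, 0 < d &
    forall s, 0 < s < d -> f (t + s) - f t <= s * (g t + e)) /\
     (derivable F t 1 /\ derive1 F t = g0 t)]).
  apply: negligibleS (negligibleU fder F_derive) => t /= /not_andP[h|h]; [left|right]; exact: h.
have main : f T - F T <= f 0 - F 0.
  apply: (abs_cont_nonincreasing T0 acfF (E := N)); first by exists N; split.
  move=> t tT nN e e0.
  have [dinif [dF dFE]] := contrapT (fun h => nN (subN _ h)).
  have e2 : 0 < e / 2 by rewrite divr_gt0.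
  have [d1 d10 H1] := dinif tT _ e2.
  have hF : is_derive t 1 F (g t).
    apply: DeriveDef => //; rewrite -derive1E dFE /g0 patchE ifT// inE /= in_itv /=.
    exact: tT.
  have [d2 d20 H2] := is_derive_expansion hF e2.
  exists (Num.min d1 d2); first by rewrite lt_min d10.
  move=> s /andP[s0]; rewrite lt_min => /andP[s1 s2].
  have := H1 s; rewrite s0 s1 => /(_ isT) h1.
  have := H2 s; rewrite s0 s2 => /(_ isT); rewrite ler_norml => /andP[h2 _].
  move: h2; rewrite /GRing.scale /= => h2.
  move: h1 h2; move: (f _) (f _) (F _) (F _) (g t) => a b c c' gt h1 h2.
  lra.
have F0 : F 0 = 0.
  rewrite /F /Rintegral integral0_eq// => x; rewrite /= in_itv /= => x0.
  by rewrite /g0 patchE ifF//; apply/negP; rewrite inE /= in_itv /= => /andP[]; rewrite ltNge x0.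
have FT : F T = \int[leb1 R]_(t in `]0, T[) g t.
  have h (A : set R) : \int[leb1 R]_(t in A) g0 t = \int[leb1 R]_(t in A `&` `]0, T[%classic) g t.
    by rewrite Rintegral_mkcondr.
  rewrite /F h; congr (Rintegral _ _ _); apply/seteqP; split => x /=; rewrite !in_itv /=.
    by move=> [].
  by move=> /andP[x0 xT]; rewrite x0 xT (ltW xT).
by move: main; rewrite F0 FT; lra.
Qed.

End integral_comparison.

(** * Measurability of the Lipschitz norm in time *)

Section c01norm_measurability.
Context {R : realType}.
Variable (Om : region R).
Hypothesis hOm : admissible Om.
Implicit Types (u w : plane R -> plane R).

Let S1 u := ereal_sup [set (enorm (u x))%:E | x in carrier Om].
Let S2 u := ereal_sup [set (enorm (u p.1 - u p.2) / pdist Om p.1 p.2)%:E | p in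
     [set p | [/\ carrier Om p.1, carrier Om p.2 & p.1 <> p.2]]].

Let S1_ge0 u : (0 <= S1 u)%E.
Proof.
have [x [y [cx _ _]]] := carrier_two_points hOm.
apply: le_trans (_ : (enorm (u x))%:E <= _)%E; first by rewrite lee_fin enorm_ge0.
by apply: ereal_sup_ubound; exists x.
Qed.

Let S2_ge0 u : (0 <= S2 u)%E.
Proof.
have [x [y [cx cy xy]]] := carrier_two_points hOm.
apply: le_trans (_ : (enorm (u x - u y) / pdist Om x y)%:E <= _)%E.
  by rewrite lee_fin divr_ge0 ?enorm_ge0 ?pdist_ge0.
by apply: ereal_sup_ubound; exists (x, y).
Qed.

Lemma c01norm_ge0 u : (0 <= c01norm Om u)%E.
Proof. exact: adde_ge0 (S1_ge0 u) (S2_ge0 u). Qed.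

(** Stated for pointwise domination, so as to apply to differences of fields as well. *)
Lemma c01norm_triangle u w z : (forall x, enorm (u x) <= enorm (w x) + enorm (z x)) ->
  (forall x y, enorm (u x - u y) <= enorm (w x - w y) + enorm (z x - z y)) ->
  (c01norm Om u <= c01norm Om w + c01norm Om z)%E.
Proof.
move=> h1 h2; rewrite /c01norm -!/(S1 _) -!/(S2 _) addeACA; apply: leeD.
  apply: ge_ereal_sup => _ [x cx <-].
  apply: le_trans (_ : (enorm (w x))%:E + (enorm (z x))%:E <= _)%E; first by rewrite -EFinD lee_fin.
  by apply: leeD; apply: ereal_sup_ubound; exists x.
apply: ge_ereal_sup => _ [[x y] [cx cy xy] <-] /=.
apply: le_trans (_ : (enorm (w x - w y) / pdist Om x y)%:E + (enorm (z x - z y) / pdist Om x y)%:E <= _)%E.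
  rewrite -EFinD lee_fin -mulrDl ler_wpM2r// invr_ge0 pdist_ge0//.
by apply: leeD; apply: ereal_sup_ubound; exists (x, y).
Qed.

Lemma c01norm_cvg (u : nat -> plane R -> plane R) w : (c01norm Om w < +oo)%E ->
  c01norm Om (fun x => w x - u n x) @[n --> \oo] --> 0%E ->
  c01norm Om (u n) @[n --> \oo] --> c01norm Om w.
Proof.
move=> wfin H.
have wnum : c01norm Om w \is a fin_num by rewrite ge0_fin_numE// c01norm_ge0.
pose eps n := c01norm Om (fun x => w x - u n x).
apply: (@squeeze_cvge _ _ _ _ (fun n => c01norm Om w - eps n)%E _
  (fun n => c01norm Om w + eps n)%E).
- near=> n; rewrite /eps; apply/andP; split.
    have := @c01norm_triangle w (u n) (fun x => w x - u n x) _ _.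
    have e0 := c01norm_ge0 (fun x => w x - u n x).
    move: e0; case: (c01norm Om (fun x => w x - u n x)) => [r||//] r0 tri.
      rewrite leeBlDr//; apply: tri => [x|x y].
        by apply: le_trans (_ : enorm (u n x + (w x - u n x)) <= _); [rewrite addrC subrK|exact: enormD].
      apply: le_trans (_ : enorm ((u n x - u n y) + (w x - u n x - (w y - u n y))) <= _); last exact: enormD.
      by rewrite le_eqVlt; apply/orP; left; apply/eqP; congr enorm; apply: plane_ext => /=; ring.
    by rewrite addeNy// leNye.
  apply: c01norm_triangle => [x|x y].
    apply: le_trans (_ : enorm (w x + (u n x - w x)) <= _); first by rewrite addrC subrK.
    by rewrite [X in _ <= _ + X]enormC; exact: enormD.
  rewrite [X in _ <= _ + X]enormC.
  apply: le_trans (_ : enorm ((w x - w y) + (w y - u n y - (w x - u n x))) <= _); last exact: enormD.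
  by rewrite le_eqVlt; apply/orP; left; apply/eqP; congr enorm; apply: plane_ext => /=; ring.
- rewrite -[X in _ --> X]sube0; apply: cvgeB => //; last exact: cvg_cst.
  by rewrite oppe0 fin_num_adde_defl.
- rewrite -[X in _ --> X]adde0; apply: cvgeD => //; last exact: cvg_cst.
  by rewrite fin_num_adde_defl.
Unshelve. all: by end_near. Qed.

(** As a function of time this takes one value on each atom of the algebra generated by the
   [E k], whatever the functional [Phi]; the offset [w] carries the induction on [m]. *)
Lemma measurable_step_function (Phi : (plane R -> plane R) -> \bar R) (m : nat)
    (E : 'I_m -> set (measurableTypeR R)) (u : 'I_m -> plane R -> plane R) w :
  (forall k, measurable (E k)) ->
  measurable_fun setT (fun t : measurableTypeR R =>
    Phi (fun x => w x + \sum_(k < m) (\1_(E k) t : R) *: u k x)).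
Proof.
elim: m E u w => [|m IH] E u w mE.
  rewrite (_ : (fun t => _) = cst (Phi w)); first exact: measurable_cst.
  by apply/funext => t; congr Phi; apply/funext => x; rewrite big_ord0 addr0.
have IH1 := IH (fun k => E (lift ord0 k)) (fun k => u (lift ord0 k)) (fun x => w x + u ord0 x)
  (fun k => mE (lift ord0 k)).
have IH0 := IH (fun k => E (lift ord0 k)) (fun k => u (lift ord0 k)) w
  (fun k => mE (lift ord0 k)).
move=> mT Y mY; rewrite setTI.
have mE0 := mE ord0.
have A1 := IH1 mT Y mY; have A0 := IH0 mT Y mY.
rewrite setTI in A1; rewrite setTI in A0.
have -> : (fun t : measurableTypeR R =>
    Phi (fun x => w x + \sum_(k < m.+1) (\1_(E k) t : R) *: u k x)) @^-1` Y =
   (E ord0 `&` ((fun t : measurableTypeR R =>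
    Phi (fun x => w x + u ord0 x + \sum_(k < m) (\1_(E (lift ord0 k)) t : R) *: u (lift ord0 k) x)) @^-1` Y)) `|`
   (~` E ord0 `&` ((fun t : measurableTypeR R =>
    Phi (fun x => w x + \sum_(k < m) (\1_(E (lift ord0 k)) t : R) *: u (lift ord0 k) x)) @^-1` Y)).
  have P1 t : E ord0 t -> (fun x => w x + \sum_(k < m.+1) (\1_(E k) t : R) *: u k x) =
      (fun x => w x + u ord0 x + \sum_(k < m) (\1_(E (lift ord0 k)) t : R) *: u (lift ord0 k) x).
    by move=> Et; apply/funext => x; rewrite big_ord_recl addrA indicE mem_set// scale1r.
  have P0 t : ~ E ord0 t -> (fun x => w x + \sum_(k < m.+1) (\1_(E k) t : R) *: u k x) =
      (fun x => w x + \sum_(k < m) (\1_(E (lift ord0 k)) t : R) *: u (lift ord0 k) x).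
    by move=> Et; apply/funext => x; rewrite big_ord_recl indicE memNset// scale0r add0r.
  apply/seteqP; split => t /=.
    have [Et|Et] := pselect (E ord0 t); first by rewrite (P1 _ Et); left.
    by rewrite (P0 _ Et); right.
  by case=> -[Et]; rewrite ?(P1 _ Et) ?(P0 _ Et).
by apply: measurableU; apply: measurableI => //; exact: measurableC.
Qed.

(** The norm of a Bochner function is, almost everywhere, the limit of the norms
   of simple functions. *)
Lemma c01norm_ae_measurable (T : R) (v : R -> plane R -> plane R) : L1_C01 Om T v ->
  exists L : R -> \bar R, [/\ measurable_fun setT (L : measurableTypeR R -> \bar R),
    (forall t, 0 <= L t)%E &
    {ae leb1 R, forall t, 0 < t < T -> C01 Om (v t) /\ c01norm Om (v t) = L t}].
Proof.
move=> [[s [simple_s cv]] _].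
exists (fun t => limn_esup (fun n => c01norm Om (s n t))); split.
- apply: measurable_fun_limn_esup => n.
  have [m [E [u [mE _ sE]]]] := simple_s n.
  have := @measurable_step_function (c01norm Om) m E u (fun=> 0) mE.
  congr (measurable_fun _ _); apply/funext => t; congr (c01norm Om); apply/funext => x.
  by rewrite sE add0r.
- move=> t; rewrite limn_esup_lim; apply: lime_ge; first exact: is_cvg_esups.
  near=> n; apply: le_trans (_ : c01norm Om (s n t) <= _)%E; first exact: c01norm_ge0.
  by apply: ereal_sup_ubound; exists n => /=.
- move: cv; apply: filterS; first exact: (ae_filter_ringOfSetsType (leb1 R)).
  move=> t H tT; have [Cv cvt] := H tT; split => //.
  have cs := c01norm_cvg Cv.2 cvt.
  rewrite is_cvg_limn_esupE; last by apply/cvg_ex; exists (c01norm Om (v t)).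
  by apply/esym/cvg_lim.
Unshelve. all: by end_near. Qed.

End c01norm_measurability.

(** * Integrals of functions of unknown measurability *)

Section lower_integrals.
Import HBNNSimple.
Context {R : realType}.
Implicit Types (D : set (measurableTypeR R)).

Lemma integrable_bounded_itv (T : R) (f : R -> R) (B : R) :
  measurable_fun setT (f : measurableTypeR R -> measurableTypeR R) ->
  (forall t, `|f t| <= B) ->
  (leb1 R).-integrable (`]0, T[%classic : set (measurableTypeR R)) (EFin \o f).
Proof.
move=> mf fB; apply: measurable_bounded_integrable.
- exact: measurable_itv.
- have [T0|T0] := leP T 0.
    by rewrite set_itv_ge ?bnd_simp -?leNgt// measure0.
  by rewrite leb1_itv ?ltry// ltW.
- exact: (measurable_funS measurableT (@subsetT _ _) mf).
- exists B; split; first exact: num_real.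
  by move=> M BM t _; apply: le_trans (fB t) (ltW BM).
Qed.

(** The integral of an arbitrary function is a supremum over the simple
   functions below its positive part, so it is bounded as soon as the integrals of
   its measurable minorants are. *)
Lemma integral_le_minorants (T : R) (f : R -> R) (Z : R) :
  (forall (s : R -> R) (B : R), measurable_fun setT (s : measurableTypeR R -> measurableTypeR R) ->
    (forall t, 0 <= s t <= B) -> (forall t, 0 < t < T -> s t <= Num.max (f t) 0) ->
    \int[leb1 R]_(t in `]0, T[) s t <= Z) ->
  (\int[leb1 R]_(t in `]0%R, T[) (f t)%:E <= Z%:E)%E.
Proof.
move=> H; rewrite integralE.
have neg : (0 <= \int[leb1 R]_(t in `]0%R, T[) (fun t => (f t)%:E)^\- t)%E.
  by apply: integral_ge0 => t _; exact: funeneg_ge0.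
have pos : (\int[leb1 R]_(t in `]0%R, T[) (fun t => (f t)%:E)^\+ t <= Z%:E)%E.
  rewrite ge0_integralE; last by move=> t _; exact: funepos_ge0.
  apply: ge_ereal_sup => _ [h hle <-].
  have mh : measurable_fun setT (h : measurableTypeR R -> measurableTypeR R).
    exact: (@measurable_funP _ _ _ _ setT h).
  have h0 t : 0 <= h t by exact: fun_ge0.
  have [B hB] : exists B, forall t, h t <= B.
    have [B [_ hB]] := @simple_bounded _ _ _ h.
    exists (B + 1) => t; have := hB (B + 1); rewrite ltrDl ltr01 => /(_ isT t Logic.I) /=.
    by apply: le_trans; exact: ler_norm.
  have hout t : ~ (0 < t < T) -> h t = 0.
    move=> nt; apply/eqP; rewrite eq_le h0 andbT -lee_fin; apply: le_trans (hle t) _.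
    by rewrite patchE ifF//; apply/negP; rewrite inE /= in_itv /=.
  have hin t : 0 < t < T -> h t <= Num.max (f t) 0.
    move=> tT; rewrite -lee_fin; apply: le_trans (hle t) _.
    by rewrite patchE ifT ?inE /= ?in_itv//= funeposE EFin_max.
  have HB := H h B mh (fun t => introT andP (conj (h0 t) (hB t))) hin.
  rewrite -integralT_nnsfun.
  have -> : (\int[leb1 R]_x (h x)%:E = \int[leb1 R]_(x in `]0%R, T[) (h x)%:E)%E.
    rewrite [RHS]integral_mkcond; apply: eq_integral => t _.
    rewrite patchE; case: ifPn => //; rewrite notin_setE /= in_itv /= => nt.
    by rewrite hout.
  rewrite -(@fineK _ (\int[leb1 R]_(x in `]0%R, T[) (h x)%:E)%E); first by rewrite lee_fin.
  apply: integrable_fin_num; first exact: measurable_itv.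
  apply: (@integrable_bounded_itv _ _ B) => // t.
  by rewrite ger0_norm.
apply: le_trans pos; move: neg.
case: (\int[leb1 R]_(t in `]0%R, T[) (fun t => (f t)%:E)^\- t)%E => [r||]//.
- by rewrite lee_fin => r0; rewrite leeBlDr// leeDl// lee_fin.
- by move=> _; rewrite /= addeNy ?leNye.
Qed.

(** The integral of a nonnegative function, measurable or not, is the supremum of the
   integrals of the simple functions below it. *)
Lemma ge0_integral_monotone (D : set (measurableTypeR R)) (f g : R -> \bar R) :
  (forall t, D t -> 0 <= f t)%E -> (forall t, D t -> f t <= g t)%E ->
  (\int[leb1 R]_(t in D) f t <= \int[leb1 R]_(t in D) g t)%E.
Proof.
move=> f0 fg; have g0 t : D t -> (0 <= g t)%E by move=> Dt; exact: le_trans (f0 t Dt) (fg t Dt).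
rewrite ge0_integralE// ge0_integralE//; apply: le_ereal_sup => _ [h hle <-].
exists h => // t; apply: le_trans (hle t) _; rewrite !patchE.
by case: ifPn => //; rewrite inE; exact: fg.
Qed.

Lemma ge0_integral_ae_le (T : R) (f g : R -> \bar R) :
  measurable_fun setT (f : measurableTypeR R -> \bar R) ->
  (forall t, 0 <= f t)%E -> (forall t, 0 <= g t)%E ->
  {ae leb1 R, forall t, 0 < t < T -> (f t <= g t)%E} ->
  (\int[leb1 R]_(t in `]0%R, T[) f t <= \int[leb1 R]_(t in `]0%R, T[) g t)%E.
Proof.
move=> mf f0 g0 [N [mN N0 subN]].
have mI : measurable (`]0, T[%classic : set (measurableTypeR R)) by exact: measurable_itv.
rewrite (ge0_negligible_integral mN mI)//; last first.
  exact: (measurable_funS measurableT (@subsetT _ _) mf).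
rewrite integral_mkcond [leRHS]integral_mkcond; apply: ge0_integral_monotone => t _.
  by rewrite patchE; case: ifP.
rewrite !patchE; case: ifPn => [|_]; last by case: ifP.
rewrite inE => -[It Nt]; rewrite ifT ?inE//.
by apply: (contrapT (fun h => Nt (subN t h))); move: It; rewrite /= in_itv.
Qed.

End lower_integrals.

(** * Dissipation of the energy *)

Section dini_arithmetic.
Context {R : realType}.

Lemma small_increment (a d W e : R) : 0 <= a -> 0 <= d -> 0 <= W -> 0 < e ->
  exists2 eps : R, 0 < eps <= 1 & exists2 s0 : R, 0 < s0 & forall s, 0 < s < s0 ->
    a * (4 * d * eps + s * (W + 2) ^+ 2) <= e.
Proof.
move=> a0 d0 W0 e0.
pose K := a * (4 * d) + 1; pose L := a * (W + 2) ^+ 2 + 1.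
have K0 : 0 < K by rewrite ltr_wpDl// !mulr_ge0.
have L0 : 0 < L by rewrite ltr_wpDl// mulr_ge0// sqr_ge0.
exists (Num.min 1 (e / 2 / K)); first by rewrite lt_min ltr01 !divr_gt0//= ge_min lexx.
exists (e / 2 / L); first by rewrite !divr_gt0.
move=> s /andP[s0 sL].
have A : a * (4 * d) * Num.min 1 (e / 2 / K) <= e / 2.
  apply: le_trans (_ : a * (4 * d) * (e / 2 / K) <= _).
    by rewrite ler_wpM2l ?mulr_ge0// ge_min lexx orbT.
  rewrite mulrC mulrAC ler_pdivrMr// ler_pM2l ?divr_gt0//.
  by rewrite /K lerDl.
have B : a * (W + 2) ^+ 2 * s <= e / 2.
  apply: le_trans (_ : a * (W + 2) ^+ 2 * (e / 2 / L) <= _).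
    by apply: ler_wpM2l; [apply: mulr_ge0 => //; exact: sqr_ge0|exact: ltW].
  rewrite mulrC mulrAC ler_pdivrMr// ler_pM2l ?divr_gt0//.
  by rewrite /L lerDl.
have -> : a * (4 * d * Num.min 1 (e / 2 / K) + s * (W + 2) ^+ 2) =
  a * (4 * d) * Num.min 1 (e / 2 / K) + a * (W + 2) ^+ 2 * s by ring.
by rewrite [leRHS]splitr lerD.
Qed.

Lemma common_radius (N : nat) (P : 'I_N -> R -> Prop) :
  (forall i (r s : R), r <= s -> P i s -> P i r) ->
  (forall i, exists2 r : R, 0 < r & P i r) -> exists2 r : R, 0 < r & forall i, P i r.
Proof.
move=> mono ex.
have /choice[f Hf] : forall i, exists r : R, 0 < r /\ P i r by move=> i; have [r] := ex i; exists r.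
exists (\big[Num.min/1]_(i < N) f i).
  by apply: lt_bigmin => // i _; have [] := Hf i.
by move=> i; apply: (mono i _ (f i)); [exact: bigmin_le_cond|have [] := Hf i].
Qed.

End dini_arithmetic.

Section dissipation.
Context {R : realType}.
Variable (Om : region R).
Hypothesis hOm : admissible Om.
Implicit Types (x y z a b : plane R).

Lemma energy_abs_cont (N : nat) (T : R) (X : R -> config R N) : (0 < N)%N ->
  (forall t, 0 <= t <= T -> configs Om N (X t)) ->
  (forall i, abs_continuous 0 T (fun t => X t i)) ->
  abs_cont 0 T (fun t => energy Om (X t)).
Proof.
move=> N0 cX ac e e0; have [C C0 lip] := energy_lipschitz hOm.
have K0 : 0 < C * N%:R + 1 by rewrite ltr_wpDl// mulr_ge0.
have e1 : 0 < e / (C * N%:R + 1) by rewrite divr_gt0.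
have [d d0 Hd] : exists2 d : R, 0 < d & forall i : 'I_N, forall (m : nat) (p q : 'I_m -> R),
    intervals_in 0 T p q -> \sum_(k < m) (q k - p k) < d ->
    \sum_(k < m) enorm (X (q k) i - X (p k) i) < e / (C * N%:R + 1).
  apply: common_radius.
    by move=> i r s rs H m p q pq small; apply: H => //; exact: lt_le_trans rs.
  move=> i; have [d d0 H] := ac i _ e1; exists d => // m p q [pq dis]; exact: H.
exists d => // m p q pq small.
apply: le_lt_trans (_ : \sum_(k < m) C * \sum_(i < N) enorm (X (q k) i - X (p k) i) < _).
  apply: ler_sum => k _; have [/(_ k)[p0 [pqk qT]] _] := pq.
  apply: lip => //; apply: cX; rewrite ?p0 ?qT.
    by rewrite andbT (le_trans p0).
  by rewrite (le_trans pqk).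
rewrite -mulr_sumr exchange_big /=.
apply: le_lt_trans (_ : C * \sum_(i < N) e / (C * N%:R + 1) < _).
  by rewrite ler_wpM2l//; apply: ler_sum => i _; apply/ltW/Hd.
rewrite sumr_const card_ord -[_ *+ N]mulr_natr.
rewrite (_ : C * _ = C * N%:R / (C * N%:R + 1) * e); last by ring.
by rewrite gtr_pMl// ltr_pdivrMr// mul1r ltrDl.
Qed.

(** The chain rule, as an upper bound: it is the semiconcavity inequality for the
   configurations at times [t] and [t + s], with the increment expanded to first
   order. *)
Lemma energy_dini (N : nat) (X : R -> config R N) (t d : R) (w : 'I_N -> plane R) (T : R) :
  (0 < N)%N -> 0 < t < T ->
  (forall t, 0 <= t <= T -> configs Om N (X t) /\ distinct Om (X t)) ->
  max_diam Om (X t) <= d -> (forall i, volume Om (X t) i != 0) ->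
  (forall i, is_derive t 1 (fun s => X s i) (w i)) ->
  forall e : R, 0 < e -> exists2 r : R, 0 < r & forall s, 0 < s < r ->
    energy Om (X (t + s)) - energy Om (X t) <=
    s * (- (2 * \sum_(i < N) volume Om (X t) i * dot (displacement Om (X t) i) (w i)) + e).
Proof.
move=> N0 /andP[t0 tT] cdX hd V0 dX e e0.
have tin : 0 <= t <= T by rewrite !ltW.
have [cXt dXt] := cdX t tin.
have d0 : 0 <= d by exact: (radius_ge0 hOm cXt dXt hd).
set ar := area Om (carrier Om).
have ar0 : 0 <= ar by exact: fine_ge0.
pose W := \sum_(i < N) enorm (w i).
have W0 : 0 <= W by apply: sumr_ge0 => i _; exact: enorm_ge0.
have [eps /andP[eps0 eps1] [s0 s00 Hs0]] := small_increment ar0 d0 W0 e0.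
have [r1 r10 Hr1] : exists2 r : R, 0 < r & forall i : 'I_N, forall s, 0 < s < r ->
    `|X (t + s) i - X t i - s *: w i| <= eps * s.
  apply: common_radius; last by move=> i; exact: is_derive_expansion.
  move=> i r s rs H u /andP[u0 ur]; apply: H; rewrite u0; exact: lt_le_trans rs.
exists (Num.min (Num.min s0 r1) (T - t)).
  by rewrite !lt_min s00 r10 subr_gt0.
move=> s /andP[sp]; rewrite !lt_min => /andP[/andP[ss0 sr1] sT].
have tsin : 0 <= t + s <= T.
  by rewrite addr_ge0 ?(ltW t0) ?(ltW sp)//= -lerBrDl ltW.
have [cXs _] := cdX _ tsin.
have pert := energy_perturbation hOm N0 cXt cXs dXt V0.
rewrite lerBlDl; apply: le_trans pert _; rewrite lerD2l.
set S := \sum_(i < N) volume Om (X t) i * dot (displacement Om (X t) i) (w i).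
have term i : volume Om (X t) i * (enorm (X (t + s) i - X t i) ^+ 2 -
     2 * dot (displacement Om (X t) i) (X (t + s) i - X t i)) <=
   s * (- (2 * (volume Om (X t) i * dot (displacement Om (X t) i) (w i)))) +
   volume Om (X t) i * (s * (4 * d * eps + s * (W + 2) ^+ 2)).
  set D := displacement Om (X t) i; set dl := X (t + s) i - X t i; set V := volume Om (X t) i.
  have Vp : 0 <= V by exact: volume_ge0.
  have Dd : enorm D <= d by exact: (displacement_le hOm N0 cXt dXt hd (V0 i)).
  pose rm := dl - s *: w i.
  have rm_le : enorm rm <= 2 * (eps * s).
    have := Hr1 i s; rewrite sp sr1 => /(_ isT); rewrite -/dl -/rm prod_normE ge_max => /andP[h1 h2].
    apply: le_trans (enorm_le_sum _) _; move: h1 h2; rewrite mulrDl mul1r; exact: lerD.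
  have dlE : dl = s *: w i + rm by rewrite /rm addrC subrK.
  have wW : enorm (w i) <= W by rewrite /W (bigD1 i)//= lerDl; apply: sumr_ge0 => j _; exact: enorm_ge0.
  have dl_le : enorm dl <= s * (W + 2).
    rewrite dlE; apply: le_trans (enormD _ _) _; rewrite enormZ (gtr0_norm sp) mulrDr.
    apply: lerD; first by rewrite ler_pM2l.
    apply: le_trans rm_le _; rewrite [leRHS]mulrC ler_pM2l//.
    by rewrite mulrC ler_piMr// ltW.
  have sq : enorm dl ^+ 2 <= (s * (W + 2)) ^+ 2.
    by rewrite ler_sqr ?nnegrE ?enorm_ge0// (le_trans (enorm_ge0 _) dl_le).
  have dr : - (2 * dot D rm) <= 4 * d * (eps * s).
    have := norm_dot D rm; rewrite ler_norml => /andP[h1 _].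
    have h2 : enorm D * enorm rm <= d * (2 * (eps * s)).
      by apply: ler_pM; rewrite ?enorm_ge0.
    move: h1 h2; move: (dot D rm) (enorm D * enorm rm) => A B h1 h2; lra.
  have -> : dot D dl = s * dot D (w i) + dot D rm by rewrite dlE dotDr dotZr.
  have -> : s * (- (2 * (V * dot D (w i)))) + V * (s * (4 * d * eps + s * (W + 2) ^+ 2)) =
    V * (- (2 * (s * dot D (w i))) + 4 * d * (eps * s) + (s * (W + 2)) ^+ 2) by ring.
  rewrite ler_wpM2l//.
  move: sq dr; move: (enorm dl ^+ 2) (dot D rm) (dot D (w i)) => A B C' h1 h2.
  lra.
apply: le_trans (ler_sum _ (fun i _ => term i)) _.
rewrite big_split /= -mulr_sumr -mulr_suml (sum_volume hOm N0 dXt) -/ar.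
have -> : \sum_(i < N) - (2 * (volume Om (X t) i * dot (displacement Om (X t) i) (w i))) = - (2 * S).
  by rewrite sumrN -mulr_sumr.
rewrite [leRHS]mulrDr lerD2l mulrCA ler_pM2l//.
by apply: Hs0; rewrite sp ss0.
Qed.

(** Along the flow the energy can only grow through the transport term, which is
   controlled by the velocity norm; what the relaxation dissipates is therefore
   bounded by the initial energy and the total transport. The dissipation enters
   through its measurable minorants [k], whose integrals determine its own. *)
Lemma dissipation_bound : exists2 C : R, 0 < C &
  forall (N : nat) (T d : R) (v : R -> plane R -> plane R) (alpha : R -> R) (X0 : config R N)
    (X : R -> config R N) (k : R -> R) (B : R),
  (0 < N)%N -> 0 < T -> L1_C01 Om T v ->
  {ae leb1 R, forall t, 0 < t < T -> 0 <= alpha t} ->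
  solution Om T v alpha X0 X ->
  (forall t, 0 <= t <= T -> max_diam Om (X t) <= d) ->
  (forall t, 0 <= t <= T -> forall i, volume Om (X t) i != 0) ->
  measurable_fun setT (k : measurableTypeR R -> measurableTypeR R) ->
  (forall t, 0 <= k t <= B) ->
  {ae leb1 R, forall t, 0 < t < T -> k t <= alpha t * gap Om (X t)} ->
  \int[leb1 R]_(t in `]0, T[) k t <= C * d ^+ 2 * (1 + Lam Om v T).
Proof.
have [C C0 tb] := transport_bound hOm.
set ar := area Om (carrier Om).
have ar0 : 0 <= ar by exact: fine_ge0.
exists (C + ar); first by rewrite ltr_wpDr.
move=> N T d v alpha X0 X k B N0 T0 Lv al0 [X00 cdX acX dX] hd V0 mk kB kle.
have [L [mL L0 LE]] := c01norm_ae_measurable hOm Lv.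
have mI : measurable (`]0, T[%classic : set (measurableTypeR R)) by exact: measurable_itv.
have c0 t : (0 <= c01norm Om (v t))%E by exact: c01norm_ge0.
have zin : 0 <= (0 : R) <= T by rewrite lexx ltW.
have Tin : 0 <= T <= T by rewrite lexx ltW.
have d0 : 0 <= d.
  by have [c1 c2] := cdX _ zin; exact: (radius_ge0 hOm c1 c2 (hd _ zin)).
have intLc : (\int[leb1 R]_(t in `]0%R, T[) L t <= \int[leb1 R]_(t in `]0%R, T[) c01norm Om (v t))%E.
  apply: ge0_integral_ae_le => //; move: LE; apply: filterS.
    exact: (ae_filter_ringOfSetsType (leb1 R)).
  by move=> t H tT; have [_ ->] := H tT.
have finc : (\int[leb1 R]_(t in `]0%R, T[) c01norm Om (v t) < +oo)%E by case: Lv.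
have numc : (\int[leb1 R]_(t in `]0%R, T[) c01norm Om (v t))%E \is a fin_num.
  by rewrite ge0_fin_numE//; apply: integral_ge0.
have numL : (\int[leb1 R]_(t in `]0%R, T[) L t)%E \is a fin_num.
  by rewrite ge0_fin_numE; [exact: le_lt_trans intLc finc|exact: integral_ge0].
pose l t := fine (L t).
have ml : measurable_fun setT (l : measurableTypeR R -> measurableTypeR R).
  exact: measurableT_comp mL.
have l0 t : 0 <= l t by exact: fine_ge0.
have intl : ((\int[leb1 R]_(t in `]0%R, T[) (l t)%:E) <= \int[leb1 R]_(t in `]0%R, T[) L t)%E.
  apply: ge0_integral_monotone => t _; first by rewrite lee_fin.
  by rewrite /l; have := L0 t; case: (L t) => [r _|_|//]; [exact: lexx|exact: leey].
have il : (leb1 R).-integrable (`]0, T[%classic : set (measurableTypeR R)) (EFin \o l).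
  apply/integrableP; split.
    apply/measurable_EFinP; exact: (measurable_funS measurableT (@subsetT _ _) ml).
  under eq_integral => t _ do rewrite /= ger0_norm//.
  by apply: le_lt_trans intl _; rewrite -ge0_fin_numE//; exact: integral_ge0.
have ik : (leb1 R).-integrable (`]0, T[%classic : set (measurableTypeR R)) (EFin \o k).
  apply: (@integrable_bounded_itv _ _ _ B) => // t.
  by have /andP[k0 kb] := kB t; rewrite ger0_norm.
pose g t := C * d ^+ 2 * l t - 2 * k t.
have i1 := integrableZl mI (C * d ^+ 2) il.
have i2 := integrableZl mI 2 ik.
have ig : (leb1 R).-integrable (`]0, T[%classic : set (measurableTypeR R)) (EFin \o g).
  exact: (integrableB mI i1 i2).
have lLam : \int[leb1 R]_(t in `]0, T[) l t <= Lam Om v T.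
  have numl : (\int[leb1 R]_(t in `]0%R, T[) (l t)%:E)%E \is a fin_num.
    rewrite ge0_fin_numE; last by apply: integral_ge0 => t _; rewrite lee_fin.
    by apply: le_lt_trans intl _; rewrite -ge0_fin_numE//; exact: integral_ge0.
  by rewrite /Lam /Rintegral fine_le//; exact: le_trans intl intLc.
have key : energy Om (X T) - energy Om (X 0) <= \int[leb1 R]_(t in `]0, T[) g t.
  apply: (abs_cont_le_integral T0 ig (f := fun t => energy Om (X t))).
    by apply: energy_abs_cont => // t /cdX[].
  have := negligibleU (negligibleU LE al0) (negligibleU dX kle).
  apply: negligibleS => t /= nt.
  apply: contrapT => /not_orP[/not_orP[/contrapT h1 /contrapT h2] /not_orP[/contrapT h3 /contrapT h4]].
  apply: nt => tT e e0.
  have [[vper vfin] vL] := h1 tT; have a0 := h2 tT; have der := h3 tT; have kg := h4 tT.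
  have tin : 0 <= t <= T by case/andP: tT => *; rewrite !ltW.
  have [cXt dXt] := cdX t tin.
  have [r r0 Hr] := energy_dini N0 tT cdX (hd t tin) (V0 t tin) der e0.
  exists r => // s hs; apply: le_trans (Hr s hs) _.
  have sp : 0 < s by case/andP: hs.
  rewrite ler_pM2l// lerD2r.
  have [vM vLip] := enorm_fin_c01norm hOm (conj vper vfin).
  have M0 : 0 <= fine (c01norm Om (v t)) by exact: fine_ge0.
  have := tb N (X t) d _ (v t) N0 cXt dXt (hd t tin) (V0 t tin) vper M0 vM vLip.
  rewrite vL -/(l t) => tbt.
  have -> : \sum_(i < N) volume Om (X t) i * dot (displacement Om (X t) i)
      (v t (X t i) + alpha t *: displacement Om (X t) i) =
    \sum_(i < N) volume Om (X t) i * dot (displacement Om (X t) i) (v t (X t i)) +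
      alpha t * gap Om (X t).
    rewrite /gap mulr_sumr -big_split /=; apply: eq_bigr => i _.
    by rewrite dotDr dotZr dotxx; ring.
  rewrite /g; move: tbt kg; move: (\sum_(i < N) _) (alpha t * _) (l t) (k t) => A G lt kt tbt kg.
  by rewrite mulrDr opprD; lra.
move: key; rewrite /g RintegralB// !RintegralZl//.
have [c0X d0X] := cdX _ zin; have [cTX dTX] := cdX _ Tin.
have E0 := energy_le hOm N0 c0X d0X (hd _ zin).
have ET : 0 <= energy Om (X T) by exact: energy_ge0.
have Lam0 : 0 <= Lam Om v T by apply: fine_ge0; exact: integral_ge0.
have h := ler_wpM2l (_ : 0 <= C * d ^+ 2) lLam.
move: h E0 ET; rewrite -/ar.
move: (energy _ _) (energy _ _) (\int[leb1 R]_(t in _) l t) (\int[leb1 R]_(t in _) k t) (Lam _ _ _) Lam0.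
move=> eT e0' il' ik' La La0 h E0 ET key.
have {}h := h (mulr_ge0 (ltW C0) (sqr_ge0 d)).
have q := mulr_ge0 (mulr_ge0 ar0 (sqr_ge0 d)) La0.
have q' := mulr_ge0 (mulr_ge0 (ltW C0) (sqr_ge0 d)) La0.
have q2 := mulr_ge0 (ltW C0) (sqr_ge0 d).
have q3 := mulr_ge0 ar0 (sqr_ge0 d).
lra.
Qed.

End dissipation.

(** * Masses weighted by displacements *)

Section power_splitting.
Context {R : realType}.

(** A replacement for Young's inequality in which the second factor is known to
   be small: when [r] is not dominated by [m * D], the bound on [D] turns the
   product into a power of [r]. *)
Lemma power_split (r D l m th d : R) : 0 <= r -> 0 <= D -> D <= d -> 0 < l -> 0 < m ->
  0 < th -> th <= 1 -> d `^ (1 - th) <= l * m `^ th ->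
  r * D <= l * r `^ (1 + th) + m * D ^+ 2.
Proof.
move=> r0 D0 Dd l0 m0 th0 th1 H.
have d0 : 0 <= d by exact: le_trans D0 Dd.
have [D00|Dn0] := eqVneq D 0.
  rewrite D00 mulr0 expr0n /= mulr0 addr0.
  by apply: mulr_ge0; [exact: ltW|exact: powR_ge0].
have Dp : 0 < D by rewrite lt_neqAle eq_sym Dn0.
have [rm|mr] := leP r (m * D).
  apply: le_trans (_ : m * D ^+ 2 <= _).
    by rewrite expr2 mulrA ler_wpM2r.
  by rewrite lerDr; apply: mulr_ge0; [exact: ltW|exact: powR_ge0].
have rp : 0 < r by apply: le_lt_trans mr; rewrite mulr_ge0// ltW.
apply: le_trans (_ : l * r `^ (1 + th) <= _); last first.
  by rewrite lerDl; apply: mulr_ge0; [exact: ltW|exact: sqr_ge0].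
rewrite powRD; last by apply/implyP => _; rewrite gt_eqF.
rewrite powRr1// mulrCA ler_pM2l//.
have -> : D = D `^ (1 - th) * D `^ th.
  by rewrite -powRD ?subrK ?powRr1//; apply/implyP => _; rewrite gt_eqF.
apply: le_trans (_ : l * m `^ th * D `^ th <= _).
  apply: ler_wpM2r; first exact: powR_ge0.
  apply: le_trans H; apply: ge0_ler_powR; rewrite ?nnegrE//.
  by rewrite subr_ge0.
have mD0 : 0 <= m * D := mulr_ge0 (ltW m0) D0.
rewrite -mulrA ler_pM2l// -(powRM _ (ltW m0) D0).
by apply: ge0_ler_powR; rewrite ?nnegrE ?(ltW th0) ?(ltW rp) ?(ltW mr).
Qed.

Lemma powR_le_1D (r s p : R) : 0 <= r -> 0 < s -> s <= p -> r `^ s <= 1 + r `^ p.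
Proof.
move=> r0 s0 sp; have [r1|/ltW r1] := leP r 1.
  apply: le_trans (_ : 1 <= _); last by rewrite lerDl powR_ge0.
  have <- : 1 `^ s = 1 :> R by rewrite powR1.
  by apply: ge0_ler_powR; rewrite ?nnegrE ?(ltW s0).
by apply: le_trans (ler_powR r1 sp) _; rewrite lerDr.
Qed.

End power_splitting.

Section mass_bounds.
Context {R : realType}.
Variable (Om : region R).
Hypothesis hOm : admissible Om.

(** A bound on the integral of the power [min p 2] of a function of norm [K] that covers the
   three cases [p <= 2], [2 < p] finite (by [s ^ 2 <= 1 + s ^ p]) and [p] infinite. *)
Definition power_bound (p : \bar R) (K : R) : R :=
  area Om (carrier Om) + K `^ (fine p) + K ^+ 2 * area Om (carrier Om).

Let ar0 : 0 <= area Om (carrier Om).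
Proof. exact: fine_ge0. Qed.

Lemma power_bound_ge0 p K : 0 <= power_bound p K.
Proof. by rewrite !addr_ge0 ?powR_ge0// mulr_ge0// sqr_ge0. Qed.

Lemma leb2_cellE : leb2 R (cell Om) = (area Om (carrier Om))%:E.
Proof.
rewrite /area setIidl; last by move=> x; exact: cell_carrier.
by rewrite fineK// ge0_fin_numE//; exact: leb2_cell_lty.
Qed.

Lemma min_exponent (p : \bar R) : (1 < p)%E ->
  1 < fine (Order.min p 2%:E) <= 2.
Proof.
case: p => [r| |]//; first by rewrite lte_fin => r1; rewrite -EFin_min /= lt_min r1 ge_min lexx orbT ltr1n.
by rewrite minye /= => _; rewrite ltr1n lexx.
Qed.

Lemma integral_power_bound (p : \bar R) (rho : plane R -> R) : (1 < p)%E -> in_Lp Om p rho ->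
  (\int[leb2 R]_(x in cell Om) (`|rho x| `^ fine (Order.min p 2%:E))%:E <=
   (power_bound p (fine (Lp_norm Om p rho)))%:E)%E.
Proof.
move=> p1 [_ mrho fin].
have mC := measurable_cell hOm.
have numK : Lp_norm Om p rho \is a fin_num by rewrite ge0_fin_numE//; exact: Lnorm_ge0.
set K := fine (Lp_norm Om p rho).
have K0 : 0 <= K by apply: fine_ge0; exact: Lnorm_ge0.
have KE : Lp_norm Om p rho = K%:E by rewrite fineK.
have mpow s : measurable_fun (cell Om : set (mplane R)) ((fun x => (`|rho x| `^ s)%:E) : mplane R -> \bar R).
  apply/measurable_EFinP; apply: (measurableT_comp (measurable_powR s)).
  exact: (measurableT_comp (@normr_measurable R setT)).
have pow0 s x : (0 <= (`|rho x| `^ s)%:E)%E by rewrite lee_fin powR_ge0.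
move: p1 KE; case: p fin numK @K K0 => [r| |] // fin numK K K0; last first.
  move=> _; rewrite /Lp_norm unlock => KE.
  rewrite minye /=.
  have T0 : (0 < leb2 R [set: mplane R])%E.
    apply: lt_le_trans (_ : leb2 R (cell Om) <= _)%E; last by apply: le_measure; rewrite ?inE.
    by rewrite leb2_cellE lte_fin area_gt0.
  rewrite T0 in KE.
  have := ess_sup_ge (leb2 R) (abse \o (EFin \o (rho \_ (cell Om)))).
  rewrite KE => aeK.
  apply: le_trans (_ : \int[leb2 R]_(x in cell Om) (K ^+ 2)%:E <= _)%E.
    apply: ae_ge0_le_integral => //.
    - by move=> x _; rewrite lee_fin sqr_ge0.
    - move: aeK; apply: filterS.
      move=> x /= xK cx; move: xK; rewrite patchE mem_set// lee_fin => xK.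
      by rewrite lee_fin powR_mulrn// ler_sqr ?nnegrE.
  rewrite integral_cst// leb2_cellE -EFinM lee_fin /power_bound /= powRr0.
  by rewrite lerDr addr_ge0.
rewrite lte_fin => r1 KE.
have r0 : r != 0 by rewrite gt_eqF// (lt_trans _ r1).
have E : (\int[leb2 R]_(x in cell Om) (`|rho x| `^ r)%:E = (K `^ r)%:E)%E.
  have := @poweR_Lnorm _ _ _ (leb2 R) (EFin \o (rho \_ (cell Om))) r r0.
  rewrite -[Lnorm _ _ _]/(Lp_norm Om r%:E rho) KE poweR_EFin => ->.
  rewrite [LHS]integral_mkcond; apply: eq_integral => x _.
  rewrite !patchE /= patchE; case: ifPn => //= _.
  by rewrite normr0 powR0.
have [r2|r2] := leP r 2.
  rewrite -EFin_min (min_idPl r2) E lee_fin /power_bound /=.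
  by rewrite addrAC lerDr addr_ge0// mulr_ge0// sqr_ge0.
rewrite -EFin_min (min_idPr (ltW r2)) /=.
apply: le_trans (_ : \int[leb2 R]_(x in cell Om) (1%:E + (`|rho x| `^ r)%:E) <= _)%E.
  apply: ge0_le_integral => //.
  - by apply: emeasurable_funD.
  - by move=> x _; rewrite -EFinD lee_fin powR_le_1D// ltW.
rewrite ge0_integralD//.
rewrite E integral_cst// mul1e leb2_cellE -EFinD lee_fin /power_bound /= lerDl.
by rewrite mulr_ge0// sqr_ge0.
Qed.

(** The mass of a cell is an integral of the density, to which the power splitting applies
   pointwise with [r] the density and [D] the displacement of the cell; this takes the
   place of the Hoelder inequality. *)
Lemma weighted_mass_bound (N : nat) (X : config R N) (rho : plane R -> R) (D : 'I_N -> R)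
    (KP l m th d : R) : (0 < N)%N -> distinct Om X ->
  measurable_fun (cell Om : set (mplane R)) (rho : mplane R -> measurableTypeR R) ->
  (\int[leb2 R]_(x in cell Om) (`|rho x| `^ (1 + th))%:E <= KP%:E)%E ->
  (forall i, 0 <= D i <= d) -> 0 < l -> 0 < m ->
  0 < th -> th <= 1 -> d `^ (1 - th) <= l * m `^ th ->
  \sum_(i < N) mass Om rho X i * D i <= l * KP + m * \sum_(i < N) volume Om X i * D i ^+ 2.
Proof.
move=> N0 dX mrho KPle Dd l0 m0 th0 th1 H.
have mC := measurable_cell hOm.
pose A i := cell Om `&` voronoi Om X i.
have mA i : measurable (A i : set (mplane R)).
  by apply: measurableI => //; exact: measurable_voronoi.
have mpow : measurable_fun (cell Om : set (mplane R)) ((fun x => `|rho x| `^ (1 + th)) : mplane R -> measurableTypeR R).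
  apply: (measurableT_comp (measurable_powR (1 + th))).
  exact: (measurableT_comp (@normr_measurable R setT)).
have ipow : (leb2 R).-integrable (cell Om : set (mplane R)) (EFin \o (fun x => `|rho x| `^ (1 + th))).
  apply/integrableP; split; first exact/measurable_EFinP.
  apply: le_lt_trans (ltry KP); apply: le_trans KPle.
  by under eq_integral => x _ do rewrite /= ger0_norm ?powR_ge0//.
have icst (c : R) : (leb2 R).-integrable (cell Om : set (mplane R)) (EFin \o (fun=> c)).
  by apply: (@integrable_cell _ _ hOm _ `|c|) => //; exact: measurable_cst.
have irho : (leb2 R).-integrable (cell Om : set (mplane R)) (EFin \o rho).
  apply: (@le_integrable _ _ _ _ _ mC _ (EFin \o (fun x => 1 + `|rho x| `^ (1 + th)))).
  - exact/measurable_EFinP.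
  - move=> x _; rewrite /= lee_fin [leRHS]ger0_norm ?addr_ge0 ?powR_ge0//.
    by rewrite -[leLHS]powRr1// powR_le_1D// lerDl ltW.
  - exact: (integrableD mC (icst 1) ipow).
have sub i : A i `<=` cell Om by exact: subIsetl.
have iA i f : (leb2 R).-integrable (cell Om : set (mplane R)) f -> (leb2 R).-integrable (A i : set (mplane R)) f.
  by move=> H'; exact: (integrableS mC (mA i) (sub i) H').
have cellwise i : mass Om rho X i * D i <=
    l * \int[leb2 R]_(x in A i) (`|rho x| `^ (1 + th)) + m * (volume Om X i * D i ^+ 2).
  have /andP[D0 Ddi] := Dd i.
  rewrite /mass -/(A i).
  have -> : m * (volume Om X i * D i ^+ 2) = \int[leb2 R]_(x in A i) (m * D i ^+ 2).
    by rewrite Rintegral_cst// /volume /area -/(A i); ring.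
  rewrite -RintegralZr//; last exact: iA.
  rewrite -RintegralZl//; last exact: iA.
  have i1 := integrableZl (mA i) l (iA i _ ipow).
  have i2 := iA i _ (icst (m * D i ^+ 2)).
  rewrite -RintegralD//; apply: le_Rintegral => //.
  - exact: (integrableZr (mA i) _ (iA i _ irho)).
  - exact: (integrableD (mA i) i1 i2).
  - move=> x _; apply: le_trans (_ : `|rho x| * D i <= _).
      by rewrite ler_wpM2r// ler_norm.
    exact: (power_split (d := d)).
apply: le_trans (ler_sum _ (fun i _ => cellwise i)) _.
rewrite big_split /= -!mulr_sumr lerD2r ler_pM2l// -lee_fin.
apply: le_trans KPle.
have tA : trivIset setT A.
  apply/trivIsetP => i j _ _ ij; apply/seteqP; split => // x [[_ Vi] [_ Vj]].
  by move/negP: ij; apply; apply/eqP; exact: voronoi_disj Vi Vj.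
set U := \big[setU/set0]_(i < N) A i.
have mU : measurable (U : set (mplane R)) by exact: bigsetU_measurable.
have UC : U `<=` cell Om by rewrite /U -bigcup_seq => x [i _ [cx _]].
have -> : (\sum_(i < N) \int[leb2 R]_(x in A i) (`|rho x| `^ (1 + th)))%:E =
    (\int[leb2 R]_(x in U) (`|rho x| `^ (1 + th))%:E)%E.
  rewrite /U (@ge0_integral_bigsetU _ _ _ (leb2 R) _ A _ (index_enum 'I_N) mA (index_enum_uniq _)).
  - rewrite -sumEFin; apply: eq_bigr => i _; rewrite /Rintegral fineK//.
    by apply: integrable_fin_num => //; exact: iA.
  - exact: sub_trivIset tA.
  - by apply/measurable_EFinP; exact: (measurable_funS mC UC mpow).
  - by move=> x _; rewrite lee_fin powR_ge0.
apply: ge0_subset_integral => //.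
exact/measurable_EFinP.
Qed.

End mass_bounds.

(** * The drift *)

Section drift_bound.
Context {R : realType}.
Variable (Om : region R).
Hypothesis hOm : admissible Om.

Lemma Lam_ge0 (v : R -> plane R -> plane R) (t : R) : 0 <= Lam Om v t.
Proof. by apply: fine_ge0; apply: integral_ge0 => s _; exact: c01norm_ge0. Qed.

Lemma gap_ge0 (N : nat) (X : config R N) : 0 <= gap Om X.
Proof. by apply: sumr_ge0 => i _; rewrite mulr_ge0 ?sqr_ge0 ?fine_ge0. Qed.

Lemma total_intensity_norm (T : R) (alpha : R -> R) :
  (leb1 R).-integrable (`]0, T[%classic : set (measurableTypeR R)) (EFin \o alpha) ->
  {ae leb1 R, forall t, 0 < t < T -> 0 <= alpha t} ->
  \int[leb1 R]_(t in `]0, T[) `|alpha t| = total_intensity T alpha.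
Proof.
move=> ia al0; rewrite /total_intensity /Rintegral; congr fine.
have mI : measurable (`]0, T[%classic : set (measurableTypeR R)) by exact: measurable_itv.
have ma : measurable_fun (`]0, T[%classic : set (measurableTypeR R)) (EFin \o alpha).
  exact: measurable_int ia.
apply: ae_eq_integral => //.
  by apply/measurable_EFinP; apply: (measurableT_comp (@normr_measurable R setT)); apply/measurable_EFinP.
move: al0; apply: filterS; first exact: (ae_filter_ringOfSetsType (leb1 R)).
move=> t H /=.
by rewrite in_itv /= => tT; rewrite ger0_norm// H.
Qed.

(** The masses are frozen at the initial time, like the initial volumes that [c4] compares
   with the current ones. The power splitting thus turns the drift into the intensity of
   the control plus the dissipated energy; the splitting parameter [a] is then matched to
   the total intensity. *)
Lemma drift_le (N : nat) (T : R) v (alpha : R -> R) (X : R -> config R N) (rho : plane R -> R)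
    (KP C1 h th c4 Z : R) :
  (0 < N)%N -> 0 < T ->
  (leb1 R).-integrable (`]0, T[%classic : set (measurableTypeR R)) (EFin \o alpha) ->
  {ae leb1 R, forall t, 0 < t < T -> 0 <= alpha t} ->
  distinct Om (X 0) ->
  measurable_fun (cell Om : set (mplane R)) (rho : mplane R -> measurableTypeR R) ->
  (\int[leb2 R]_(x in cell Om) (`|rho x| `^ (1 + th))%:E <= KP%:E)%E ->
  0 <= KP -> 0 < th -> th <= 1 -> 0 < C1 -> 0 < h -> 0 < c4 -> 0 <= Z ->
  (forall t, 0 < t < T -> forall i, enorm (displacement Om (X t) i) <= C1 * h) ->
  (forall t, 0 < t < T -> forall i, volume Om (X 0) i <= c4 * volume Om (X t) i) ->
  (forall (k : R -> R) (B : R), measurable_fun setT (k : measurableTypeR R -> measurableTypeR R) ->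
    (forall t, 0 <= k t <= B) ->
    {ae leb1 R, forall t, 0 < t < T -> k t <= alpha t * gap Om (X t)} ->
    \int[leb1 R]_(t in `]0, T[) k t <= Z * h ^+ 2) ->
  (drift Om T v alpha rho X <=
     (expR (Lam Om v T) * (C1 `^ (1 - th) * KP + c4 * Z) * h *
      powR (total_intensity T alpha) (1 + th)^-1)%:E)%E.
Proof.
move=> N0 T0 ia al0 dX0 mrho KPle KP0 th0 th1 C10 h0 c40 Z0 hD hV Hdis.
have mI : measurable (`]0, T[%classic : set (measurableTypeR R)) by exact: measurable_itv.
set E := expR (Lam Om v T); have E0 : 0 < E by exact: expR_gt0.
set A := total_intensity T alpha.
have A0 : 0 <= A.
  by rewrite /A -total_intensity_norm//; apply: Rintegral_ge0 => t _; exact: normr_ge0.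
pose al := (fun t => `|alpha t|) \_ (`]0, T[%classic : set (measurableTypeR R)).
have mal : measurable_fun setT (al : measurableTypeR R -> measurableTypeR R).
  apply/(measurable_restrictT _ mI).
  apply: (measurableT_comp (@normr_measurable R setT)).
  by apply/measurable_EFinP; exact: measurable_int ia.
have al_ge0 t : 0 <= al t by rewrite /al patchE; case: ifP.
have alE t : 0 < t < T -> al t = `|alpha t|.
  by move=> tT; rewrite /al patchE ifT// inE /= in_itv.
have ial : (leb1 R).-integrable (`]0, T[%classic : set (measurableTypeR R)) (EFin \o al).
  apply: (eq_integrable mI _ _ _ (integrable_abse ia)) => t; rewrite inE /= in_itv /= => tT.
  by rewrite alE.
have intal : \int[leb1 R]_(t in `]0, T[) al t = A.
  rewrite /A -total_intensity_norm//; apply: eq_Rintegral => t; rewrite inE /= in_itv /= => tT.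
  by rewrite alE.
pose pp := 1 + th.
have pp0 : pp != 0 by rewrite gt_eqF// addr_gt0.
apply: integral_le_minorants => s B ms sB sle.
have B0 : 0 <= B by have /andP[s0 sb] := sB 0; exact: le_trans s0 sb.
(* The pair [l], [m = a / h] makes the splitting condition an equality when the radius
   is [C1 * h]. *)
have core (a : R) : 0 < a ->
    \int[leb1 R]_(t in `]0, T[) s t <= E * (C1 `^ (1 - th) * h * a / a `^ pp * KP * A + a * c4 * Z * h).
  move=> a0; set l := C1 `^ (1 - th) * h * a / a `^ pp; pose m := a / h.
  have m0 : 0 < m by exact: divr_gt0.
  have l0 : 0 < l by rewrite !mulr_gt0 ?invr_gt0 ?powR_gt0.
  have lm : (C1 * h) `^ (1 - th) <= l * m `^ th.
    have hE : h = h `^ (1 - th) * h `^ th.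
      by rewrite -powRD ?subrK ?powRr1 ?(ltW h0)//; apply/implyP => _; rewrite gt_eqF.
    have aE : a `^ pp = a * a `^ th.
      by rewrite powRD ?powRr1 ?(ltW a0)//; apply/implyP => _; rewrite gt_eqF.
    have mE : a `^ th = m `^ th * h `^ th.
      by rewrite -powRM ?(ltW m0) ?(ltW h0)// divfK ?gt_eqF.
    rewrite powRM ?(ltW C10) ?(ltW h0)// /l aE mE {2}hE.
    have p1 : m `^ th != 0 by rewrite gt_eqF// powR_gt0.
    have p2 : h `^ th != 0 by rewrite gt_eqF// powR_gt0.
    have p3 : a != 0 by rewrite gt_eqF.
    move: (m `^ th) (h `^ th) p1 p2 => x y p1 p2.
    by rewrite le_eqVlt; apply/orP; left; apply/eqP; field; rewrite p1 p2 p3.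
  pose q := l * KP.
  have q0 : 0 <= q by rewrite mulr_ge0// ltW.
  have mc0 : 0 < m * c4 by exact: mulr_gt0.
  pose k t := Num.max ((s t / E - al t * q) / (m * c4)) 0.
  have mk : measurable_fun setT (k : measurableTypeR R -> measurableTypeR R).
    apply: measurable_maxr => //; apply: measurable_funM => //.
    by apply: measurable_funB; apply: measurable_funM.
  have kB t : 0 <= k t <= B / E / (m * c4).
    have /andP[s0 sb] := sB t.
    rewrite /k le_max lexx orbT /= ge_max; apply/andP; split; last first.
      by rewrite !mulr_ge0 ?invr_ge0 ?(ltW E0) ?(ltW mc0).
    rewrite ler_pM2r ?invr_gt0// lerBlDr; apply: (@le_trans _ _ (B / E)).
      by rewrite ler_pM2r ?invr_gt0.
    by rewrite lerDl mulr_ge0.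
  have kgap : {ae leb1 R, forall t, 0 < t < T -> k t <= alpha t * gap Om (X t)}.
    move: al0; apply: filterS; first exact: (ae_filter_ringOfSetsType (leb1 R)).
    move=> t H tT; have a0t := H tT.
    rewrite /k ge_max (mulr_ge0 a0t (gap_ge0 _)) andbT ler_pdivrMr//.
    rewrite (alE _ tT) ger0_norm// lerBlDr ler_pdivrMr//.
    have bnd : \sum_(i < N) mass Om rho (X 0) i * enorm (displacement Om (X t) i) <=
        q + gap Om (X t) * (m * c4).
      have W := weighted_mass_bound hOm N0 dX0 mrho KPle (fun i => introT andP
        (conj (enorm_ge0 _) (hD t tT i))) l0 m0 th0 th1 lm.
      apply: le_trans W _; rewrite lerD2l [leRHS]mulrC -[leRHS]mulrA ler_pM2l// /gap mulr_sumr.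
      apply: ler_sum => i _.
      by rewrite [leRHS]mulrA; apply: ler_wpM2r; [exact: sqr_ge0|exact: hV].
    have rhs0 : 0 <= q + gap Om (X t) * (m * c4).
      by rewrite addr_ge0// mulr_ge0 ?gap_ge0// ltW.
    apply: le_trans (sle t tT) _; rewrite ge_max; apply/andP; split; last first.
      exact: mulr_ge0 (addr_ge0 (mulr_ge0 (mulr_ge0 a0t (gap_ge0 _)) (ltW mc0)) (mulr_ge0 a0t q0)) (ltW E0).
    apply: (@le_trans _ _ (expR (Lam Om v T - Lam Om v t) * alpha t * (q + gap Om (X t) * (m * c4)))).
      by rewrite ler_wpM2l// mulr_ge0// expR_ge0.
    have -> : (alpha t * gap Om (X t) * (m * c4) + alpha t * q) * E =
      E * alpha t * (q + gap Om (X t) * (m * c4)) by ring.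
    by rewrite ler_wpM2r// ler_wpM2r// ler_expR gerBl; exact: Lam_ge0.
  have := Hdis k _ mk kB kgap.
  have ik : (leb1 R).-integrable (`]0, T[%classic : set (measurableTypeR R)) (EFin \o k).
    apply: (@integrable_bounded_itv _ _ _ (B / E / (m * c4))) => // t.
    by have /andP[k0 kb] := kB t; rewrite ger0_norm.
  have is_ : (leb1 R).-integrable (`]0, T[%classic : set (measurableTypeR R)) (EFin \o s).
    apply: (@integrable_bounded_itv _ _ _ B) => // t.
    by have /andP[k0 kb] := sB t; rewrite ger0_norm.
  have i1 := integrableZl mI (E * q) ial.
  have i2 := integrableZl mI (E * (m * c4)) ik.
  have : \int[leb1 R]_(t in `]0, T[) s t <=
      \int[leb1 R]_(t in `]0, T[) (E * q * al t + E * (m * c4) * k t).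
    apply: le_Rintegral => //; first exact: (integrableD mI i1 i2).
    move=> t _; have kt : (s t / E - al t * q) / (m * c4) <= k t by rewrite /k le_max lexx.
    move: kt; rewrite ler_pdivrMr// lerBlDr ler_pdivrMr// => /le_trans; apply.
    by rewrite le_eqVlt; apply/orP; left; apply/eqP; ring.
  rewrite RintegralD// !RintegralZl// intal.
  move: (\int[leb1 R]_(t in _) k t) => kk H1 H2; apply: le_trans H1 _.
  have -> : E * (l * KP * A + a * c4 * Z * h) = E * q * A + E * (m * c4) * (Z * h ^+ 2).
    by rewrite /q /m; field; rewrite gt_eqF.
  by rewrite lerD2l; apply: ler_wpM2l => //; rewrite mulr_ge0 ?(ltW E0) ?(ltW mc0).
(* The two terms balance for [a] the root of order [1 + th] of the total intensity; if it
   vanishes, [a] tends to 0. *)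
have [A00|An0] := eqVneq A 0.
  rewrite A00 powR0 ?invr_eq0// mulr0.
  apply: (@ler_small_error _ _ _ (E * (c4 * Z * h))) => a a0.
  apply: le_trans (core a a0) _; rewrite A00 mulr0 add0r.
  by rewrite le_eqVlt; apply/orP; left; apply/eqP; ring.
have Ap : 0 < A by rewrite lt_neqAle eq_sym An0.
set a := A `^ (1 + th)^-1.
have a0 : 0 < a by exact: powR_gt0.
have aA : a `^ pp = A by rewrite /a -powRrM mulVf// powRr1.
apply: le_trans (core _ a0) _; rewrite aA.
by rewrite le_eqVlt; apply/orP; left; apply/eqP; field.
Qed.

End drift_bound.

(** * Stability of the generators along the flow *)

Section tubes.
Context {R : realType}.
Variable (Om : region R).
Hypothesis hOm : admissible Om.

Lemma pdist_le_cdist (N : nat) (X Y : config R N) i :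
  pdist Om (X i) (Y i) <= cdist Om X Y.
Proof.
rewrite -[leLHS](ger0_norm (pdist_ge0 hOm _ _)) -sqrtr_sqr ler_wsqrtr//.
by rewrite (bigD1 i)//= lerDl sumr_ge0// => j _; exact: sqr_ge0.
Qed.

Lemma cdistxx (N : nat) (X : config R N) : cdist Om X X = 0.
Proof.
rewrite /cdist big1 ?sqrtr0// => i _.
by rewrite (pdistxx hOm) expr0n.
Qed.

Lemma tube_sub_closure (N : nat) (r : R) : tube Om N r `<=` tube_closure Om N r.
Proof. by move=> X tX e e0; exists X => //; rewrite cdistxx. Qed.

Lemma tube_minimizer (N : nat) (r : R) (X : config R N) :
  minimizers Om N !=set0 -> tube Om N r X ->
  exists Y, [/\ minimizers Om N Y, tube Om N r Y & cdist Om X Y < r].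
Proof.
move=> [M mM] [cX dX].
have [|_ [Y mY <-] Yr] := inf_lt _ dX.
  by exists (cdist Om X M), M.
exists Y; split => //; split; first by case: mY.
apply: (@le_lt_trans _ _ 0); last exact: le_lt_trans (sqrtr_ge0 _) Yr.
rewrite -(cdistxx Y); apply: ge_inf; last by exists Y.
by exists 0 => _ [Z _ <-]; exact: sqrtr_ge0.
Qed.

End tubes.
Theorem corollary3p2 (R : realType) (Om : region R) (hOm : admissible Om)
    (C1 : R) (hC1 : 0 < C1) :
  exists C3 : R, 0 < C3 /\
  exists C4 : R -> R, (forall lam, 0 < C4 lam) /\
  exists C5 : R -> \bar R -> R -> R, (forall lam p K, 0 < C5 lam p K) /\
  forall (T : R) (v : R -> plane R -> plane R),
    0 < T ->
    L1_C01 Om T v ->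
    {ae leb1 R, forall t, 0 < t < T -> tangential Om (v t)} ->
  forall (N : nat) (r : R) (X0 : config R N) (alpha : R -> R)
    (X : R -> config R N),
    (0 < N)%N ->
    minimizers Om N !=set0 ->
    cdist_compact Om (minimizers Om N) ->
    0 < r ->
    (forall Y : config R N, tube_closure Om N r Y -> distinct Om Y) ->
    tube_closure Om N r `<=` configs Om N ->
    (forall Y : config R N, tube Om N r Y -> max_diam Om Y <= C1 * mesh Om N) ->
    tube Om N r X0 ->
    ((energy Om X0 - min_energy Om N)%:E < barrier Om N r)%E ->
    (leb1 R).-integrable `]0, T[ (EFin \o alpha) ->
    {ae leb1 R, forall t, 0 < t < T -> 0 <= alpha t} ->
    solution Om T v alpha X0 X ->
    (forall Y : R -> config R N, solution Om T v alpha X0 Y ->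
       forall t, 0 <= t <= T -> Y t = X t) ->
    (forall t, 0 <= t <= T -> tube Om N r (X t)) ->
    r <= C3 * mesh Om N ->
    [/\ (forall t, 0 <= t <= T -> forall i j, i != j ->
           2 * C3 * mesh Om N <= pdist Om (X t i) (X t j)),
        (forall t, 0 <= t <= T -> forall i,
           mesh Om N ^+ 2 / C4 (Lam Om v T) <= volume Om (X t) i /\
           volume Om (X 0) i / C4 (Lam Om v T) <= volume Om (X t) i),
        (\int[leb1 R]_(t in `]0%R, T[) (alpha t * gap Om (X t))%:E <=
           (C4 (Lam Om v T) * mesh Om N ^+ 2)%:E)%E &
        (forall (p : \bar R) (rho0 : plane R -> R),
           (1 < p)%E ->
           in_Lp Om p rho0 ->
           {ae leb2 R, forall x, cell Om x -> 0 <= rho0 x} ->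
           (drift Om T v alpha rho0 X <=
              (C5 (Lam Om v T) p (fine (Lp_norm Om p rho0)) * mesh Om N *
               powR (total_intensity T alpha)
                    (fine (Order.min p 2%:E))^-1)%:E)%E)].
Proof.
have [kp kp0 Hsep] := minimizer_separation hOm hC1.
have ar0 := area_gt0 hOm.
have L0 : 0 < Num.sqrt (area Om (carrier Om)) by rewrite sqrtr_gt0.
have [c c0 Hball] := ball_density hOm L0.
have [C C0 Hdis] := dissipation_bound hOm.
(* The generators of a minimizer are [kp * h] apart; moving each by less than
   [C3 * h <= kp * h / 4] leaves [2 * C3 * h]. With [C3 <= 1] the radius [C3 * h]
   stays in the range of the density bound. *)
pose C3 := Num.min 1 (kp / 4).
have C30 : 0 < C3 by rewrite lt_min ltr01 divr_gt0.
(* Every volume lies between [c * (C3 * h) ^+ 2] and [4 * (C1 * h) ^+ 2]. *)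
pose a0 := 1 / (c * C3 ^+ 2).
pose c4 := 4 * C1 ^+ 2 / (c * C3 ^+ 2).
have cC0 : 0 < c * C3 ^+ 2 by rewrite mulr_gt0// exprn_gt0.
have a00 : 0 < a0 by exact: divr_gt0.
have c40 : 0 < c4 by rewrite divr_gt0// mulr_gt0// exprn_gt0.
pose Z (lam : R) := C * C1 ^+ 2 * (1 + `|lam|).
have Z0 lam : 0 < Z lam by rewrite !mulr_gt0 ?exprn_gt0// ltr_wpDr.
exists C3; split => //.
exists (fun lam => a0 + c4 + Z lam); split; first by move=> lam; rewrite !addr_gt0.
exists (fun lam p K => expR lam * (C1 `^ (1 - (fine (Order.min p 2%:E) - 1)) * power_bound Om p K + c4 * Z lam)).
split.
  move=> lam p K; apply: mulr_gt0; first exact: expR_gt0.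
  apply: ltr_wpDl; last exact: mulr_gt0.
  by rewrite mulr_ge0 ?powR_ge0 ?power_bound_ge0.
move=> T v T0 Lv _ N r X0 alpha X N0 M0 _ r0 Hd _ Hdiam _ _ ia al0 solX _ Htube rC3.
have [X00 cdX acX dX] := solX.
set h := mesh Om N.
have h0 : 0 < h by exact: mesh_gt0.
have zin : 0 <= (0 : R) <= T by rewrite lexx ltW.
have C34 : 4 * C3 <= kp by rewrite mulrC -ler_pdivlMr// ge_min lexx orbT.
have C31 : C3 <= 1 by rewrite ge_min lexx.
have sep t : 0 <= t <= T -> forall i j, i != j -> 2 * C3 * h <= pdist Om (X t i) (X t j).
  move=> tT i j ij.
  have [Y [mY tY XY]] := tube_minimizer hOm M0 (Htube t tT).
  have dY := Hd Y (tube_sub_closure hOm tY).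
  have sY := Hsep N Y N0 mY dY (Hdiam Y tY) i j ij.
  have e1 := le_lt_trans (pdist_le_cdist hOm (X t) Y i) XY.
  have e2 := le_lt_trans (pdist_le_cdist hOm (X t) Y j) XY.
  have t1 := pdist_triangle hOm (Y i) (X t i) (Y j).
  have t2 := pdist_triangle hOm (X t i) (X t j) (Y j).
  have e3 : 4 * C3 * h <= kp * h by rewrite ler_pM2r.
  move: e1 e2 e3 t1 t2 sY rC3; rewrite (pdistC hOm (Y i) (X t i)) -/h.
  clearbody h C3; move: (pdist _ _ _) (pdist _ _ _) (pdist _ _ _) (pdist _ _ _) (pdist _ _ _).
  by move=> *; lra.
have vol t : 0 <= t <= T -> forall i, c * C3 ^+ 2 * h ^+ 2 <= volume Om (X t) i.
  move=> tT i; have [cXt dXt] := cdX t tT.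
  rewrite -mulrA -exprMn.
  apply: (separated_volume hOm Hball) => //.
  - exact: mulr_gt0.
  - by apply: le_trans (mesh_le hOm N0); rewrite ler_piMl// ltW.
  - by move=> j ji; rewrite mulrA; apply: sep => //; rewrite eq_sym.
have h20 : 0 < h ^+ 2 by rewrite exprn_gt0.
have V0 t : 0 <= t <= T -> forall i, volume Om (X t) i != 0.
  by move=> tT i; rewrite gt_eqF//; apply: lt_le_trans (vol t tT i); exact: mulr_gt0.
have hdm t : 0 <= t <= T -> max_diam Om (X t) <= C1 * h by move=> tT; exact: Hdiam (Htube t tT).
have V4 t : 0 <= t <= T -> forall i, volume Om (X 0) i <= c4 * volume Om (X t) i.
  move=> tT i; have [cX0 dX0] := cdX 0 zin.
  apply: le_trans (volume_le hOm N0 cX0 dX0 (hdm 0 zin) i) _.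
  apply: le_trans (ler_wpM2l (ltW c40) (vol t tT i)).
  by rewrite /c4 [leRHS]mulrA divfK ?gt_eqF// exprMn mulrA.
set lam := Lam Om v T.
have lam0 : 0 <= lam by exact: Lam_ge0.
set C4 := a0 + c4 + Z lam.
have C40 : 0 < C4 by rewrite !addr_gt0.
(* The energy estimate, in the form shared by the bounds on the dissipation and on the
   drift. *)
have Hk (k : R -> R) (B : R) : measurable_fun setT (k : measurableTypeR R -> measurableTypeR R) ->
    (forall t, 0 <= k t <= B) ->
    {ae leb1 R, forall t, 0 < t < T -> k t <= alpha t * gap Om (X t)} ->
    \int[leb1 R]_(t in `]0, T[) k t <= Z lam * h ^+ 2.
  move=> mk kB kle.
  apply: le_trans (Hdis N T (C1 * h) v alpha X0 X k B N0 T0 Lv al0 solX hdm V0 mk kB kle) _.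
  by rewrite /Z (ger0_norm lam0) exprMn -/lam; rewrite le_eqVlt; apply/orP; left; apply/eqP; ring.
have in_cc t : 0 < t < T -> 0 <= t <= T by case/andP => ? ?; rewrite !ltW.
split.
- exact: sep.
- move=> t tT i; split; rewrite ler_pdivrMr//.
    apply: le_trans (_ : a0 * volume Om (X t) i <= _).
      by rewrite /a0 mulrAC mul1r ler_pdivlMr// mulrC; exact: vol.
    by rewrite mulrC ler_wpM2l ?fine_ge0// /C4 -addrA lerDl addr_ge0// ltW.
  apply: le_trans (V4 t tT i) _; rewrite mulrC ler_wpM2l ?fine_ge0// /C4.
  by rewrite addrAC lerDr addr_ge0// ltW.
- apply: le_trans (_ : (Z lam * h ^+ 2)%:E <= _)%E; last first.
    by rewrite lee_fin ler_pM2r// /C4 lerDr addr_ge0// ltW.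
  apply: integral_le_minorants => s B ms sB sle; apply: (Hk s B ms sB).
  move: al0; apply: filterS; first exact: (ae_filter_ringOfSetsType (leb1 R)).
  move=> t H tT; apply: le_trans (sle t tT) _.
  by rewrite ge_max lexx /= mulr_ge0 ?gap_ge0// H.
- move=> p rho p1 Lp _.
  have /andP[pp1 pp2] := min_exponent p1.
  have := integral_power_bound hOm p1 Lp.
  set pp := fine _; set K := fine _.
  move: pp1 pp2; rewrite -/pp => pp1 pp2.
  have ppE : pp = 1 + (pp - 1) by ring.
  rewrite {1}ppE => KP.
  have [cX0 dX0] := cdX 0 zin; have [_ mrho _] := Lp.
  have KB : 0 <= power_bound Om p K by exact: power_bound_ge0.
  have th0 : 0 < pp - 1 by rewrite subr_gt0.
  have th1 : pp - 1 <= 1 by rewrite lerBlDr.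
  have hD t : 0 < t < T -> forall i, enorm (displacement Om (X t) i) <= C1 * h.
    move=> tT i; have [cXt dXt] := cdX t (in_cc t tT).
    apply: (displacement_le hOm N0 cXt dXt); first exact: hdm (in_cc t tT).
    exact: V0 (in_cc t tT) i.
  have hV t : 0 < t < T -> forall i, volume Om (X 0) i <= c4 * volume Om (X t) i.
    by move=> tT; exact: V4 (in_cc t tT).
  have := drift_le hOm v N0 T0 ia al0 dX0 mrho KP KB th0 th1 hC1 h0 c40 (ltW (Z0 lam)) hD hV Hk.
  by rewrite -ppE.
Qed.
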